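(* Let $q$ be an even prime power. There are exactly $15$ orbits, under the group $K\cong \mathrm{PGL}(3,q)$, of planes of $\mathrm{PG}(5,q)$ containing at least one rank-1 point. For $q\neq 2$, representatives of these $15$ orbits are the planes with the following matrix representations (where $\mathrm{Tr}$ is the trace from $\mathbb{F}_q$ to $\mathbb{F}_2$, and the parameter $c\in\mathbb{F}_q\setminus\{0\}$ may be chosen separately in each case subject to the stated condition): $$\Sigma_1:\begin{pmatrix} x&y&0\\ y&z&0\\ 0&0&0\end{pmatrix},\quad \Sigma_2:\begin{pmatrix} x&0&0\\ 0&y&0\\ 0&0&z\end{pmatrix},\quad \Sigma_3:\begin{pmatrix} x&0&z\\ 0&y&0\\ z&0&0\end{pmatrix},\quad \Sigma_4:\begin{pmatrix} x&0&z\\ 0&y&z\\ z&z&0\end{pmatrix},\quad \Sigma_5:\begin{pmatrix} x&0&z\\ 0&y&z\\ z&z&z\end{pmatrix},$$ $$\Sigma_6:\begin{pmatrix} x&0&0\\ 0&y+cz&z\\ 0&z&y\end{pmatrix}\ (\mathrm{Tr}(c^{-1})=1),\quad \Sigma_7:\begin{pmatrix} x&y&z\\ y&0&0\\ z&0&0\end{pmatrix},\quad \Sigma_8:\begin{pmatrix} x&y&0\\ y&0&z\\ 0&z&0\end{pmatrix},\quad \Sigma_9:\begin{pmatrix} x&y&0\\ y&z&z\\ 0&z&0\end{pmatrix},$$ $$\Sigma_{10}:\begin{pmatrix} x&y&0\\ y&z&0\\ 0&0&z\end{pmatrix},\quad \Sigma_{11}:\begin{pmatrix} x&y&0\\ y&z&z\\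 0&z&x+z\end{pmatrix},\quad \Sigma_{15}:\begin{pmatrix} x&y&z\\ y&z&0\\ z&0&0\end{pmatrix},$$ together with three orbits $\Sigma_{12},\Sigma_{13},\Sigma_{14}$ if $q>4$, and $\Sigma_{12},\Sigma_{13},\Sigma_{14}'$ if $q=4$. Here $\Sigma_{12},\Sigma_{13},\Sigma_{14}$ are represented by $$\pi_c:\begin{pmatrix} x&y&cx\\ y&y+z&0\\ cx&0&c^2x+z\end{pmatrix}$$ with the following conditions on $c$: - $\Sigma_{12}$: $\mathrm{Tr}(c)=1$, and moreover $c^{-1}$ is not admissible if $q$ is an odd power of $2$; - $\Sigma_{13}$: $\mathrm{Tr}(c)=0$, and moreover $c^{-1}$ is not admissible if $q$ is an even power of $2$; - $\Sigma_{14}$ (only for $q>4$): $\mathrm{Tr}(c)=\mathrm{Tr}(1)$ and $c^{-1}$ is admissible; and, for $q=4$, $\Sigma_{14}'$ is represented by $$\begin{pmatrix} x+z&z&z\\ z&y+z&z\\ z&z&y\end{pmatrix}.$$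
   Context: A point $(y_0,y_1,y_2,y_3,y_4,y_5)$ of $\mathrm{PG}(5,q)$ is represented by the symmetric matrix $\begin{pmatrix} y_0&y_1&y_2\\ y_1&y_3&y_4\\ y_2&y_4&y_5\end{pmatrix}$, and its rank is the rank of this matrix. The rank-1 points are exactly the points of the Veronese surface $\mathcal{V}(\mathbb{F}_q)$, the image of $\nu:\mathrm{PG}(2,q)\to\mathrm{PG}(5,q)$, $(u_0,u_1,u_2)\mapsto(u_0^2,u_0u_1,u_0u_2,u_1^2,u_1u_2,u_2^2)$. The group $K\leq \mathrm{PGL}(6,q)$ consists of the projectivities induced by $M\mapsto AMA^T$ on symmetric $3\times3$ matrices, $A\in\mathrm{GL}(3,q)$; it is isomorphic to $\mathrm{PGL}(3,q)$. A matrix with entries linear forms in $x,y,z$ represents the plane consisting of all points whose matrix is obtained by substituting $(x,y,z)\in\mathrm{PG}(2,q)$. An element $a\in\mathbb{F}_q$ is called admissible if $a=\dfrac{v+v^{-1}}{(1+v+v^{-1})^3}$ for some $v\in\mathbb{F}_q\setminus\mathbb{F}_4$, meaning $v \in \mathbb{F}_q$ with $v\notin\{0,1\}$ and $v^2+v+1\ne 0$. *)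

(* Defs.v *)
From HB Require Import structures.
From mathcomp Require Import all_boot all_order all_algebra all_fingroup.
From mathcomp Require Import all_solvable all_field.

Set Implicit Arguments.
Unset Strict Implicit.
Unset Printing Implicit Defensive.

Import GRing.Theory.
Local Open Scope ring_scope.

Section FiniteVspace.
Import VectorInternalTheory.
Variables (F : finFieldType) (vT : vectType F).
HB.instance Definition _ := [Countable of {vspace vT} by <:].
HB.instance Definition _ := [Finite of {vspace vT} by <:].
End FiniteVspace.

Section Coordinates.
Variable F : fieldType.

Definition mx3 (s : seq (seq F)) : 'M[F]_3 := \matrix_(i, j) (nth [::] s i)`_j.

Definition sym_of_pt (y : 'rV[F]_6) : 'M[F]_3 :=
  let y_ k := y 0 (inord k) in
  mx3 [:: [:: y_ 0%N; y_ 1%N; y_ 2%N];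
          [:: y_ 1%N; y_ 3%N; y_ 4%N];
          [:: y_ 2%N; y_ 4%N; y_ 5%N]].

Definition pt_of_sym (M : 'M[F]_3) : 'rV[F]_6 :=
  let m i j := M (inord i) (inord j) in
  \row_k [:: m 0%N 0%N; m 0%N 1%N; m 0%N 2%N; m 1%N 1%N; m 1%N 2%N; m 2%N 2%N]`_k.

Lemma sym_of_ptK : cancel sym_of_pt pt_of_sym.
Proof.
move=> y; apply/rowP=> k; rewrite mxE.
by case: k => [[|[|[|[|[|[|//]]]]]] lt_k6];
  rewrite /= mxE !inordK //=; congr (y 0 _); apply: val_inj; rewrite /= inordK.
Qed.

Lemma pt_of_symK M : M^T = M -> sym_of_pt (pt_of_sym M) = M.
Proof.
move=> symM; have symE i j : M i j = M j i by rewrite -{1}symM mxE.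
apply/matrixP=> i j; rewrite mxE.
case: i j => [[|[|[|//]]] lt_i] [[|[|[|//]]] lt_j];
  rewrite /= mxE !inordK //=; 
  first [by congr (M _ _); apply: val_inj; rewrite /= inordK
       | by rewrite symE; congr (M _ _); apply: val_inj; rewrite /= inordK].
Qed.

Lemma sym_of_pt_sym y : (sym_of_pt y)^T = sym_of_pt y.
Proof.
apply/matrixP=> i j; rewrite !mxE.
by case: i j => [[|[|[|//]]] ?] [[|[|[|//]]] ?].
Qed.

Fact sym_of_pt_is_linear : linear sym_of_pt.
Proof.
move=> a u v; apply/matrixP=> i j; rewrite /sym_of_pt /mx3 !mxE.
by case: i j => [[|[|[|//]]] ?] [[|[|[|//]]] ?]; rewrite /= ?mxE.
Qed.
HB.instance Definition _ :=
  GRing.isLinear.Build F 'rV[F]_6 'M[F]_3 _ sym_of_pt sym_of_pt_is_linear.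

Fact pt_of_sym_is_linear : linear pt_of_sym.
Proof.
move=> a M N; apply/rowP=> k; rewrite /pt_of_sym !mxE.
by case: k => [[|[|[|[|[|[|//]]]]]] ?]; rewrite /= ?mxE.
Qed.
HB.instance Definition _ :=
  GRing.isLinear.Build F 'M[F]_3 'rV[F]_6 _ pt_of_sym pt_of_sym_is_linear.

Definition congr_pt (A : 'M[F]_3) (y : 'rV[F]_6) : 'rV[F]_6 :=
  pt_of_sym (A *m sym_of_pt y *m A^T).

Fact congr_pt_is_linear A : linear (congr_pt A).
Proof.
by move=> a u v; rewrite /congr_pt !linearP /= mulmxDl -scalemxAl linearP.
Qed.
HB.instance Definition _ A :=
  GRing.isLinear.Build F 'rV[F]_6 'rV[F]_6 _ (congr_pt A) (congr_pt_is_linear A).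

Lemma sym_congr_pt A y : sym_of_pt (congr_pt A y) = A *m sym_of_pt y *m A^T.
Proof.
by rewrite pt_of_symK // !trmx_mul trmxK sym_of_pt_sym mulmxA.
Qed.

Lemma congr_pt1 y : congr_pt 1%:M y = y.
Proof. by rewrite /congr_pt trmx1 mulmx1 mul1mx sym_of_ptK. Qed.

Lemma congr_ptM A B y : congr_pt B (congr_pt A y) = congr_pt (B *m A) y.
Proof. by rewrite {1}/congr_pt sym_congr_pt /congr_pt trmx_mul !mulmxA. Qed.

End Coordinates.

Section Projectivities.
Variable F : finFieldType.

(* PG(5,q) is the lattice of subspaces of F^6 (points have dimension 1, planes
   dimension 3), and a projectivity is identified with the permutation it
   induces on that lattice. *)
Local Notation PG5 := {vspace 'rV[F]_6}.

Definition congr_vs (A : 'M[F]_3) (U : PG5) : PG5 := (linfun (congr_pt A) @: U)%VS.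

Definition K : {set {perm PG5}} :=
  [set s : {perm PG5} |
    [exists A in unitmx, [forall U : PG5, s U == congr_vs A U]]].

Lemma congr_vs1 U : congr_vs 1%:M U = U.
Proof.
rewrite /congr_vs (_ : linfun _ = \1%VF) ?lim1g //.
by apply/lfunP=> y; rewrite lfunE /= congr_pt1 id_lfunE.
Qed.

Lemma congr_vsM A B U : congr_vs B (congr_vs A U) = congr_vs (B *m A) U.
Proof.
rewrite /congr_vs -limg_comp; congr (_ @: _)%VS.
by apply/lfunP=> y; rewrite comp_lfunE !lfunE /= congr_ptM.
Qed.

Fact K_group_set : group_set K.
Proof.
apply/group_setP; split=> [|s t].
  rewrite inE; apply/exists_inP; exists 1%:M; first exact: unitmx1.
  by apply/forallP=> U; rewrite perm1 congr_vs1.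
rewrite !inE => /exists_inP[A uA /forallP sA] /exists_inP[B uB /forallP tB].
apply/exists_inP; exists (B *m A); first by rewrite unitmx_mul uB.
by apply/forallP=> U; rewrite permM (eqP (tB _)) (eqP (sA _)) congr_vsM.
Qed.
Canonical K_group := Group K_group_set.

Lemma congr_vs_inj A : A \in unitmx -> injective (congr_vs A).
Proof.
move=> uA; apply: (can_inj (g := congr_vs (invmx A))) => U.
by rewrite congr_vsM mulVmx // congr_vs1.
Qed.

Lemma congr_vs_K A (uA : A \in unitmx) : perm (congr_vs_inj uA) \in K.
Proof.
rewrite inE; apply/exists_inP; exists A => //.
by apply/forallP=> U; rewrite permE.
Qed.

Definition rank1_planes : {set PG5} :=
  [set U : PG5 | (\dim U == 3%N) &&
    [exists y : 'rV[F]_6, (y \in U) && (\rank (sym_of_pt y) == 1%N)]].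

Definition rank1_plane_orbits : {set {set PG5}} :=
  [set orbit 'P K U | U in rank1_planes].

End Projectivities.

Arguments K F : clear implicits.
Arguments rank1_planes F : clear implicits.
Arguments rank1_plane_orbits F : clear implicits.

Section Trace.
Variables (F : finFieldType) (charF2 : 2%N \in [pchar F]).

(* pPrimeCharType charF2 is F viewed as an extension of 'F_2. *)
Definition Tr (a : F) : F :=
  galTrace 1 {: pPrimeCharType charF2} (a : pPrimeCharType charF2).

Lemma TrE a : Tr a = \sum_(i < logn 2 #|F|) a ^+ (2 ^ i).
Proof.
rewrite /Tr; set L := pPrimeCharType charF2.
have [s /eqP genG sE] := finField_galois_generator (sub1v {: L}).
have{} sE x : s x = x ^+ 2 by rewrite sE ?memvf // dimv1 expn1 card_Fp.
have sXE i x : (s ^+ i)%g x = x ^+ (2 ^ i).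
  elim: i x => [|i IHi] x; first by rewrite gal_id.
  by rewrite expgSr galM ?memvf // sE IHi expnSr exprM.
have ord_s : #[s]%g = logn 2 #|F|.
  rewrite orderE -genG -galois_dim ?finField_galois ?sub1v //.
  by rewrite dimv1 divn1 pprimeChar_dimf.
rewrite /galTrace genG -ord_s.
have -> : <[s]>%g = [set (s ^+ i)%g | i : 'I_#[s]%g].
  apply/setP=> t; apply/idP/imsetP=> [/cyclePmin[i lt_i ->]|[i _ ->]].
    by exists (Ordinal lt_i).
  exact: mem_cycle.
rewrite big_imset /=; first by apply: eq_bigr => i _; rewrite sXE.
move=> i j _ _ /eqP; rewrite eq_expg_mod_order !modn_small //.
by move/eqP/val_inj.
Qed.

End Trace.

Section Representatives.
Variable F : finFieldType.

(* M is meant to be linear, so that the vectors spanning U already form a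
   subspace: U consists of the points with matrices M x y z. *)
Definition plane_of (M : F -> F -> F -> seq (seq F)) : {vspace 'rV[F]_6} :=
  <<[seq pt_of_sym (mx3 (M u.1.1 u.1.2 u.2)) | u : F * F * F]>>%VS.

Definition admissible (a : F) : Prop :=
  exists v : F, [/\ v != 0, v != 1, v ^+ 2 + v + 1 != 0 &
    a = (v + v^-1) / (1 + v + v^-1) ^+ 3].

Definition Sigma1 := plane_of (fun x y z =>
  [:: [:: x; y; 0]; [:: y; z; 0]; [:: 0; 0; 0]]).
Definition Sigma2 := plane_of (fun x y z =>
  [:: [:: x; 0; 0]; [:: 0; y; 0]; [:: 0; 0; z]]).
Definition Sigma3 := plane_of (fun x y z =>
  [:: [:: x; 0; z]; [:: 0; y; 0]; [:: z; 0; 0]]).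
Definition Sigma4 := plane_of (fun x y z =>
  [:: [:: x; 0; z]; [:: 0; y; z]; [:: z; z; 0]]).
Definition Sigma5 := plane_of (fun x y z =>
  [:: [:: x; 0; z]; [:: 0; y; z]; [:: z; z; z]]).
Definition Sigma6 (c : F) := plane_of (fun x y z =>
  [:: [:: x; 0; 0]; [:: 0; y + c * z; z]; [:: 0; z; y]]).
Definition Sigma7 := plane_of (fun x y z =>
  [:: [:: x; y; z]; [:: y; 0; 0]; [:: z; 0; 0]]).
Definition Sigma8 := plane_of (fun x y z =>
  [:: [:: x; y; 0]; [:: y; 0; z]; [:: 0; z; 0]]).
Definition Sigma9 := plane_of (fun x y z =>
  [:: [:: x; y; 0]; [:: y; z; z]; [:: 0; z; 0]]).
Definition Sigma10 := plane_of (fun x y z =>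
  [:: [:: x; y; 0]; [:: y; z; 0]; [:: 0; 0; z]]).
Definition Sigma11 := plane_of (fun x y z =>
  [:: [:: x; y; 0]; [:: y; z; z]; [:: 0; z; x + z]]).
Definition Pi (c : F) := plane_of (fun x y z =>
  [:: [:: x; y; c * x]; [:: y; y + z; 0]; [:: c * x; 0; c ^+ 2 * x + z]]).
Definition Sigma14' := plane_of (fun x y z =>
  [:: [:: x + z; z; z]; [:: z; y + z; z]; [:: z; z; y]]).
Definition Sigma15 := plane_of (fun x y z =>
  [:: [:: x; y; z]; [:: y; z; 0]; [:: z; 0; 0]]).

Definition representatives (c6 c12 c13 : F) (S14 : {vspace 'rV[F]_6}) :=
  [:: Sigma1; Sigma2; Sigma3; Sigma4; Sigma5; Sigma6 c6; Sigma7; Sigma8;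
      Sigma9; Sigma10; Sigma11; Pi c12; Pi c13; S14; Sigma15].

Variable charF2 : 2%N \in [pchar F].
Local Notation Tr := (Tr charF2).

(* #|F| is an odd (even) power of 2 when log2q is odd (even). *)
Let log2q := logn 2 #|F|.

Definition cond6 (c : F) : Prop := c != 0 /\ Tr c^-1 = 1.
Definition cond12 (c : F) : Prop :=
  [/\ c != 0, Tr c = 1 & odd log2q -> ~ admissible c^-1].
Definition cond13 (c : F) : Prop :=
  [/\ c != 0, Tr c = 0 & ~~ odd log2q -> ~ admissible c^-1].
Definition cond14 (c : F) : Prop :=
  [/\ c != 0, Tr c = Tr 1 & admissible c^-1].

End Representatives.

Arguments Sigma14' F : clear implicits.

(* Main.v *)
Require Import Defs.
From mathcomp Require Import all_boot all_order all_algebra all_fingroup.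
From mathcomp Require Import all_solvable all_field.
From mathcomp Require Import ring boolp.

Set Implicit Arguments.
Unset Strict Implicit.
Unset Printing Implicit Defensive.

Import GRing.Theory.
Local Open Scope ring_scope.

(** Move a rank-1 point of the plane U to E11 = e1 e1^T, and let T be the tangent
plane of the Veronese surface at E11, the matrices that vanish outside the first
row and column.

If U meets T in more than E11, then up to the group U contains E11, E12 and one
more point, whose lower right 2x2 block has few normal forms
([tline_net_types]).  Otherwise the lower blocks of the points of U form a pencil
of symmetric 2x2 matrices, that is, the annihilator of one binary quadratic form
p.  The case where p is a square is elementary ([square_net_types]).  If p is not
a square, it can be scaled to al Y^2 + Y Z + ga Z^2, and the first row of the
points of U then amounts to a binary cubic form g modulo the multiples of p
([qc_plane]).  Dually, U is the annihilator of a net of conics X Y + q1, X Z + q2,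
p, and g is the combination Z q1 + Y q2, in which X cancels as 2 = 0.

Each class of cubics modulo p has exactly one member apolar to p ([qc_apolar]).
For this member the Hessian is h p, where h^2 is the discriminant of g.  If h = 0
then g is 0 or a cube, which gives Sigma2, Sigma6 and Sigma5.  If h <> 0 then g
determines p, and the orbits are those of the binary cubics with nonzero
discriminant under GL(2, q) and scalars.  The number of roots of g on the
projective line, 3, 1 or 0, tells these orbits apart.  Cubics with a root are
normalised by moving the root to infinity and applying an Artin-Schreier
translation ([cubic_plane_root], [cubic_plane_AS]).  Two irreducible cubics are
equivalent because their roots t and t' lie in the same cubic extension, where
1, t, t' and t t' are linearly dependent, so that t' is a Moebius transform of t
([irr_Moebius]).

The cubic of pi_c is Y^3 + Y + 1/c.  It has three roots exactly when 1/c is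
admissible ([adm_two_roots], [two_roots_adm]).  If it has a root, then it has
three of them exactly when Tr c = Tr 1 ([two_roots_Tr], [root_Tr_two]).  Counting
shows that Tr c <> Tr 1 forces a root ([Tr_has_root]) and that some c with
Tr c = Tr 1 leaves the cubic without roots ([no_root_exists]).  Since Tr 1 is the
parity of log2 q, the three conditions on c describe the cubics with one, no and
three roots.

For the converse, [plane_class] assigns to each plane a number between 1 and 15
by means of invariants built from the rank-1 points, the points with zero diagonal
(an invariant plane in characteristic 2) and the determinant.  For the planes of
a pair (p, g) whose only rank-1 point is E11, an equivalence respects g
([qc_eqv_sub]), hence its number of roots.  By the normal forms, planes of the
same class are equivalent ([plane_class_complete]), and all 15 classes occur. *)

(** * Identities for cubics over commutative rings *)

(** The coefficients of a binary cubic after a linear substitution: the usual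
factors 3 are 1, as 2 = 0. *)
Lemma cubic_subst_char2 (R : comNzRingType) (a b c d p q r s t : R) :
  1 + 1 = 0 :> R ->
  let P := p * t + q in let W := r * t + s in
  a * P * P * P + b * P * P * W + c * P * W * W + d * W * W * W =
  (a * p * p * p + b * p * p * r + c * p * r * r + d * r * r * r) * t * t * t
  + (a * p * p * q + b * p * p * s + c * q * r * r + d * r * r * s) * t * t
  + (a * p * q * q + b * q * q * r + c * p * s * s + d * r * s * s) * t
  + (a * q * q * q + b * q * q * s + c * q * s * s + d * s * s * s).
Proof.
move=> two0 P W.
pose k := a * (p * p * q * t * t + p * q * q * t) + b * (p * q * r * t * t + p * q * s * t)
  + c * (p * r * s * t * t + q * r * s * t) + d * (r * r * s * t * t + r * s * s * t).
rewrite -[RHS]addr0 -[0 in RHS](mul0r k) -two0 /P /W /k; ring.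
Qed.

(** t w and w are the numerator and the denominator of a Moebius map with value t. *)
Lemma cubic_homog (R : comNzRingType) (a b c d t w : R) :
  a * (t * w) * (t * w) * (t * w) + b * (t * w) * (t * w) * w
    + c * (t * w) * w * w + d * w * w * w =
  (a * t * t * t + b * t * t + c * t + d) * (w * w * w).
Proof. ring. Qed.

Lemma cubic_elim (R : comNzRingType) (a b c d e f g h t : R) :
  e * t * t * t + f * t * t + g * t + h = 0 ->
  a * t * t * t + b * t * t + c * t + d = 0 ->
  (a * f - e * b) * t * t + (a * g - e * c) * t + (a * h - e * d) = 0.
Proof.
move=> E1 E2; transitivity (a * (e * t * t * t + f * t * t + g * t + h)
  - e * (a * t * t * t + b * t * t + c * t + d)); first by ring.
by rewrite E1 E2; ring.
Qed.

(** * Field arithmetic in characteristic 2 *)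

From Stdlib Require Import Ring Field.

Section Classification.
Variable F : finFieldType.
Hypothesis charF2 : 2%N \in [pchar F].

(** The operations of F under fixed names: the instances through which an
expression reaches the ring structure of F vary, and the [ring] tactic compares
operations syntactically. *)
Definition fadd (x y : F) : F := x + y.
Definition fmul (x y : F) : F := x * y.
Definition fsub (x y : F) : F := x - y.
Definition fopp (x : F) : F := - x.
Definition fdiv (x y : F) : F := x / y.
Definition finv (x : F) : F := x^-1.
Definition fone : F := 1.
Definition fzero : F := 0.

Lemma char2_field_theory :
  field_theory fzero fone fadd fmul fsub fopp fdiv finv eq.
Proof.
rewrite /fadd /fmul /fsub /fopp /fdiv /finv /fone /fzero.
split; [ | exact/eqP/oner_neq0 | by [] | by move=> x /eqP/mulVf].
by split=> *; rewrite ?add0r ?mul1r ?mulrDl ?subrr //;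
   by [rewrite addrC | rewrite addrA | rewrite mulrC | rewrite mulrA].
Qed.

(** Taking F_2, encoded as bool, for the ring of coefficients lets [ring] and
[field] use 2 = 0. *)
Lemma char2_ring_morph :
  ring_morph fzero fone fadd fmul fsub fopp eq
    false true xorb andb xorb id Bool.eqb (fun b : bool => if b then fone else fzero).
Proof.
have e2 : 1 + 1 = 0 :> F by apply/eqP; rewrite -mulr2n (pcharf0 charF2).
have eN : - 1 = 1 :> F by apply/eqP; rewrite eq_sym -addr_eq0 e2.
rewrite /fadd /fmul /fsub /fopp /fone /fzero.
split=> //.
- by case=> [] []; rewrite ?addr0 ?add0r ?e2.
- by case=> [] []; rewrite /= ?subr0 ?subrr ?sub0r ?eN.
- by case=> [] []; rewrite /= ?mulr0 ?mulr1.
- by case; rewrite /= ?oppr0 ?eN.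
- by case=> [] [].
Qed.

Add Field char2_field : char2_field_theory (morphism char2_ring_morph).

(** Rewrites an expression over F with the operations named above; the result is
convertible to t. *)
Ltac reif t :=
  lazymatch t with
  | @GRing.add _ ?a ?b =>
    lazymatch b with
    | @GRing.opp _ ?b => let a := reif a in let b := reif b in constr:(fsub a b)
    | _ => let a := reif a in let b := reif b in constr:(fadd a b)
    end
  | @GRing.opp _ ?a => let a := reif a in constr:(fopp a)
  | @GRing.mul _ ?a ?b =>
    lazymatch b with
    | @GRing.inv _ ?b => let a := reif a in let b := reif b in constr:(fdiv a b)
    | _ => let a := reif a in let b := reif b in constr:(fmul a b)
    end
  | @GRing.inv _ ?a => let a := reif a in constr:(finv a)
  | @GRing.exp _ ?a ?n =>
    let n := eval compute in n in let a := reif a in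
    let rec pow n := lazymatch n with
      | 0%N => constr:(fone) | 1%N => a
      | S ?m => let b := pow m in constr:(fmul a b) end in pow n
  | @GRing.one _ => constr:(fone)
  | @GRing.zero _ => constr:(fzero)
  | _ => t
  end.

Ltac prep :=
  match goal with |- @eq _ ?a ?b => let a := reif a in let b := reif b in
    change (@eq (FinRing.Field.sort F) a b) end.

Ltac ring2 := prep; ring.
Ltac field2 := prep; field; repeat split;
  try match goal with H : is_true (_ != 0) |- _ <> fzero => exact (elimN eqP H) end.

(** * Symmetric matrices in coordinates *)

Definition sym6 (a b c d e f : F) : 'rV[F]_6 :=
  pt_of_sym (mx3 [:: [:: a; b; c]; [:: b; d; e]; [:: c; e; f]]).

Lemma sym6E (a b c d e f : F) : sym6 a b c d e f = \row_k [:: a; b; c; d; e; f]`_k.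
Proof.
apply/rowP; case=> [[|[|[|[|[|[|//]]]]]] lt_k6]; by rewrite [LHS]mxE [RHS]mxE /= mxE !inordK.
Qed.

Lemma sym6_inj (a b c d e f : F) a' b' c' d' e' f' :
  sym6 a b c d e f = sym6 a' b' c' d' e' f' ->
  [/\ a = a', b = b' & c = c'] /\ [/\ d = d', e = e' & f = f'].
Proof.
rewrite !sym6E => /rowP E; have e_ k : (k < 6)%N -> [:: a; b; c; d; e; f]`_k = [:: a'; b'; c';
  d'; e'; f']`_k.
  by move=> k_lt; have := E (Ordinal k_lt); rewrite !mxE.
by split; split; [apply: (e_ 0) | apply: (e_ 1) | apply: (e_ 2) | apply: (e_ 3)
  | apply: (e_ 4) | apply: (e_ 5)].
Qed.

Lemma sym6_surj (y : 'rV[F]_6) : exists a b c d e f : F, y = sym6 a b c d e f.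
Proof.
pose y_ k := y 0 (inord k).
exists (y_ 0%N), (y_ 1%N), (y_ 2%N), (y_ 3%N), (y_ 4%N), (y_ 5%N).
rewrite sym6E; apply/rowP; case=> [[|[|[|[|[|[|//]]]]]] lt_k6]; rewrite mxE /=;
  by congr (y _ _); apply: val_inj; rewrite /= inordK.
Qed.

Lemma scale_sym6 k a b c d e f :
  k *: sym6 a b c d e f = sym6 (k * a) (k * b) (k * c) (k * d) (k * e) (k * f).
Proof.
by rewrite !sym6E; apply/rowP; case=> [[|[|[|[|[|[|//]]]]]] lt_k6]; rewrite !mxE.
Qed.

Lemma add_sym6 (a b c d e f : F) a' b' c' d' e' f' :
  sym6 a b c d e f + sym6 a' b' c' d' e' f' =
  sym6 (a + a') (b + b') (c + c') (d + d') (e + e') (f + f').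
Proof.
by rewrite !sym6E; apply/rowP; case=> [[|[|[|[|[|[|//]]]]]] lt_k6]; rewrite !mxE.
Qed.

Lemma sym6_0 : sym6 0 0 0 0 0 0 = 0.
Proof.
by rewrite !sym6E; apply/rowP; case=> [[|[|[|[|[|[|//]]]]]] lt_k6]; rewrite !mxE.
Qed.

Lemma sym6_eq0 (a b c d e f : F) : sym6 a b c d e f = 0 ->
  [/\ a = 0, b = 0 & c = 0] /\ [/\ d = 0, e = 0 & f = 0].
Proof. by rewrite -sym6_0 => /sym6_inj. Qed.

Lemma sym_sym6 (a b c d e f : F) : sym_of_pt (sym6 a b c d e f) =
  mx3 [:: [:: a; b; c]; [:: b; d; e]; [:: c; e; f]].
Proof.
rewrite pt_of_symK //; apply/matrixP=> i j; rewrite !mxE.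
by case: i j => [[|[|[|//]]] ?] [[|[|[|//]]] ?].
Qed.

Definition mat9 (a1 a2 a3 b1 b2 b3 c1 c2 c3 : F) : 'M[F]_3 :=
  mx3 [:: [:: a1; a2; a3]; [:: b1; b2; b3]; [:: c1; c2; c3]].

Lemma mat9_surj (A : 'M[F]_3) : exists a1 a2 a3 b1 b2 b3 c1 c2 c3 : F,
  A = mat9 a1 a2 a3 b1 b2 b3 c1 c2 c3.
Proof.
pose A_ i j := A (inord i) (inord j).
exists (A_ 0 0)%N, (A_ 0 1)%N, (A_ 0 2)%N, (A_ 1 0)%N, (A_ 1 1)%N, (A_ 1 2)%N, (A_ 2 0)%N,
  (A_ 2 1)%N, (A_ 2 2)%N.
apply/matrixP=> i j; rewrite mxE.
case: i j => [[|[|[|//]]] ?] [[|[|[|//]]] ?] /=; congr (A _ _); apply: val_inj;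
  by rewrite /= inordK.
Qed.

Lemma det_mat9 a1 a2 a3 b1 b2 b3 c1 c2 c3 :
  \det (mat9 a1 a2 a3 b1 b2 b3 c1 c2 c3) =
  a1 * (b2 * c3 + b3 * c2) + a2 * (b1 * c3 + b3 * c1) + a3 * (b1 * c2 + b2 * c1).
Proof.
rewrite (expand_det_row _ 0) !big_ord_recl big_ord0 /cofactor.
rewrite !(expand_det_row _ 0) !big_ord_recl !big_ord0 /cofactor !det_mx11 !mxE /=.
rewrite !expr0 !expr1; ring2.
Qed.

Lemma mulmx_mat9 (a b c d e f g h i a' b' c' d' e' f' g' h' i' : F) :
  mat9 a b c d e f g h i *m mat9 a' b' c' d' e' f' g' h' i' =
  mat9 (a * a' + b * d' + c * g') (a * b' + b * e' + c * h') (a * c' + b * f' + c * i')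
       (d * a' + e * d' + f * g') (d * b' + e * e' + f * h') (d * c' + e * f' + f * i')
       (g * a' + h * d' + i * g') (g * b' + h * e' + i * h') (g * c' + h * f' + i * i').
Proof.
apply/matrixP=> r s; rewrite !mxE !big_ord_recl big_ord0 !mxE /=.
by case: r s => [[|[|[|//]]] ?] [[|[|[|//]]] ?] /=; rewrite addr0 addrA.
Qed.

(** Diagonal entries transform semilinearly, by the squares of the entries of A:
the mixed terms occur twice.  This is why squaring and square roots appear
throughout. *)
Lemma congr_sym6 a1 a2 a3 b1 b2 b3 c1 c2 c3 m11 m12 m13 m22 m23 m33 :
  let q u1 u2 u3 := u1 * u1 * m11 + u2 * u2 * m22 + u3 * u3 * m33 in
  let f u1 u2 u3 v1 v2 v3 := u1 * v1 * m11 + u2 * v2 * m22 + u3 * v3 * m33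
    + (u1 * v2 + u2 * v1) * m12 + (u1 * v3 + u3 * v1) * m13 + (u2 * v3 + u3 * v2) * m23 in
  congr_pt (mat9 a1 a2 a3 b1 b2 b3 c1 c2 c3) (sym6 m11 m12 m13 m22 m23 m33) =
  sym6 (q a1 a2 a3) (f a1 a2 a3 b1 b2 b3) (f a1 a2 a3 c1 c2 c3)
       (q b1 b2 b3) (f b1 b2 b3 c1 c2 c3) (q c1 c2 c3).
Proof.
move=> q f; rewrite /congr_pt sym_sym6 -/(mat9 _ _ _ _ _ _ _ _ _).
have -> : (mat9 a1 a2 a3 b1 b2 b3 c1 c2 c3)^T = mat9 a1 b1 c1 a2 b2 c2 a3 b3 c3.
  apply/matrixP=> r s; rewrite !mxE.
  by case: r s => [[|[|[|//]]] ?] [[|[|[|//]]] ?].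
rewrite !mulmx_mat9 /sym6 -!/(mat9 _ _ _ _ _ _ _ _ _) /q /f.
by congr pt_of_sym; congr mat9; ring2.
Qed.

Lemma det_sym6 (a b c d e f : F) :
  \det (sym_of_pt (sym6 a b c d e f)) = a * d * f + a * e * e + d * c * c + f * b * b.
Proof. rewrite sym_sym6 -/(mat9 _ _ _ _ _ _ _ _ _) det_mat9; ring2. Qed.

(** * Orbits of planes and parametrised planes *)

Definition eqv (U V : {vspace 'rV[F]_6}) : Prop :=
  exists2 A : 'M[F]_3, A \in unitmx & congr_vs A U = V.

Lemma eqv_refl U : eqv U U.
Proof. by exists 1%:M; [exact: unitmx1 | exact: congr_vs1]. Qed.

Lemma eqv_sym U V : eqv U V -> eqv V U.
Proof.
case=> A uA <-; exists (invmx A); first by rewrite unitmx_inv.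
by rewrite congr_vsM mulVmx // congr_vs1.
Qed.

Lemma eqv_trans U V W : eqv U V -> eqv V W -> eqv U W.
Proof.
case=> A uA <- [B uB <-]; exists (B *m A); first by rewrite unitmx_mul uB.
by rewrite congr_vsM.
Qed.

Lemma orbit_eqv U V : orbit 'P (K F) U = orbit 'P (K F) V <-> eqv U V.
Proof.
have orbP := @orbit_eqP _ _ 'P%act (K_group F) U V; split=> [/orbP /orbitP[s] | [A uA AU]].
  rewrite inE => /exists_inP[A uA /forallP sA] /= sV.
  by apply: eqv_sym; exists A; rewrite // -sV apermE (eqP (sA _)).
apply/orbP; rewrite orbit_sym; apply/orbitP.
by exists (perm (congr_vs_inj uA)); rewrite ?congr_vs_K //= apermE permE.
Qed.

Lemma mem_congr_vs (A : 'M[F]_3) (U : {vspace 'rV[F]_6}) y : A \in unitmx ->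
  (congr_pt A y \in congr_vs A U) = (y \in U).
Proof.
move=> uA; apply/memv_imgP/idP=> [[x xU]|yU]; last by exists y; rewrite ?lfunE.
rewrite lfunE /= => /(congr1 (congr_pt (invmx A))).
by rewrite !congr_ptM mulVmx // !congr_pt1 => ->.
Qed.

Lemma congr_vsP (A : 'M[F]_3) (U : {vspace 'rV[F]_6}) y :
  reflect (exists2 x, x \in U & y = congr_pt A x) (y \in congr_vs A U).
Proof.
by apply: (iffP memv_imgP) => [] [x xU ->]; exists x; rewrite ?lfunE.
Qed.

Lemma dim_eqv U V : eqv U V -> \dim U = \dim V.
Proof.
have le (A : 'M[F]_3) W : (\dim (congr_vs A W) <= \dim W)%N.
  by rewrite /congr_vs -(limg_ker_dim (linfun (congr_pt A)) W) leq_addl.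
move=> UV; have VU := eqv_sym UV.
case: UV => A _ UV; case: VU => B _ VU.
by apply/eqP; rewrite eqn_leq; apply/andP; split; [rewrite -VU | rewrite -UV]; apply: le.
Qed.

Definition net (P : F -> F -> F -> 'rV[F]_6) : {vspace 'rV[F]_6} :=
  <<[seq P u.1.1 u.1.2 u.2 | u : F * F * F]>>%VS.

Definition lin3 (P : F -> F -> F -> 'rV[F]_6) : Prop :=
  forall x y z, P x y z = x *: P 1 0 0 + y *: P 0 1 0 + z *: P 0 0 1.

Lemma net_span P : lin3 P -> net P = span [:: P 1 0 0; P 0 1 0; P 0 0 1].
Proof.
move=> linP; apply/eqP; rewrite eqEsubv; apply/andP; split.
  apply/span_subvP=> y /mapP[[[u v] w] _ ->] /=.
  by rewrite linP !rpredD ?rpredZ ?memv_span // !inE eqxx ?orbT.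
have memP u : P u.1.1 u.1.2 u.2 \in net P.
  by apply: memv_span; apply: map_f; rewrite mem_enum.
apply/span_subvP=> y; rewrite !inE.
by case/or3P=> /eqP->; [apply: (memP (1, 0, 0)) | apply: (memP (0, 1, 0))
  | apply: (memP (0, 0, 1))].
Qed.

Lemma span3P (w1 w2 w3 y : 'rV[F]_6) : y \in span [:: w1; w2; w3] <->
  exists a b c, y = a *: w1 + b *: w2 + c *: w3.
Proof.
rewrite !span_cons span_nil addv0 addvA; split.
  case/memv_addP=> _ /memv_addP[_ /vlineP[a ->] [_ /vlineP[b ->] ->]].
  by case=> _ /vlineP[c ->] ->; exists a, b, c.
by case=> a [b [c ->]]; rewrite !memv_add ?memvZ ?memv_line.
Qed.

Lemma netP P y : lin3 P -> (y \in net P) <-> exists a b c, y = P a b c.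
Proof.
move=> linP; rewrite net_span //; split.
  by case/span3P=> a [b [c ->]]; exists a, b, c; rewrite -linP.
by case=> a [b [c ->]]; apply/span3P; exists a, b, c; rewrite -linP.
Qed.

Lemma mem_net P a b c : lin3 P -> P a b c \in net P.
Proof. by move=> linP; apply/netP=> //; exists a, b, c. Qed.

Lemma dim_net_le P : lin3 P -> (\dim (net P) <= 3)%N.
Proof. by move/net_span->; exact: dim_span. Qed.

Lemma dim_net P : lin3 P ->
  (forall x y z, P x y z = 0 -> [/\ x = 0, y = 0 & z = 0]) -> \dim (net P) = 3%N.
Proof.
move=> linP P0; rewrite net_span //.
suff : free [:: P 1 0 0; P 0 1 0; P 0 0 1] by move/eqP.
apply/freeP=> k; rewrite !big_ord_recl big_ord0 /= addr0 addrA -linP => /P0[k0 k1 k2].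
by case=> [[|[|[|//]]] lt3]; [rewrite -k0 | rewrite -k1 | rewrite -k2];
  congr (k _); apply: val_inj.
Qed.

Lemma eqvI (U : {vspace 'rV[F]_6}) P A : \dim U = 3%N -> lin3 P -> A \in unitmx ->
  (forall y, y \in U -> exists a b c, congr_pt A y = P a b c) -> eqv U (net P).
Proof.
move=> dU linP uA AP; exists A => //; apply/eqP.
rewrite eqEdim; apply/andP; split.
  by apply/subvP=> y /congr_vsP[x /AP[a [b [c Ax]]] ->]; rewrite Ax mem_net.
rewrite -(@dim_eqv U (congr_vs A U)); last by exists A.
by rewrite dU dim_net_le.
Qed.

(** To identify two planes it suffices to send the points of one into the other,
since both have dimension 3.  The scalar e certifies that A is invertible. *)
Lemma eqv_net P Q a1 a2 a3 b1 b2 b3 c1 c2 c3 e :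
  \dim (net P) = 3%N -> lin3 P -> lin3 Q ->
  (a1 * (b2 * c3 + b3 * c2) + a2 * (b1 * c3 + b3 * c1) + a3 * (b1 * c2 + b2 * c1)) * e = 1 ->
  (forall x y z, exists x' y' z',
     congr_pt (mat9 a1 a2 a3 b1 b2 b3 c1 c2 c3) (P x y z) = Q x' y' z') ->
  eqv (net P) (net Q).
Proof.
move=> dP lP lQ de PQ; apply: (@eqvI _ _ (mat9 a1 a2 a3 b1 b2 b3 c1 c2 c3)) => //.
  rewrite unitmxE det_mat9 unitfE; apply: contra_eq_neq de => ->.
  by rewrite mul0r eq_sym oner_neq0.
by move=> y /netP[//|x [y' [z ->]]].
Qed.

Ltac lin := move=> ? ? ?; cbv beta; rewrite !scale_sym6 !add_sym6; congr sym6; ring2.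

(** * Rank-1 points *)

(** Squaring is additive in characteristic 2, with trivial kernel. *)
Lemma sqr_inj (x y : F) : x * x = y * y -> x = y.
Proof.
move=> E; have /eqP : (x + y) * (x + y) = 0.
  by transitivity (x * x + y * y); [ring2 | rewrite E; ring2].
rewrite mulf_eq0 orbb => /eqP xy.
by transitivity (x + y + y); [ring2 | rewrite xy add0r].
Qed.

Lemma sqrt_exists (x : F) : exists r, x = r * r.
Proof.
have inj : injective (fun r : F => r * r) by move=> r s; exact: sqr_inj.
by exists (invF inj x); rewrite -[LHS](f_invF inj).
Qed.

Definition nu (u1 u2 u3 : F) : 'rV[F]_6 :=
  sym6 (u1 * u1) (u1 * u2) (u1 * u3) (u2 * u2) (u2 * u3) (u3 * u3).

Definition rk1 (y : 'rV[F]_6) : bool := \rank (sym_of_pt y) == 1%N.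

(** The 2x2 minors give m_ij^2 = m_ii m_jj, so the square roots of the diagonal
entries recover the whole matrix. *)
Lemma rk1_nu y : rk1 y -> exists u1 u2 u3 : F, [|| u1 != 0, u2 != 0 | u3 != 0] /\ y = nu u1 u2 u3.
Proof.
have [a [b [c [d [e [f yE]]]]]] := sym6_surj y.
rewrite /rk1 => /eqP rk; set M := sym_of_pt y in rk.
have minor i j k l : M i j * M k l = M i l * M k j.
  move: (col_base M) (row_base M) (mulmx_base M); rewrite rk => C R <-.
  by rewrite !mxE !big_ord1; ring2.
have MM i j k l : (mx3 [:: [:: a; b; c]; [:: b; d; e]; [:: c; e; f]]) i j * (mx3 [:: [:: a; b;
  c]; [:: b; d; e]; [:: c; e; f]]) k l =
   (mx3 [:: [:: a; b; c]; [:: b; d; e]; [:: c; e; f]]) i l * (mx3 [:: [:: a; b; c]; [:: b; d;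
     e]; [:: c; e; f]]) k j.
  by have := minor i j k l; rewrite /M yE sym_sym6.
have Eb := MM 0 (inord 1) (inord 1) 0.
have Ec := MM 0 (inord 2) (inord 2) 0.
have Ee := MM (inord 1) (inord 2) (inord 2) (inord 1).
rewrite !mxE !inordK //= in Eb Ec Ee.
have [u1 aE] := sqrt_exists a; have [u2 dE] := sqrt_exists d; have [u3 fE] := sqrt_exists f.
have bE : b = u1 * u2 by apply: sqr_inj; rewrite Eb aE dE; ring2.
have cE : c = u1 * u3 by apply: sqr_inj; rewrite Ec aE fE; ring2.
have eE : e = u2 * u3 by apply: sqr_inj; rewrite Ee dE fE; ring2.
have yE' : y = nu u1 u2 u3 by rewrite yE /nu aE bE cE dE eE fE.
exists u1, u2, u3; split=> //; case: (eqVneq u1 0) => //= u1_0; case: (eqVneq u2 0) => //= u2_0.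
apply/eqP=> u3_0; have := rk; rewrite /M yE' u1_0 u2_0 u3_0 /nu !mul0r sym6_0.
by rewrite linear0 mxrank0.
Qed.

Lemma nu_rk1 u1 u2 u3 : [|| u1 != 0, u2 != 0 | u3 != 0] -> rk1 (nu u1 u2 u3).
Proof.
move=> u_n0; rewrite /rk1 eqn_leq; apply/andP; split.
  pose v : 'rV[F]_3 := \row_k [:: u1; u2; u3]`_k.
  have -> : sym_of_pt (nu u1 u2 u3) = v^T *m v.
    rewrite sym_sym6; apply/matrixP=> i j; rewrite !mxE big_ord1 !mxE.
    by case: i j => [[|[|[|//]]] ?] [[|[|[|//]]] ?] //=; rewrite mulrC.
  exact: leq_trans (mulmx_max_rank _ _) _.
rewrite lt0n mxrank_eq0; apply: contraTneq u_n0 => M0.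
have : nu u1 u2 u3 = 0 by rewrite -[LHS]sym_of_ptK M0 linear0.
move/sym6_eq0=> [[/eqP a _ _] [/eqP d _ /eqP f]]; move: a d f.
by rewrite !mulf_eq0 !orbb !negb_or /= !negbK => -> -> ->.
Qed.

Lemma rk1_neq0 y : rk1 y -> y != 0.
Proof. by rewrite /rk1; apply: contraTneq => ->; rewrite linear0 mxrank0. Qed.

Lemma rk1_congr (A : 'M[F]_3) y : A \in unitmx -> rk1 (congr_pt A y) = rk1 y.
Proof.
move=> uA; rewrite /rk1 sym_congr_pt mxrankMfree ?row_free_unit ?unitmx_tr //.
by rewrite -mxrank_tr trmx_mul mxrankMfree ?row_free_unit ?unitmx_tr // mxrank_tr.
Qed.

Notation E11 := (sym6 1 0 0 0 0 0).

Lemma unit_mat9 a1 a2 a3 b1 b2 b3 c1 c2 c3 :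
  a1 * (b2 * c3 + b3 * c2) + a2 * (b1 * c3 + b3 * c1) + a3 * (b1 * c2 + b2 * c1) != 0 ->
  mat9 a1 a2 a3 b1 b2 b3 c1 c2 c3 \in unitmx.
Proof. by rewrite unitmxE det_mat9 unitfE. Qed.

Lemma move_to_e1 u1 u2 u3 : [|| u1 != 0, u2 != 0 | u3 != 0] ->
  exists2 A : 'M[F]_3, A \in unitmx & congr_pt A (nu u1 u2 u3) = E11.
Proof.
case/or3P=> u_n0.
- exists (mat9 u1^-1 0 0 (u2 / u1) 1 0 (u3 / u1) 0 1).
    by apply: unit_mat9; rewrite !(mulr0, mul0r, mulr1, addr0) invr_eq0.
  by rewrite congr_sym6; cbv zeta beta; congr sym6; field2.
- exists (mat9 0 u2^-1 0 1 (u1 / u2) 0 0 (u3 / u2) 1).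
    by apply: unit_mat9; rewrite !(mulr0, mul0r, mulr1, addr0, add0r) invr_eq0.
  by rewrite congr_sym6; cbv zeta beta; congr sym6; field2.
- exists (mat9 0 0 u3^-1 1 0 (u1 / u3) 0 1 (u2 / u3)).
    by apply: unit_mat9; rewrite !(mulr0, mul0r, mulr1, addr0, add0r) invr_eq0.
  by rewrite congr_sym6; cbv zeta beta; congr sym6; field2.
Qed.

Lemma rank1_plane_E11 U : U \in rank1_planes F ->
  exists2 V, eqv U V & \dim V = 3%N /\ E11 \in V.
Proof.
rewrite inE => /andP[/eqP dU /existsP[y /andP[yU /rk1_nu[u1 [u2 [u3 [u_n0 yE]]]]]]].
have [A uA AE] := move_to_e1 u_n0.
have UA : eqv U (congr_vs A U) by exists A.
exists (congr_vs A U) => //; split; first by rewrite -(dim_eqv UA).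
by rewrite -AE mem_congr_vs // -yE.
Qed.

Lemma eqv_rank1_planes U V : eqv U V -> (U \in rank1_planes F) = (V \in rank1_planes F).
Proof.
suff imp U' V' : eqv U' V' -> U' \in rank1_planes F -> V' \in rank1_planes F.
  by move=> UV; apply/idP/idP; apply: imp => //; exact: eqv_sym.
move=> UV; rewrite !inE (dim_eqv UV) => /andP[-> /existsP[y /andP[yU y1]]].
case: UV => A uA <-; apply/existsP; exists (congr_pt A y).
by rewrite mem_congr_vs // yU; have := rk1_congr y uA; rewrite /rk1 => ->.
Qed.

(** * The representatives as parametrised planes *)

Definition sigma1 (x y z : F) := sym6 x y 0 z 0 0.
Definition sigma2 (x y z : F) := sym6 x 0 0 y 0 z.
Definition sigma3 (x y z : F) := sym6 x 0 z y 0 0.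
Definition sigma4 (x y z : F) := sym6 x 0 z y z 0.
Definition sigma5 (x y z : F) := sym6 x 0 z y z z.
Definition sigma6 (c x y z : F) := sym6 x 0 0 (y + c * z) z y.
Definition sigma7 (x y z : F) := sym6 x y z 0 0 0.
Definition sigma8 (x y z : F) := sym6 x y 0 0 z 0.
Definition sigma9 (x y z : F) := sym6 x y 0 z z 0.
Definition sigma10 (x y z : F) := sym6 x y 0 z 0 z.
Definition sigma11 (x y z : F) := sym6 x y 0 z z (x + z).
Definition sigmaPi (c x y z : F) := sym6 x y (c * x) (y + z) 0 (c ^+ 2 * x + z).
Definition sigma14' (x y z : F) := sym6 (x + z) z z (y + z) z y.
Definition sigma15 (x y z : F) := sym6 x y z z 0 0.

Lemma lin_sigma1 : lin3 sigma1. Proof. lin. Qed.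
Lemma lin_sigma2 : lin3 sigma2. Proof. lin. Qed.
Lemma lin_sigma3 : lin3 sigma3. Proof. lin. Qed.
Lemma lin_sigma4 : lin3 sigma4. Proof. lin. Qed.
Lemma lin_sigma5 : lin3 sigma5. Proof. lin. Qed.
Lemma lin_sigma6 c : lin3 (sigma6 c). Proof. lin. Qed.
Lemma lin_sigma7 : lin3 sigma7. Proof. lin. Qed.
Lemma lin_sigma8 : lin3 sigma8. Proof. lin. Qed.
Lemma lin_sigma9 : lin3 sigma9. Proof. lin. Qed.
Lemma lin_sigma10 : lin3 sigma10. Proof. lin. Qed.
Lemma lin_sigma11 : lin3 sigma11. Proof. lin. Qed.
Lemma lin_sigmaPi c : lin3 (sigmaPi c). Proof. lin. Qed.
Lemma lin_sigma14' : lin3 sigma14'. Proof. lin. Qed.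
Lemma lin_sigma15 : lin3 sigma15. Proof. lin. Qed.

Ltac dims lin := apply: dim_net lin _ => x y z; move/sym6_eq0=> [[e1 e2 e3] [e4 e5 e6]].

Lemma dim_sigma1 : \dim (net sigma1) = 3%N. Proof. by dims lin_sigma1. Qed.
Lemma dim_sigma2 : \dim (net sigma2) = 3%N. Proof. by dims lin_sigma2. Qed.
Lemma dim_sigma3 : \dim (net sigma3) = 3%N. Proof. by dims lin_sigma3. Qed.
Lemma dim_sigma4 : \dim (net sigma4) = 3%N. Proof. by dims lin_sigma4. Qed.
Lemma dim_sigma5 : \dim (net sigma5) = 3%N. Proof. by dims lin_sigma5. Qed.
Lemma dim_sigma6 c : \dim (net (sigma6 c)) = 3%N. Proof. by dims (@lin_sigma6 c). Qed.
Lemma dim_sigma7 : \dim (net sigma7) = 3%N. Proof. by dims lin_sigma7. Qed.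
Lemma dim_sigma8 : \dim (net sigma8) = 3%N. Proof. by dims lin_sigma8. Qed.
Lemma dim_sigma9 : \dim (net sigma9) = 3%N. Proof. by dims lin_sigma9. Qed.
Lemma dim_sigma10 : \dim (net sigma10) = 3%N. Proof. by dims lin_sigma10. Qed.
Lemma dim_sigma11 : \dim (net sigma11) = 3%N. Proof. by dims lin_sigma11. Qed.
Lemma dim_sigmaPi c : \dim (net (sigmaPi c)) = 3%N.
Proof. by dims (@lin_sigmaPi c); move: e4; rewrite e1 e2 mulr0 in e6 *;
  rewrite !add0r in e6 * => ->. Qed.
Lemma dim_sigma14' : \dim (net sigma14') = 3%N.
Proof. by dims lin_sigma14'; move: e1 e4; rewrite e2 !addr0. Qed.
Lemma dim_sigma15 : \dim (net sigma15) = 3%N. Proof. by dims lin_sigma15. Qed.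

(** * Planes that contain a tangent line at a rank-1 point *)

Notation E12 := (sym6 0 1 0 0 0 0).

Lemma outside_span (U : {vspace 'rV[F]_6}) (s : seq 'rV[F]_6) :
  (size s < \dim U)%N -> exists2 w, w \in U & w \notin <<s>>%VS.
Proof.
move=> lt_s; have : ~~ (U <= <<s>>)%VS.
  apply: contraL lt_s => /dimvS le; rewrite -leqNgt.
  exact: leq_trans le (dim_span s).
by case/subvPn=> w; exists w.
Qed.

Lemma basis3 (U : {vspace 'rV[F]_6}) (w1 w2 w3 : 'rV[F]_6) :
  \dim U = 3%N -> w1 \in U -> w2 \in U -> w3 \in U ->
  w1 != 0 -> w2 \notin <<[:: w1]>>%VS -> w3 \notin <<[:: w2; w1]>>%VS ->
  forall y, y \in U -> exists a b c, y = a *: w1 + b *: w2 + c *: w3.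
Proof.
move=> dU w1U w2U w3U w1_0 w2_1 w3_12 y yU; apply/span3P.
have sU : (span [:: w1; w2; w3] <= U)%VS by apply/span_subvP=> w; rewrite !inE; case/or3P=> /eqP->.
suff /eqP-> : span [:: w1; w2; w3] == U by [].
rewrite eqEdim sU dU /=.
have /eqP -> : free [:: w1; w2; w3] => //.
rewrite (_ : free _ = free [:: w3; w2; w1]).
  by rewrite !free_cons w3_12 w2_1 span_nil memv0 w1_0 nil_free.
by apply: perm_free; rewrite -[X in perm_eq _ X]/(rev [:: w1; w2; w3]) perm_sym perm_rev.
Qed.

Lemma span1P (w y : 'rV[F]_6) : y \in <<[:: w]>>%VS <-> exists a, y = a *: w.
Proof. by rewrite span_seq1; split=> [/vlineP[a ->] | [a ->]];
  [exists a | rewrite memvZ ?memv_line]. Qed.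

Lemma span2P (w1 w2 y : 'rV[F]_6) : y \in <<[:: w1; w2]>>%VS <->
  exists a b, y = a *: w1 + b *: w2.
Proof.
rewrite span_cons span_seq1; split.
  by case/memv_addP=> _ /vlineP[a ->] [_ /vlineP[b ->] ->]; exists a, b.
by case=> a [b ->]; rewrite memv_add ?memvZ ?memv_line.
Qed.

(** The third generator is reduced modulo E11 and E12. *)
Definition tline_net (r s t w x y z : F) := sym6 x y (r * z) (s * z) (t * z) (w * z).

Lemma lin_tline_net (r s t w : F) : lin3 (tline_net r s t w). Proof. lin. Qed.

Lemma tline_net_exists (U : {vspace 'rV[F]_6}) : \dim U = 3%N -> E11 \in U -> E12 \in U ->
  exists r s t w : F, U = net (tline_net r s t w).
Proof.
move=> dU e1U e2U.
have [w wU w_out] : exists2 w, w \in U & w \notin <<[:: E12; E11]>>%VS.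
  by apply: outside_span; rewrite dU.
have e1_0 : E11 != 0 by apply/eqP=> /sym6_eq0[[/eqP]]; rewrite oner_eq0.
have e2_1 : E12 \notin <<[:: E11]>>%VS.
  apply/negP=> /span1P[k]; rewrite scale_sym6 mulr0 => /sym6_inj[[_ /eqP]].
  by rewrite oner_eq0.
have Uw := basis3 dU e1U e2U wU e1_0 e2_1 w_out.
have [a [b [r [s [t [v wE]]]]]] := sym6_surj w; exists r, s, t, v.
apply/vspaceP=> y; apply/idP/idP => [/Uw [x1 [x2 [x3 ->]]]|/(netP _ (@lin_tline_net _ _ _
  _))[x1 [x2 [x3 ->]]]].
  apply/netP; first exact: lin_tline_net.
  exists (x1 + x3 * a), (x2 + x3 * b), x3; rewrite wE !scale_sym6 !add_sym6 /tline_net.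
  by congr sym6; ring2.
have -> : tline_net r s t v x1 x2 x3 = (x1 - x3 * a) *: E11 + (x2 - x3 * b) *: E12 + x3 *: w.
  by rewrite wE !scale_sym6 !add_sym6 /tline_net; congr sym6; ring2.
by rewrite !rpredD ?rpredZ.
Qed.

(** The arguments are the rows of A, the inverse of det A, and the linearity of the two
parametrisations. *)
Ltac netmove a1 a2 a3 b1 b2 b3 c1 c2 c3 e linP linQ :=
  apply: (@eqv_net _ _ a1 a2 a3 b1 b2 b3 c1 c2 c3 e) => //; [exact: linP | exact: linQ | field2 | ].
Ltac netwit := rewrite congr_sym6; cbv zeta beta; congr sym6; field2.

(** The images of e2 and e3 may be changed by multiples of e1, and that of e3 also
by multiples of e2.  This removes the entries of the third generator one at a time,
starting from its (3,3) entry w; s / w + (t / w)^2 is what remains of the (2,2)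
entry. *)
Lemma tline_net_types (r s t w : F) : \dim (net (tline_net r s t w)) = 3%N ->
  exists2 V, V \in [:: net sigma1; net sigma3; net sigma7; net sigma8; net sigma9; net sigma10;
    net sigma15]
           & eqv (net (tline_net r s t w)) V.
Proof.
move=> dA.
have [w0|w0] := eqVneq w 0; last first.
  pose t1 := t / w; pose r1 := r / w.
  have [m mE] := sqrt_exists (s / w + t1 * t1).
  have sE : s = w * (m * m + t1 * t1) by rewrite -mE /t1; field2.
  have tE : t = w * t1 by rewrite /t1; field2.
  have rE : r = w * r1 by rewrite /r1; field2.
  move: dA; rewrite {}sE {}tE {}rE; move: t1 r1 {mE} => t1 r1 dA.
  have [m0|m0] := eqVneq m 0.
    exists (net sigma3); first by rewrite !inE eqxx ?orbT.
    netmove (1:F) (0:F) r1 (0:F) (0:F) (1:F) (0:F) (1:F) t1 (1:F) lin_tline_net lin_sigma3.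
    move=> x y z; exists (x + r1*r1*w*z), (w * z), (y + t1 * r1 * w * z).
    by rewrite m0; netwit.
  exists (net sigma10); first by rewrite !inE eqxx ?orbT.
  netmove (1:F) (0:F) r1 (0:F) m^-1 (t1/m) (0:F) (0:F) (1:F) m lin_tline_net lin_sigma10.
  move=> x y z; exists (x + r1*r1*w*z), (y/m + t1 * r1 * w * z/m), (w * z).
  netwit.
have [t0|t0] := eqVneq t 0; last first.
  have [s0|s0] := eqVneq s 0.
    exists (net sigma8); first by rewrite !inE eqxx ?orbT.
    netmove (1:F) (r/t) (0:F) (0:F) (1:F) (0:F) (0:F) (0:F) (1:F) (1:F) lin_tline_net lin_sigma8.
    move=> x y z; exists x, y, (t * z).
    by rewrite s0 w0; netwit.
  exists (net sigma9); first by rewrite !inE eqxx ?orbT.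
  netmove (1:F) (r/t) (0:F) (0:F) (1:F) (0:F) (0:F) (0:F) (s/t) (t/s) lin_tline_net lin_sigma9.
  move=> x y z; exists (x + r / t * r / t * s * z), (y + r / t * s * z), (s * z).
  by rewrite w0; netwit.
have [s0|s0] := eqVneq s 0; last first.
  have [r0|r0] := eqVneq r 0.
    exists (net sigma1); first by rewrite !inE eqxx ?orbT.
    netmove (1:F) (0:F) (0:F) (0:F) (1:F) (0:F) (0:F) (0:F) (1:F) (1:F) lin_tline_net lin_sigma1.
    move=> x y z; exists x, y, (s * z).
    by rewrite r0 w0 t0; netwit.
  exists (net sigma15); first by rewrite !inE eqxx ?orbT.
  netmove (1:F) (0:F) (0:F) (0:F) (1:F) (0:F) (0:F) (0:F) (s/r) (r/s) lin_tline_net lin_sigma15.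
  move=> x y z; exists x, y, (s * z).
  by rewrite w0 t0; netwit.
exists (net sigma7); first by rewrite !inE eqxx ?orbT.
netmove (1:F) (0:F) (0:F) (0:F) (1:F) (0:F) (0:F) (0:F) (1:F) (1:F) lin_tline_net lin_sigma7.
move=> x y z; exists x, y, (r * z).
by rewrite w0 t0 s0; netwit.
Qed.

(** The given point of T spans with E11 a tangent line, which is moved to the line
through E11 and E12. *)
Lemma tline_types (U : {vspace 'rV[F]_6}) (t1 t2 : F) : \dim U = 3%N -> E11 \in U ->
  sym6 0 t1 t2 0 0 0 \in U -> (t1 != 0) || (t2 != 0) ->
  exists2 V, V \in [:: net sigma1; net sigma3; net sigma7; net sigma8; net sigma9; net sigma10;
    net sigma15]
           & eqv U V.
Proof.
move=> dU e1U tU t_n0.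
have [A uA [A1 At]] : exists2 A : 'M[F]_3, A \in unitmx &
    congr_pt A E11 = E11 /\ congr_pt A (sym6 0 t1 t2 0 0 0) = E12.
  have [t1_0|t1_0] := eqVneq t1 0.
    rewrite t1_0 eqxx /= in t_n0.
    exists (mat9 1 0 0 0 0 t2^-1 0 1 0); last by rewrite !congr_sym6 t1_0; split; congr sym6;
      field2.
    by apply: unit_mat9; rewrite !(mulr0, mul0r, mulr1, mul1r, addr0, add0r) invr_eq0.
  exists (mat9 1 0 0 0 t1^-1 0 0 (t2/t1) 1); last by rewrite !congr_sym6; split; congr sym6; field2.
  by apply: unit_mat9; rewrite !(mulr0, mul0r, mulr1, mul1r, addr0, add0r) invr_eq0.
have UA : eqv U (congr_vs A U) by exists A.
have dA : \dim (congr_vs A U) = 3%N by rewrite -(dim_eqv UA).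
have [r [s [t [w VE]]]] : exists r s t w : F, congr_vs A U = net (tline_net r s t w).
  by apply: tline_net_exists => //; [rewrite -A1 | rewrite -At]; rewrite mem_congr_vs.
rewrite VE in dA UA; have [V VL AV] := tline_net_types dA.
by exists V => //; apply: eqv_trans UA AV.
Qed.

(** * Planes that meet a tangent plane in one point *)

(** The planes containing E11 and a point whose lower block is alternating: the
quadratic form annihilating the lower blocks is then a square. *)
Definition square_net (s t s' t' k l x y z : F) :=
  sym6 x (s * y + s' * z) (t * y + t' * z) (k * z) y (l * z).

Lemma lin_square_net (s t s' t' k l : F) : lin3 (square_net s t s' t' k l). Proof. lin. Qed.

(** The diagonal vector (k, l) has a square root (u, v), on which the group acts
linearly: it is moved to (0, 1).  Translating e2 and e3 by multiples of e1
then clears the first row of the alternating generator. *)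
Lemma square_net_norm (s t s' t' k l : F) : \dim (net (square_net s t s' t' k l)) = 3%N ->
  (k != 0) || (l != 0) ->
  exists g d, eqv (net (square_net s t s' t' k l)) (net (square_net 0 0 g d 0 1)).
Proof.
move=> dB kl0.
have [s1 [t1 [s2 [t2 eqv1]]]] : exists s1 t1 s2 t2,
   eqv (net (square_net s t s' t' k l)) (net (square_net s1 t1 s2 t2 0 1)).
  have [u kE] := sqrt_exists k; have [v lE] := sqrt_exists l.
  have [v0|v0] := eqVneq v 0.
    have u0 : u != 0 by move: kl0; rewrite kE lE v0 !mulf_eq0 eqxx /= orbF orbb.
    exists (t * u), s, t', (s' / u).
    netmove (1:F) (0:F) (0:F) (0:F) (0:F) (1:F) (0:F) u^-1 (0:F) u lin_square_net lin_square_net.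
    move=> x y z; exists x, (y / u), z; rewrite kE lE v0.
    by netwit.
  exists ((s + u / v * t) * v), t, ((s + u / v * t) * v * u + s' + u / v * t'), (t * u + t' / v).
  netmove (1:F) (0:F) (0:F) (0:F) (1:F) (u/v) (0:F) (0:F) v^-1 v lin_square_net lin_square_net.
  move=> x y z; exists x, (y / v + u * z), z; rewrite kE lE.
  by netwit.
have dB1 := dim_eqv eqv1; rewrite dB in dB1.
exists s2, (t2 + s1); apply: eqv_trans eqv1 _.
netmove (1:F) t1 s1 (0:F) (1:F) (0:F) (0:F) (0:F) (1:F) (1:F) lin_square_net lin_square_net.
move=> x y z; exists (x + s1 * s1 * z), y, z.
by netwit.
Qed.

(** If g <> 0, translating e2 by a multiple of e3 removes d, and the base point is
sent to (e2 + e3)(e2 + e3)^T, the rank-1 point of Sigma11.  If g = 0 <> d, the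
plane has the second rank-1 point (e3 + d e1)(e3 + d e1)^T, which becomes E22. *)
Lemma square_net_types (g d : F) : \dim (net (square_net 0 0 g d 0 1)) = 3%N ->
  exists2 V, V \in [:: net sigma3; net sigma4; net sigma11] & eqv (net (square_net 0 0 g d 0 1)) V.
Proof.
move=> dB; have [g0|g0] := eqVneq g 0; last first.
  exists (net sigma11); first by rewrite !inE eqxx ?orbT.
  netmove (0:F) (d/g) (1:F) (1:F) (1/g+d/g) (1:F) (1:F) (0:F) (0:F) g lin_square_net lin_sigma11.
  move=> x y z; exists z, (z + y / g), (x + z).
  by netwit.
have [d0|d0] := eqVneq d 0.
  exists (net sigma3); first by rewrite !inE eqxx ?orbT.
  netmove (0:F) (0:F) (1:F) (1:F) (0:F) (0:F) (0:F) (1:F) (0:F) (1:F) lin_square_net lin_sigma3.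
  move=> x y z; exists z, x, y; rewrite g0 d0.
  by netwit.
exists (net sigma4); first by rewrite !inE eqxx ?orbT.
netmove (d^-1:F) (0:F) (1:F) (0:F) (0:F) (1:F) (0:F) (1:F) (0:F) d lin_square_net lin_sigma4.
move=> x y z; exists (x/(d*d)+z), z, y; rewrite g0.
by netwit.
Qed.

(** The representatives that arise when U meets T in more than a point or p is a
square. *)
Definition nine_planes := [:: net sigma1; net sigma3; net sigma4; net sigma7; net sigma8;
  net sigma9; net sigma10; net sigma11; net sigma15].

Lemma tline_nine_planes (U : {vspace 'rV[F]_6}) (t1 t2 : F) : \dim U = 3%N -> E11 \in U ->
  sym6 0 t1 t2 0 0 0 \in U -> (t1 != 0) || (t2 != 0) ->
  exists2 V, V \in nine_planes & eqv U V.
Proof.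
move=> dU e1U tU t_n0; have [V VL UV] := tline_types dU e1U tU t_n0; exists V => //.
by move: VL; rewrite !inE; do 6?[case/orP=> [->|]; rewrite ?orbT //]; move->; rewrite !orbT.
Qed.

Lemma square_nine_planes (U : {vspace 'rV[F]_6}) (s t : F) : \dim U = 3%N -> E11 \in U ->
  sym6 0 s t 0 1 0 \in U -> exists2 V, V \in nine_planes & eqv U V.
Proof.
move=> dU e1U WU; set W := sym6 0 s t 0 1 0 in WU.
have [w wU w_out] : exists2 w, w \in U & w \notin <<[:: W; E11]>>%VS.
  by apply: outside_span; rewrite dU.
have e1_0 : E11 != 0 by apply/eqP=> /sym6_eq0[[/eqP]]; rewrite oner_eq0.
have W_1 : W \notin <<[:: E11]>>%VS.
  apply/negP=> /span1P[k]; rewrite scale_sym6 mulr0 => /sym6_inj[_ [_ /eqP]].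
  by rewrite oner_eq0.
have Uw := basis3 dU e1U WU wU e1_0 W_1 w_out.
have [x0 [s0 [t0 [k [e [l wE]]]]]] := sym6_surj w.
pose s' := s0 + e * s; pose t' := t0 + e * t.
have w'E : sym6 0 s' t' k 0 l = w - x0 *: E11 - e *: W.
  by rewrite wE -!scaleNr !scale_sym6 !add_sym6 /s' /t'; congr sym6; ring2.
have w'U : sym6 0 s' t' k 0 l \in U by rewrite w'E !rpredB ?rpredZ.
have [/norP[]|kl0] := boolP (~~ ((k != 0) || (l != 0))).
  rewrite !negbK => /eqP k0 /eqP l0; rewrite k0 l0 in w'U.
  apply: tline_nine_planes (w'U) _ => //; rewrite -negb_and;
    apply: contra w_out => /andP[/eqP s'0 /eqP t'0].
  have := w'E; rewrite k0 l0 s'0 t'0 sym6_0 => /esym/eqP; rewrite subr_eq0 subr_eq => /eqP->.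
  by apply/span2P; exists e, x0.
rewrite negbK in kl0.
have UE : U = net (square_net s t s' t' k l).
  apply/vspaceP=> y; apply/idP/idP => [/Uw [x1 [x2 [x3 ->]]]|/(netP _ (@lin_square_net _ _ _ _
    _ _))[x1 [x2 [x3 ->]]]].
    apply/netP; first exact: lin_square_net.
    exists (x1 + x3 * x0), (x2 + x3 * e), x3.
    rewrite (_ : w = sym6 0 s' t' k 0 l + x0 *: E11 + e *: W); last first.
      by rewrite w'E -addrA [x0 *: _ + _]addrC addrA !subrK.
    by rewrite /W /square_net !(add_sym6, scale_sym6); congr sym6; ring2.
  have -> : square_net s t s' t' k l x1 x2 x3 = x1 *: E11 + x2 *: W + x3 *: sym6 0 s' t' k 0 l.
    by rewrite /W /square_net !(add_sym6, scale_sym6); congr sym6; ring2.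
  by rewrite !rpredD ?rpredZ.
rewrite UE in dU *.
have [g [d eqv1]] := square_net_norm dU kl0.
have [|V VL eqv2] := @square_net_types g d; first by rewrite -(dim_eqv eqv1).
exists V; last exact: eqv_trans eqv1 eqv2.
by move: VL; rewrite !inE; case/or3P=> ->; rewrite !orbT.
Qed.

(** The plane of the pair p = al Y^2 + Y Z + ga Z^2, g = a Y^3 + b Y^2 Z + c Y Z^2
+ d Z^3.  Its determinant is x p(A, C)^2 + g(A, C)^2 with y = A^2 and z = C^2. *)
Definition qc_plane (al ga a b c d x y z : F) :=
  sym6 x (b * y + d * z) (a * y + c * z) y (al * y + ga * z) z.

Lemma lin_qc (al ga a b c d : F) : lin3 (qc_plane al ga a b c d). Proof. lin. Qed.

Lemma dim_qc (al ga a b c d : F) : \dim (net (qc_plane al ga a b c d)) = 3%N.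
Proof. by dims (@lin_qc al ga a b c d). Qed.

(** Let w and v complete E11 to a basis, and let D be the determinant of their
(2,2) and (3,3) entries.  If D <> 0 these two entries are coordinates on the plane
modulo E11, which gives the form [qc_plane].  If D = 0 some combination of w and v
has an alternating lower block, and the two preceding cases apply. *)
Lemma nine_planes_or_qc (U : {vspace 'rV[F]_6}) : \dim U = 3%N -> E11 \in U ->
  (exists2 V, V \in nine_planes & eqv U V) \/ exists al ga a b c d, U =
    net (qc_plane al ga a b c d).
Proof.
move=> dU e1U.
have [w wU w_out] : exists2 w, w \in U & w \notin <<[:: E11]>>%VS.
  by apply: outside_span; rewrite dU.
have [v vU v_out] : exists2 v, v \in U & v \notin <<[:: w; E11]>>%VS.
  by apply: outside_span; rewrite dU.
have e1_0 : E11 != 0 by apply/eqP=> /sym6_eq0[[/eqP]]; rewrite oner_eq0.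
have Uw := basis3 dU e1U wU vU e1_0 w_out v_out.
have [x1 [s1 [t1 [k1 [e1 [l1 wE]]]]]] := sym6_surj w.
have [x2 [s2 [t2 [k2 [e2 [l2 vE]]]]]] := sym6_surj v.
pose S y z := y * s1 + z * s2; pose T y z := y * t1 + z * t2.
pose Kd y z := y * k1 + z * k2; pose E y z := y * e1 + z * e2; pose Ld y z := y * l1 + z * l2.
have comb y z : sym6 0 (S y z) (T y z) (Kd y z) (E y z) (Ld y z)
    = y *: w + z *: v - (y * x1 + z * x2) *: E11.
  rewrite wE vE -scaleNr !scale_sym6 !add_sym6 /S /T /Kd /E /Ld.
  by congr sym6; ring2.
have combU y z : y *: w + z *: v - (y * x1 + z * x2) *: E11 \in U.
  by rewrite rpredB ?rpredD ?rpredZ.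
have comb0 y z : y *: w + z *: v - (y * x1 + z * x2) *: E11 = 0 -> y = 0 /\ z = 0.
  move/eqP; rewrite subr_eq0 => /eqP wvE; have z0 : z = 0.
    apply: contraNeq v_out => z0; apply/span2P.
    exists (z^-1 * - y), (z^-1 * (y * x1 + z * x2)).
    rewrite -!scalerA -scalerDr [_ + _]addrC scaleNr -wvE addrAC subrr add0r.
    by rewrite scalerA mulVf ?scale1r.
  split=> //; apply: contraNeq w_out => y0; apply/span1P.
  exists (y^-1 * (y * x1)); rewrite -scalerA; move: wvE; rewrite z0 scale0r !mul0r !addr0 => <-.
  by rewrite scalerA mulVf ?scale1r.
pose D := k1 * l2 + k2 * l1.
have [D0|D0] := eqVneq D 0.
  (* A nonzero row or column of the singular matrix gives a kernel vector; for the
     zero matrix any vector will do. *)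
  left; have [y [z [yz0 [kE lE]]]] :
      exists y z, [|| y != 0 | z != 0] /\ (Kd y z = 0 /\ Ld y z = 0).
    rewrite /Kd /Ld; have [|] := boolP ((k1 != 0) || (k2 != 0)).
      by exists k2, k1; rewrite orbC; split=> //; split; [ring2 | rewrite -D0 /D; ring2].
    rewrite negb_or !negbK => /andP[/eqP k10 /eqP k20].
    have [|] := boolP ((l1 != 0) || (l2 != 0)).
      by exists l2, l1; rewrite orbC; split=> //; split; [rewrite k10 k20; ring2 | ring2].
    rewrite negb_or !negbK => /andP[/eqP l10 /eqP l20].
    by exists 1, 0; rewrite oner_eq0 k10 k20 l10 l20 !mulr0 addr0.
  have VU := combU y z; have V0 := @comb0 y z.
  rewrite -comb kE lE in VU V0.
  have [eps0|eps0] := eqVneq (E y z) 0.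
    rewrite eps0 in VU V0; apply: tline_nine_planes (VU) _ => //.
    rewrite -negb_and; apply: contraL yz0 => /andP[/eqP sE /eqP tE].
    by rewrite -negb_and negbK; case: V0 => [|-> ->]; rewrite ?sE ?tE ?sym6_0 ?eqxx.
  apply: (@square_nine_planes U (S y z / E y z) (T y z / E y z)) => //.
  have -> : sym6 0 (S y z / E y z) (T y z / E y z) 0 1 0 =
      (E y z)^-1 *: sym6 0 (S y z) (T y z) 0 (E y z) 0.
    by rewrite scale_sym6 !mulr0 mulVf // ![_^-1 * _]mulrC.
  by rewrite rpredZ.
(* By Cramer's rule, in the basis whose (2,2) and (3,3) entries are (1, 0) and
   (0, 1). *)
right; exists ((l2 * e1 + l1 * e2) / D), ((k2 * e1 + k1 * e2) / D), ((l2 * t1 + l1 * t2) / D),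
 ((l2 * s1 + l1 * s2) / D), ((k2 * t1 + k1 * t2) / D), ((k2 * s1 + k1 * s2) / D).
apply/vspaceP=> y; apply/idP/idP => [/Uw [y1 [y2 [y3 ->]]]|/(netP _ (@lin_qc _ _ _ _ _ _))[y1
  [y2 [y3 ->]]]].
  apply/netP; first exact: lin_qc.
  exists (y1 + y2 * x1 + y3 * x2), (y2 * k1 + y3 * k2), (y2 * l1 + y3 * l2).
  rewrite wE vE /qc_plane !(add_sym6, scale_sym6); rewrite /D in D0 *; congr sym6; field2.
set q := qc_plane _ _ _ _ _ _ _ _ _.
pose y' := (l2 * y2 + k2 * y3) / D; pose z' := (l1 * y2 + k1 * y3) / D.
have -> : q = y1 *: E11 + sym6 0 (S y' z') (T y' z') (Kd y' z') (E y' z') (Ld y' z').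
  rewrite /q /qc_plane !(add_sym6, scale_sym6) /S /T /Kd /E /Ld /y' /z'; rewrite /D in D0 *.
  by congr sym6; field2.
by rewrite comb rpredD ?rpredZ.
Qed.

(** * The absolute trace and Artin-Schreier equations *)

Local Notation Tr := (Tr charF2).
Local Notation n2 := (logn 2 #|F|).

Lemma card_F : #|F| = (2 ^ n2)%N.
Proof. exact: card_pprimeChar charF2. Qed.

Lemma n2_gt0 : (0 < n2)%N.
Proof. by case: n2 card_F (finNzRing_gt1 F) => [->|]. Qed.

Lemma frobD i (x y : F) : (x + y) ^+ (2 ^ i) = x ^+ (2 ^ i) + y ^+ (2 ^ i).
Proof. by apply: exprDn_pchar; rewrite pnatX pnatE ?charF2. Qed.

Lemma TrD (x y : F) : Tr (x + y) = Tr x + Tr y.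
Proof. by rewrite !TrE -big_split; apply: eq_bigr => i _; exact: frobD. Qed.

(** The Frobenius permutes the summands of the trace cyclically. *)
Lemma Tr_sqr (x : F) : Tr (x * x) = Tr x.
Proof.
rewrite !TrE; have := card_F; move: n2_gt0; case: n2 => // m _ cF.
rewrite big_ord_recr /= big_ord_recl /= expn0 expr1 addrC; congr (_ + _).
  by rewrite -expr2 -exprM mulnC -expnSr -cF expf_card.
by apply: eq_bigr => i _; rewrite -expr2 -exprM -expnS /bump /=.
Qed.

Lemma Tr_AS (t : F) : Tr (t * t + t) = 0.
Proof. by rewrite TrD Tr_sqr; ring2. Qed.

Lemma Tr0 : Tr 0 = 0.
Proof. by have := Tr_AS 0; rewrite mulr0 addr0. Qed.

Lemma Tr_sqrE (x : F) : Tr x * Tr x = Tr x.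
Proof.
rewrite -[RHS]Tr_sqr !TrE -expr2 -[2%N]/(2 ^ 1)%N.
rewrite (big_morph (fun x => x ^+ (2 ^ 1)) (frobD 1) (_ : 0 ^+ (2 ^ 1) = 0));
  last by rewrite expr0n.
by apply: eq_bigr => i _; rewrite -[x * x]/(x ^+ (2 ^ 1)) -!exprM mulnC.
Qed.

Lemma Tr01 (x : F) : Tr x = 0 \/ Tr x = 1.
Proof.
have [->|x0] := eqVneq (Tr x) (0 : F); [by left | right].
by apply: (mulfI x0); rewrite mulr1 Tr_sqrE.
Qed.

(** d is a value of the Artin-Schreier map, that is, the quadratic
T^2 + T + d splits. *)
Definition AS (d : F) : Prop := exists t, d = t * t + t.

(** The trace is a polynomial function of degree q / 2. *)
Lemma card_Tr0 : (#|[set x : F | Tr x == 0%R]| <= 2 ^ n2.-1)%N.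
Proof.
pose p : {poly F} := \sum_(i < n2) 'X^(2 ^ i).
have pE x : p.[x] = Tr x.
  by rewrite TrE horner_sum; apply: eq_bigr => i _; rewrite hornerXn.
have size_p : size p = (2 ^ n2.-1).+1.
  rewrite /p; move: n2_gt0; case: n2 => // m _ /=.
  rewrite big_ord_recr /= addrC size_polyDl size_polyXn // ltnS.
  apply: leq_trans (size_sum _ _ _) _; apply/bigmax_leqP=> i _.
  by rewrite size_polyXn ltn_exp2l.
rewrite -ltnS -size_p cardE; apply: max_poly_roots.
- by rewrite -size_poly_eq0 size_p.
- by apply/allP=> x; rewrite mem_enum inE /root pE.
- exact: enum_uniq.
Qed.

Lemma AS_fibre (s t : F) : s * s + s = t * t + t -> s = t \/ s = t + 1.
Proof.
move=> E; have : (s + t) * (s + (t + 1)) = 0.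
  by transitivity ((s * s + s) + (t * t + t)); [ring2 | rewrite E; ring2].
move/eqP; rewrite mulf_eq0 => /orP[] /eqP st0; [left|right].
  by transitivity (s + t + t); [ring2 | rewrite st0 add0r].
by transitivity (s + (t + 1) + (t + 1)); [ring2 | rewrite st0 add0r].
Qed.

(** The Artin-Schreier map is two-to-one. *)
Lemma card_AS : (2 ^ n2.-1 <= #|[set (t * t + t)%R | t : F]|)%N.
Proof.
rewrite -(leq_pmul2r (m := 2)) // -expnSr prednK ?n2_gt0 // -card_F.
have -> : #|F| = (\sum_(t in F) 1)%N by rewrite sum1_card.
rewrite (partition_big_imset (fun t : F => t * t + t)) /= -[X in (_ <= X)%N]sum_nat_const.
apply: leq_sum => y /imsetP[t _ yE].
have le2 : (#|[set t; (t + 1)%R]| <= 2)%N by rewrite cards2; case: eqP.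
rewrite sum1_card; apply: leq_trans le2.
apply: subset_leq_card; apply/subsetP=> s; rewrite !inE unfold_in /= => /eqP E.
by case: (@AS_fibre s t); rewrite ?E // => ->; rewrite eqxx ?orbT.
Qed.

(** One inclusion is [Tr_AS]; both sets have q / 2 elements. *)
Lemma Tr0_set : [set x : F | Tr x == 0] = [set t * t + t | t : F].
Proof.
apply/esym/eqP; rewrite eqEcard; apply/andP; split.
  by apply/subsetP=> _ /imsetP[t _ ->]; rewrite inE Tr_AS.
exact: leq_trans card_Tr0 card_AS.
Qed.

Lemma Tr0_AS (x : F) : Tr x = 0 <-> AS x.
Proof.
split=> [x0|[t ->]]; last exact: Tr_AS.
have : x \in [set x : F | Tr x == 0] by rewrite inE x0.
by rewrite Tr0_set => /imsetP[t _ ->]; exists t.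
Qed.

Lemma Tr1_exists : exists e : F, Tr e = 1.
Proof.
have [e] : exists e, e \notin [set x : F | Tr x == 0].
  apply/existsP; apply: contraTT (card_Tr0); rewrite negb_exists => /forallP all0.
  rewrite -ltnNge (_ : [set x | _] = setT).
    by rewrite cardsT [X in (_ < X)%N]card_F ltn_exp2l // prednK ?n2_gt0.
  by apply/setP=> x; have := all0 x; rewrite negbK => ->; rewrite inE.
by rewrite inE; case: (Tr01 e) => [-> | e1 _]; [rewrite eqxx | exists e].
Qed.

Lemma nAS_Tr1 (x : F) : ~ AS x <-> Tr x = 1.
Proof.
rewrite -Tr0_AS; case: (Tr01 x) => ->; split=> [H|H] //.
- by have /eqP := H; rewrite eq_sym oner_eq0.
by move/eqP; rewrite oner_eq0.
Qed.

Lemma nAS_D (x y : F) : ~ AS x -> ~ AS y -> AS (x + y).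
Proof. by move=> /nAS_Tr1 x1 /nAS_Tr1 y1; apply/Tr0_AS; rewrite TrD x1 y1; ring2. Qed.

(** * Binary quadratic and cubic forms *)

Ltac qcmove a1 a2 a3 b1 b2 b3 c1 c2 c3 e :=
  apply: (@eqv_net _ _ a1 a2 a3 b1 b2 b3 c1 c2 c3 e);
  [exact: dim_qc | exact: lin_qc | exact: lin_qc | field2 | ].

Definition cub (a b c d Y Z : F) : F :=
  a * Y * Y * Y + b * Y * Y * Z + c * Y * Z * Z + d * Z * Z * Z.

Definition quad (al ga Y Z : F) : F := al * Y * Y + Y * Z + ga * Z * Z.

(** The contraction of g by p, a linear form in Y and Z, vanishes. *)
Definition apolar (al ga a b c d : F) : Prop :=
  a * ga + b + c * al = 0 /\ b * ga + c + d * al = 0.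

Definition has_root (a b c d : F) : Prop :=
  exists Y Z, (Y != 0) || (Z != 0) /\ cub a b c d Y Z = 0.

(** As 2 = 0, the determinant Y Z' + Y' Z says that the two roots are distinct
points of the projective line.  For a cubic with nonzero discriminant, two rational
roots mean three. *)
Definition two_roots (a b c d : F) : Prop :=
  exists Y Z Y' Z', Y * Z' + Y' * Z != 0 /\
    (cub a b c d Y Z = 0 /\ cub a b c d Y' Z' = 0).

(** Together with [hess_ga]: the Hessian of g is (a d + b c) p. *)
Lemma hess_al (al ga a b c d : F) : apolar al ga a b c d ->
  (a * d + b * c) * al = b * b + a * c.
Proof.
move=> [e1 e2]; transitivity (b * b + a * c + b * (a * ga + b + c * al) + a * (b * ga + c + d *
  al)).
  by ring2.
by rewrite e1 e2; ring2.
Qed.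

Lemma hess_ga (al ga a b c d : F) : apolar al ga a b c d ->
  (a * d + b * c) * ga = c * c + b * d.
Proof.
move=> [e1 e2]; transitivity (c * c + b * d + d * (a * ga + b + c * al) + c * (b * ga + c + d *
  al)).
  by ring2.
by rewrite e1 e2; ring2.
Qed.

(** Translating e2 and e3 by multiples of e1 adds the product of p and the linear
form v Y + w Z to g. *)
Lemma qc_shift (al ga a b c d v w : F) :
  eqv (net (qc_plane al ga a b c d)) (net (qc_plane al ga (a + v * al) (b + v + w * al) (c + v
    * ga + w) (d + w * ga))).
Proof.
qcmove (1:F) v w (0:F) (1:F) (0:F) (0:F) (0:F) (1:F) (1:F).
by move=> x y z; exists (x + v * v * y + w * w * z), y, z; netwit.
Qed.

(** The contraction of (v Y + w Z) p by p is v Y + w Z itself, because p has middle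
coefficient 1.  So a unique shift makes g apolar to p. *)
Lemma qc_apolar (al ga a b c d : F) : exists a' b' c' d',
  apolar al ga a' b' c' d' /\ eqv (net (qc_plane al ga a b c d)) (net (qc_plane al ga a' b' c' d')).
Proof.
pose v := a * ga + b + c * al; pose w := b * ga + c + d * al.
exists (a + v * al), (b + v + w * al), (c + v * ga + w), (d + w * ga).
by split; [split; rewrite /v /w; ring2 | exact: qc_shift].
Qed.

(** The hypotheses express, entry by entry, how the quadratic and the cubic form
on the right compose with the matrix B of rows (p, q) and (r, s): to det B times the
quadratic form and det B times k times the cubic form on the left. *)
Lemma qc_GL2 (p q r s k al ga a b c d al' ga' a' b' c' d' : F) :
  k != 0 -> p * s + q * r != 0 ->
  p * r + (p * s + q * r) * al = al' * (p * p) + ga' * (r * r) ->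
  q * s + (p * s + q * r) * ga = al' * (q * q) + ga' * (s * s) ->
  p * (k * b) + q * (k * a) = b' * (p * p) + d' * (r * r) ->
  r * (k * b) + s * (k * a) = a' * (p * p) + c' * (r * r) ->
  p * (k * d) + q * (k * c) = b' * (q * q) + d' * (s * s) ->
  r * (k * d) + s * (k * c) = a' * (q * q) + c' * (s * s) ->
  eqv (net (qc_plane al ga a b c d)) (net (qc_plane al' ga' a' b' c' d')).
Proof.
move=> k0 D0 e1 e2 e3 e4 e5 e6.
qcmove k (0:F) (0:F) (0:F) p q (0:F) r s ((k * (p * s + q * r))^-1).
move=> x y z; exists (k * k * x), (p * p * y + q * q * z), (r * r * y + s * s * z).
rewrite congr_sym6; cbv zeta beta; congr sym6; try ring2.
- transitivity (y * (p * (k * b) + q * (k * a)) + z * (p * (k * d) + q * (k * c))); first by ring2.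
  by rewrite e3 e5; ring2.
- transitivity (y * (r * (k * b) + s * (k * a)) + z * (r * (k * d) + s * (k * c))); first by ring2.
  by rewrite e4 e6; ring2.
transitivity (y * (p * r + (p * s + q * r) * al) + z * (q * s + (p * s + q * r) * ga));
  first by ring2.
by rewrite e1 e2; ring2.
Qed.

(** [subY3], [subY2Z], [subYZ2] and [subZ3] are the coefficients of
g(p Y + q Z, r Y + s Z). *)
Definition subY3 (p q r s a b c d : F) := cub a b c d p r.
Definition subY2Z (p q r s a b c d : F) :=
  a * p * p * q + b * p * p * s + c * q * r * r + d * r * r * s.
Definition subYZ2 (p q r s a b c d : F) :=
  a * p * q * q + b * q * q * r + c * p * s * s + d * r * s * s.
Definition subZ3 (p q r s a b c d : F) := cub a b c d q s.

Lemma cub_sub (p q r s a b c d Y Z : F) :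
  cub a b c d (p * Y + q * Z) (r * Y + s * Z) =
  cub (subY3 p q r s a b c d) (subY2Z p q r s a b c d) (subYZ2 p q r s a b c d) (subZ3 p q r s
    a b c d) Y Z.
Proof. rewrite /subY3 /subY2Z /subYZ2 /subZ3 /cub; ring2. Qed.

(** a d + b c is a square root of the discriminant, hence has weight 3. *)
Lemma disc_sub (p q r s k a b c d a' b' c' d' : F) :
  subY3 p q r s a' b' c' d' = k * a -> subY2Z p q r s a' b' c' d' = k * b ->
  subYZ2 p q r s a' b' c' d' = k * c -> subZ3 p q r s a' b' c' d' = k * d ->
  let D := p * s + q * r in
  k * k * (a * d + b * c) = D * D * D * (a' * d' + b' * c').
Proof.
move=> e1 e2 e3 e4 D; transitivity ((k * a) * (k * d) + (k * b) * (k * c)); first by ring2.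
by rewrite -e1 -e2 -e3 -e4 /subY3 /subY2Z /subYZ2 /subZ3 /cub /D; ring2.
Qed.

(** The quadratic forms need no separate assumption: by [hess_al] and [hess_ga]
they are proportional to the Hessians of the cubics, and the Hessian is a covariant. *)
Lemma qc_cubic (p q r s k al ga a b c d al' ga' a' b' c' d' : F) :
  apolar al ga a b c d -> apolar al' ga' a' b' c' d' ->
  a * d + b * c != 0 -> a' * d' + b' * c' != 0 ->
  k != 0 -> p * s + q * r != 0 ->
  subY3 p q r s a' b' c' d' = k * a -> subY2Z p q r s a' b' c' d' = k * b ->
  subYZ2 p q r s a' b' c' d' = k * c -> subZ3 p q r s a' b' c' d' = k * d ->
  eqv (net (qc_plane al ga a b c d)) (net (qc_plane al' ga' a' b' c' d')).
Proof.
move=> ap ap' h0 h'0 k0 D0 e1 e2 e3 e4; set D := p * s + q * r in D0.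
have hE := disc_sub e1 e2 e3 e4; rewrite /= -/D in hE.
have alE := hess_al ap; have al'E := hess_al ap'.
have gaE := hess_ga ap; have ga'E := hess_ga ap'.
have DDh : D * D * (a' * d' + b' * c') != 0 by rewrite !mulf_neq0.
apply: (@qc_GL2 p q r s (k / D)) => //; first by rewrite mulf_neq0 ?invr_eq0.
- apply: (mulfI DDh); rewrite -/D.
  transitivity (D * D * (a' * d' + b' * c') * p * r + k * k * ((a * d + b * c) * al)).
    by transitivity (D * D * (a' * d' + b' * c') * p * r + (D * D * D * (a' * d' + b' * c')) *
      al); [ring2 | rewrite -hE; ring2].
  transitivity (D * D * (((a' * d' + b' * c') * al') * p * p + ((a' * d' + b' * c') * ga') * r
    * r)); last by ring2.
  rewrite alE al'E ga'E.
  transitivity (D * D * (a' * d' + b' * c') * p * r + (k * b) * (k * b) + (k * a) * (k * c));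
    first by ring2.
  by rewrite -e1 -e2 -e3 /subY3 /subY2Z /subYZ2 /subZ3 /cub /D; ring2.
- apply: (mulfI DDh); rewrite -/D.
  transitivity (D * D * (a' * d' + b' * c') * q * s + k * k * ((a * d + b * c) * ga)).
    by transitivity (D * D * (a' * d' + b' * c') * q * s + (D * D * D * (a' * d' + b' * c')) *
      ga); [ring2 | rewrite -hE; ring2].
  transitivity (D * D * (((a' * d' + b' * c') * al') * q * q + ((a' * d' + b' * c') * ga') * s
    * s)); last by ring2.
  rewrite gaE al'E ga'E.
  transitivity (D * D * (a' * d' + b' * c') * q * s + (k * c) * (k * c) + (k * b) * (k * d));
    first by ring2.
  by rewrite -e2 -e3 -e4 /subY3 /subY2Z /subYZ2 /subZ3 /cub /D; ring2.
- transitivity ((p * (k * b) + q * (k * a)) / D); first by field2.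
  by rewrite -e1 -e2 /subY3 /subY2Z /cub; rewrite /D in D0 *; field2.
- transitivity ((r * (k * b) + s * (k * a)) / D); first by field2.
  by rewrite -e1 -e2 /subY3 /subY2Z /cub; rewrite /D in D0 *; field2.
- transitivity ((p * (k * d) + q * (k * c)) / D); first by field2.
  by rewrite -e3 -e4 /subYZ2 /subZ3 /cub; rewrite /D in D0 *; field2.
transitivity ((r * (k * d) + s * (k * c)) / D); first by field2.
by rewrite -e3 -e4 /subYZ2 /subZ3 /cub; rewrite /D in D0 *; field2.
Qed.

(** A common root of g and its Hessian would be a multiple root of g.  With
u, v, w the three second polars, g = Y^2 u + Z^2 w and h p = v^2 + u w. *)
Lemma no_common_root (al ga a b c d Y Z : F) : apolar al ga a b c d ->
  a * d + b * c != 0 -> quad al ga Y Z = 0 -> cub a b c d Y Z = 0 -> Y = 0 /\ Z = 0.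
Proof.
move=> ap h0 p0 g0; have alE := hess_al ap; have gaE := hess_ga ap.
have hp : (b * b + a * c) * Y * Y + (a * d + b * c) * Y * Z + (c * c + b * d) * Z * Z = 0.
  by rewrite -alE -gaE; transitivity ((a * d + b * c) * quad al ga Y Z); [rewrite /quad;
    ring2 | rewrite p0 mulr0].
have [Z0|Z0] := eqVneq Z 0.
  split=> //; apply/eqP; apply: contraNT h0 => Y0.
  have a0 : a = 0.
    by move/eqP: g0; rewrite /cub Z0 !mulr0 !addr0 !mulf_eq0 (negPf Y0) !orbF => /eqP.
  have b0 : b = 0.
    by move/eqP: hp; rewrite Z0 a0 !mulr0 !addr0 mul0r addr0 !mulf_eq0 (negPf Y0) !orbF orbb =>
      /eqP.
  by rewrite a0 b0 !mul0r addr0.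
exfalso; move/eqP: h0; apply.
pose u := a * Y + b * Z; pose v := b * Y + c * Z; pose w := c * Y + d * Z.
have g0' : Y * Y * u = Z * Z * w.
  by transitivity (cub a b c d Y Z + Z * Z * w); [rewrite /cub /u /w; ring2 | rewrite g0 add0r].
have hp' : v * v = u * w.
  transitivity ((b * b + a * c) * Y * Y + (a * d + b * c) * Y * Z + (c * c + b * d) * Z * Z + u
    * w).
    by rewrite /u /v /w; ring2.
  by rewrite hp add0r.
have vE : Z * v = Y * u.
  apply: sqr_inj; transitivity (u * (Z * Z * w)); last by rewrite -g0'; ring2.
  by transitivity (Z * Z * (v * v)); [ring2 | rewrite hp'; ring2].
have wE : Z * w = Y * v.
  apply: (mulfI Z0); transitivity (Z * Z * w); first by ring2.
  by rewrite -g0'; transitivity (Y * (Y * u)); [ring2 | rewrite -vE; ring2].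
have cE : c * Z * Z = a * Y * Y.
  transitivity (Z * v + b * Y * Z); first by rewrite /v; ring2.
  by rewrite vE /u; ring2.
have dE : d * Z * Z = b * Y * Y.
  transitivity (Z * w + c * Y * Z); first by rewrite /w; ring2.
  by rewrite wE /v; ring2.
have ZZ : Z * Z != 0 by rewrite mulf_neq0.
apply: (mulfI ZZ); rewrite mulr0.
transitivity (a * (d * Z * Z) + b * (c * Z * Z)); first by ring2.
by rewrite cE dE; ring2.
Qed.

(** * Normal forms for the planes of a quadratic and a cubic form *)

(** The plane of a cubic with nonzero discriminant; p is its normalised Hessian. *)
Definition cubic_plane (a b c d : F) :=
  net (qc_plane ((b * b + a * c) / (a * d + b * c)) ((c * c + b * d) / (a * d + b * c)) a b c d).

Lemma cubic_plane_apolar (a b c d : F) : a * d + b * c != 0 ->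
  apolar ((b * b + a * c) / (a * d + b * c)) ((c * c + b * d) / (a * d + b * c)) a b c d.
Proof. by move=> h0; split; field2. Qed.

Lemma apolar_cubic_plane (al ga a b c d : F) : apolar al ga a b c d -> a * d + b * c != 0 ->
  net (qc_plane al ga a b c d) = cubic_plane a b c d.
Proof.
by move=> ap h0; rewrite /cubic_plane -(hess_al ap) -(hess_ga ap) ![_ * al]mulrC ![_ * ga]mulrC
  !mulfK.
Qed.

Lemma cubic_plane_sub (p q r s k a b c d a' b' c' d' : F) :
  a' * d' + b' * c' != 0 -> k != 0 -> p * s + q * r != 0 ->
  subY3 p q r s a' b' c' d' = k * a -> subY2Z p q r s a' b' c' d' = k * b ->
  subYZ2 p q r s a' b' c' d' = k * c -> subZ3 p q r s a' b' c' d' = k * d ->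
  a * d + b * c != 0 /\ eqv (cubic_plane a b c d) (cubic_plane a' b' c' d').
Proof.
move=> h'0 k0 D0 e1 e2 e3 e4.
have h0 : a * d + b * c != 0.
  have := disc_sub e1 e2 e3 e4; rewrite /= => hE.
  have : k * k * (a * d + b * c) != 0 by rewrite hE !mulf_neq0.
  by rewrite mulf_eq0 negb_or => /andP[].
split=> //; apply: (qc_cubic _ _ h0 h'0 k0 D0 e1 e2 e3 e4); exact: cubic_plane_apolar.
Qed.

(** A root is moved to the point (1, 0); the two middle coefficients are then nonzero,
as their product is h, and are scaled to 1. *)
Lemma cubic_plane_root (a b c d : F) : a * d + b * c != 0 -> has_root a b c d ->
  exists e, eqv (cubic_plane a b c d) (cubic_plane 0 1 1 e).
Proof.
move=> h0 [Y [Z [YZ0 g0]]].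
have [b1 [c1 [d1 [h1 eqv1]]]] : exists b1 c1 d1,
  b1 * c1 != 0 /\ eqv (cubic_plane a b c d) (cubic_plane 0 b1 c1 d1).
  have [q [s D0]] : exists q s, Y * s + q * Z != 0.
    have [Y0|Y0] := eqVneq Y 0; last by exists 0, 1; rewrite mulr1 mul0r addr0.
    by exists 1, 0; move: YZ0; rewrite Y0 eqxx mul1r mulr0 add0r.
  exists (subY2Z Y q Z s a b c d), (subYZ2 Y q Z s a b c d), (subZ3 Y q Z s a b c d).
  have e1 : subY3 Y q Z s a b c d = 1 * 0 by rewrite /subY3 g0 mulr0.
  have mul1 (x : F) : x = 1 * x by rewrite mul1r.
  have [h1 eqv1] := cubic_plane_sub h0 (oner_neq0 F) D0 e1 (mul1 _) (mul1 _) (mul1 _).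
  by split; [rewrite mul0r add0r in h1 | exact: eqv_sym].
exists (b1 * d1 / (c1 * c1)); apply: eqv_trans eqv1 _.
have /norP[b10 c10] : ~~ ((b1 == 0) || (c1 == 0)) by rewrite -mulf_eq0.
apply: (proj2 (@cubic_plane_sub b1 0 0 c1 (b1 * c1) _ _ _ _ _ _ _ _ _ _ _ _ _ _ _)).
- by rewrite mul0r add0r mulr1 oner_neq0.
- by rewrite mulf_neq0.
- by rewrite mulr0 addr0 mulf_neq0.
- by rewrite /subY3 /cub; ring2.
- by rewrite /subY2Z; ring2.
- by rewrite /subYZ2; ring2.
by rewrite /subZ3 /cub; field2.
Qed.

(** Translating Y by t Z adds t^2 + t to e. *)
Lemma cubic_plane_AS (e e' : F) : AS (e + e') -> eqv (cubic_plane 0 1 1 e) (cubic_plane 0 1 1 e').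
Proof.
move=> [t tE]; have eE : e = e' + (t * t + t) by rewrite -tE; ring2.
apply: (proj2 (@cubic_plane_sub 1 t 0 1 1 _ _ _ _ _ _ _ _ _ _ _ _ _ _ _)).
- by rewrite mul0r add0r mulr1 oner_neq0.
- exact: oner_neq0.
- by rewrite mulr0 addr0 mulr1 oner_neq0.
- by rewrite /subY3 /cub; ring2.
- by rewrite /subY2Z; ring2.
- by rewrite /subYZ2; ring2.
by rewrite /subZ3 /cub eE; ring2.
Qed.

Lemma two_roots_AS (e : F) : two_roots 0 1 1 e <-> AS e.
Proof.
split=> [[Y [Z [Y' [Z' [D0 [g0 g'0]]]]]] | [t ->]]; last first.
  exists 1, 0, t, 1; rewrite mulr0 addr0 mulr1 oner_neq0; split=> //.
  by rewrite /cub; split; ring2.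
have root V W : W != 0 -> cub 0 1 1 e V W = 0 -> AS e.
  move=> W0 E; exists (V / W); apply: (mulfI W0); apply: (mulfI W0); apply: (mulfI W0).
  transitivity (cub 0 1 1 e V W + (V * V * W + V * W * W)); first by rewrite /cub; ring2.
  by rewrite E; field2.
have [Z0|Z0] := eqVneq Z 0; last exact: root g0.
have [Z'0|Z'0] := eqVneq Z' 0; last exact: root g'0.
by move: D0; rewrite Z0 Z'0 !mulr0 addr0 eqxx.
Qed.

(** h = 0 forces g = a (Y + k Z)^3 or g = d Z^3.  Apolarity makes the root of g a
root of p, and with it as one coordinate p = Y Z and g = Z^3. *)
Lemma qc_sigma5 (al ga a b c d : F) : apolar al ga a b c d -> a * d + b * c = 0 ->
  [|| a != 0, b != 0, c != 0 | d != 0] -> eqv (net (qc_plane al ga a b c d)) (net sigma5).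
Proof.
move=> ap h0 g_n0.
have bb : b * b = a * c.
  by transitivity ((a * d + b * c) * al + a * c); [rewrite (hess_al ap); ring2 | rewrite h0; ring2].
have cc : c * c = b * d.
  by transitivity ((a * d + b * c) * ga + b * d); [rewrite (hess_ga ap); ring2 | rewrite h0; ring2].
have [e1 e2] := ap.
have eqv5 : eqv (net (qc_plane 0 0 0 0 0 1)) (net sigma5).
  apply: (@eqv_net _ _ 1 0 1 0 1 1 0 0 1 1);
    [exact: dim_qc | exact: lin_qc | exact: lin_sigma5 | field2 | ].
  by move=> x y z; exists (x + z), (y + z), z; netwit.
apply: eqv_trans eqv5; have [a0|a0] := eqVneq a 0.
  have b0 : b = 0 by apply: sqr_inj; rewrite bb a0; ring2.
  have c0 : c = 0 by apply: sqr_inj; rewrite cc b0; ring2.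
  rewrite a0 b0 c0 eqxx /= in g_n0 e2 *.
  have al0 : al = 0 by move/eqP: e2; rewrite mul0r !add0r mulf_eq0 (negPf g_n0) => /eqP.
  rewrite al0; apply: (@qc_GL2 1 ga 0 1 d^-1); rewrite ?invr_eq0 //; try by field2.
  by rewrite mulr0 addr0 mulr1 oner_neq0.
have [k bE] : exists k, b = a * k by exists (b / a); field2.
have cE : c = a * k * k by apply: (mulfI a0); rewrite -bb bE; ring2.
have dE : d = a * k * k * k.
  apply: (mulfI a0); transitivity (a * d + b * c + b * c); first by ring2.
  by rewrite h0 bE cE; ring2.
have gaE : ga = k + k * k * al.
  apply: (mulfI a0); transitivity (a * ga + b + c * al + (b + c * al)); first by ring2.
  by rewrite e1 bE cE; ring2.
rewrite bE cE dE gaE.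
(* p = (al Y + (1 + k al) Z)(Y + k Z); the factors are the new coordinates. *)
apply: (@qc_GL2 al (1 + k * al) 1 k a^-1); rewrite ?invr_eq0 //; try by field2.
by rewrite (_ : _ + _ = 1) ?oner_neq0 //; ring2.
Qed.

(** p is a product of two distinct linear forms, which are taken as coordinates. *)
Lemma qc_sigma2 (al ga Y Z : F) : (Y != 0) || (Z != 0) -> quad al ga Y Z = 0 ->
  eqv (net (qc_plane al ga 0 0 0 0)) (net sigma2).
Proof.
move=> YZ0 p0.
have eqv2 : eqv (net (qc_plane 0 0 0 0 0 0)) (net sigma2).
  apply: (@eqv_net _ _ 1 0 0 0 1 0 0 0 1 1);
    [exact: dim_qc | exact: lin_qc | exact: lin_sigma2 | field2 | ].
  by move=> x y z; exists x, y, z; netwit.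
apply: eqv_trans eqv2; have [al0|al0] := eqVneq al 0.
  rewrite al0; apply: (@qc_GL2 1 ga 0 1 1); rewrite ?oner_neq0 //; try by ring2.
  by rewrite mulr0 addr0 mulr1 oner_neq0.
have Z0 : Z != 0.
  apply: contraTneq YZ0 => Z0; rewrite Z0 eqxx orbF negbK.
  by move/eqP: p0; rewrite /quad Z0 !mulr0 !addr0 !mulf_eq0 (negPf al0) /= orbb.
have gaE : ga = Y / Z + al * (Y / Z) * (Y / Z).
  apply: (mulfI Z0); apply: (mulfI Z0).
  transitivity (quad al ga Y Z + (al * Y * Y + Y * Z)); first by rewrite /quad; ring2.
  by rewrite p0; field2.
rewrite gaE; move: (Y / Z) => t.
(* p = (al Y + (1 + t al) Z)(Y + t Z); the factors are the new coordinates. *)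
apply: (@qc_GL2 al (1 + t * al) 1 t 1); rewrite ?oner_neq0 //; try by ring2.
by rewrite (_ : _ + _ = 1) ?oner_neq0 //; ring2.
Qed.

Lemma quad_root (al ga : F) : (exists Y Z, (Y != 0) || (Z != 0) /\ quad al ga Y Z =
  0) <-> AS (al * ga).
Proof.
split=> [[Y [Z [YZ0 p0]]] | [t tE]].
  have [Z0|Z0] := eqVneq Z 0.
    have al0 : al = 0.
      move: YZ0; rewrite Z0 eqxx orbF => Y0.
      by move/eqP: p0; rewrite /quad Z0 !mulr0 !addr0 !mulf_eq0 (negPf Y0) !orbF => /eqP.
    by exists 0; rewrite al0; ring2.
  exists (al * Y / Z); apply: (mulfI Z0); apply: (mulfI Z0).
  transitivity (al * quad al ga Y Z + al * (al * Y * Y + Y * Z)); first by rewrite /quad; ring2.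
  by rewrite p0; field2.
have [al0|al0] := eqVneq al 0.
  by exists 1, 0; rewrite oner_neq0 al0 /quad; split=> //; ring2.
exists t, al; rewrite al0 orbT /quad; split=> //.
transitivity (al * (al * ga) + al * (t * t + t)); first by ring2.
by rewrite tE; ring2.
Qed.

(** Scaling Y gives p = Y^2 + Y Z + al ga Z^2.  Two such forms without roots differ
by an Artin-Schreier translation, as the trace takes two values only. *)
Lemma qc_irr (al ga al' ga' : F) : ~ AS (al * ga) -> ~ AS (al' * ga') ->
  eqv (net (qc_plane al ga 0 0 0 0)) (net (qc_plane al' ga' 0 0 0 0)).
Proof.
have norm al1 ga1 : ~ AS (al1 * ga1) ->
  eqv (net (qc_plane al1 ga1 0 0 0 0)) (net (qc_plane 1 (al1 * ga1) 0 0 0 0)).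
  move=> nAS; have al10 : al1 != 0.
    by apply/eqP => al0; apply: nAS; exists 0; rewrite al0; ring2.
  apply: (@qc_GL2 al1 0 0 1 1); rewrite ?oner_neq0 //; try by ring2.
  by rewrite mulr0 addr0 mulr1.
move=> n1 n2; apply: eqv_trans (norm _ _ n1) (eqv_trans _ (eqv_sym (norm _ _ n2))).
have [t tE] := nAS_D n1 n2.
have -> : al * ga = al' * ga' + (t * t + t) by rewrite -tE; ring2.
apply: (@qc_GL2 1 t 0 1 1); rewrite ?oner_neq0 //; try by ring2.
by rewrite mulr0 addr0 mulr1 oner_neq0.
Qed.

Lemma sigma6_qc (c : F) : c != 0 -> eqv (net (sigma6 c)) (net (qc_plane c^-1 c^-1 0 0 0 0)).
Proof.
move=> c0.
apply: (@eqv_net _ _ 1 0 0 0 1 0 0 0 1 1);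
  [exact: dim_sigma6 | exact: lin_sigma6 | exact: lin_qc | field2 | ].
by move=> x y z; exists x, (y + c * z), y; netwit.
Qed.

(** The rank-1 point of pi_c is (1, 0, c)(1, 0, c)^T.  Moving it to E11 gives p =
c Y^2 + Y Z + c Z^2 and g = Y^2 Z + Z^3, whose apolar representative is
g + Y p = c Y^3 + c Y Z^2 + Z^3. *)
Lemma sigmaPi_cubic (c : F) : c != 0 -> eqv (net (sigmaPi c)) (cubic_plane 1 0 1 c^-1).
Proof.
move=> c0; have h0 : 1 * c^-1 + 0 * 1 != 0 by rewrite mul1r mul0r addr0 invr_eq0.
have eqv1 : eqv (net (sigmaPi c)) (net (qc_plane c c 0 1 0 1)).
  apply: (@eqv_net _ _ 1 0 0 0 1 0 c 0 1 1);
    [exact: dim_sigmaPi | exact: lin_sigmaPi | exact: lin_qc | field2 | ].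
  by move=> x y z; exists x, (y + z), z; netwit.
apply: eqv_trans eqv1 _; apply: eqv_trans (qc_shift c c 0 1 0 1 1 0) _.
rewrite -(@apolar_cubic_plane c c) //; last by split; field2.
apply: (@qc_GL2 1 0 0 1 c^-1); rewrite ?invr_eq0 //; try by field2.
by rewrite mulr0 addr0 mulr1 oner_neq0.
Qed.

(** Here p = Y^2 + Y Z + Z^2 and g = (Y + Z)^3, and g + (Y + Z) p = Y Z (Y + Z). *)
Lemma sigma14'_cubic : eqv (net sigma14') (cubic_plane 0 1 1 0).
Proof.
have eqv1 : eqv (net sigma14') (net (qc_plane 1 1 1 1 1 1)).
  apply: (@eqv_net _ _ 1 0 0 0 1 0 0 0 1 1);
    [exact: dim_sigma14' | exact: lin_sigma14' | exact: lin_qc | field2 | ].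
  by move=> x y z; exists (x + z), (y + z), y; netwit.
apply: eqv_trans eqv1 _; apply: eqv_trans (qc_shift 1 1 1 1 1 1 1 1) _.
have <- : net (qc_plane 1 1 0 1 1 0) = cubic_plane 0 1 1 0.
  apply: apolar_cubic_plane; first by split; ring2.
  by rewrite mul0r add0r mulr1 oner_neq0.
have E : 1 + 1 = 0 :> F by ring2.
by rewrite !mulr1 E add0r; exact: eqv_refl.
Qed.

(** * Equivalence of irreducible cubics *)

Lemma no_root_lead (a b c d : F) : ~ has_root a b c d -> a != 0.
Proof.
move=> nr; apply/eqP=> a0; apply: nr; exists 1, 0; rewrite oner_neq0 /cub a0; split=> //; ring2.
Qed.

(** If h = 0, then g has the double root Y^2 = c / a, Z = 1. *)
Lemma no_root_disc (a b c d : F) : ~ has_root a b c d -> a * d + b * c != 0.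
Proof.
move=> nr; have a0 := no_root_lead nr; apply/eqP=> h0; apply: nr.
have [r rE] := sqrt_exists (c / a).
have cE : c = a * r * r by rewrite -mulrA -rE; field2.
exists r, 1; rewrite oner_neq0 orbT; split=> //.
apply: (mulfI a0); transitivity ((a * d + b * c) + a * r * (a * r * r + c) + b * (a * r * r + c)).
  by rewrite /cub; ring2.
by rewrite h0 -cE; ring2.
Qed.

Definition cubpoly (a b c d : F) : {poly F} := Poly [:: d; c; b; a].

Lemma size_cubpoly (a b c d : F) : a != 0 -> size (cubpoly a b c d) = 4.
Proof. by move=> a0; rewrite (@PolyK _ 0). Qed.

Section Extension.
Variable L : fieldExtType F.
Local Notation "p ^L" := (map_poly (in_alg L) p) (at level 2, format "p ^L").
Local Notation "x ^:" := (x%:A : L) (at level 2, format "x ^:").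

Lemma cubpoly_map (a b c d : F) (t : L) :
  (cubpoly a b c d)^L.[t] = a^: * t * t * t + b^: * t * t + c^: * t + d^:.
Proof.
rewrite /cubpoly /= !cons_poly_def !(rmorphD, rmorphM) /= !map_polyX !map_polyC /= ?rmorph0.
by rewrite !hornerE !mulrDl scale0r !mul0r add0r.
Qed.

Variables (a b c d : F) (t : L).
Hypothesis nr : ~ has_root a b c d.
Hypothesis t_root : root (cubpoly a b c d)^L t.

Let a0 : a != 0 := no_root_lead nr.

Lemma cubpoly_irr : irreducible_poly (cubpoly a b c d).
Proof.
apply: cubic_irreducible; first by rewrite size_cubpoly.
move=> x; apply/negP=> /eqP x_root; apply: nr; exists x, 1; rewrite oner_neq0 orbT; split=> //.
rewrite -x_root /cubpoly /= !cons_poly_def !hornerE /cub.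
ring2.
Qed.

(** 1, t and t^2 are linearly independent over F. *)
Lemma deg3_indep (q : {poly F}) : (size q <= 3)%N -> root q^L t -> q = 0.
Proof.
move=> sq qt; apply/eqP; apply: contraLR qt => q0.
rewrite /root; apply: coprimep_root t_root.
rewrite coprimep_map irreducible_poly_coprime; last exact: cubpoly_irr.
by apply: contraL sq => /(dvdp_leq q0); rewrite size_cubpoly // -ltnNge.
Qed.

Lemma root_notin_base : forall x : F, x^: != t.
Proof.
move=> x; apply/eqP=> xt; have : 'X - x%:P = 0 :> {poly F}.
  apply: deg3_indep; first by rewrite size_XsubC.
  by rewrite rmorphB /= map_polyX map_polyC /= root_XsubC xt.
by move/eqP; rewrite polyXsubC_eq0.
Qed.

Lemma dim_Fadjoin_root : \dim <<1; t>>%VS = 3%N.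
Proof.
rewrite dim_Fadjoin dimv1 muln1; apply/eqP; rewrite -eqSS -size_minPoly eqn_leq.
have fP : (cubpoly a b c d)^L \is a polyOver 1%VS by apply/polyOver1P; exists (cubpoly a b c d).
have f0 : (cubpoly a b c d)^L != 0 by rewrite map_poly_eq0 -size_poly_eq0 size_cubpoly.
have := dvdp_leq f0 (minPoly_dvdp fP t_root); rewrite size_map_poly size_cubpoly // => -> /=.
have /polyOver1P[q qE] := minPolyOver 1 t.
rewrite qE size_map_poly; rewrite leqNgt ltnS; apply/negP=> sq.
have q0 : q = 0 by apply: deg3_indep => //; rewrite -qE root_minPoly.
by have := monic_neq0 (monic_minPoly 1 t); rewrite qE q0 rmorph0 eqxx.
Qed.

(** F(t) is the fixed field of the third power of the Frobenius, so it does not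
depend on the cubic. *)
Lemma mem_Fadjoin_root (x : L) : x \in <<1; t>>%VS <-> x ^+ (#|F| ^ 3) = x.
Proof.
have := Fermat's_little_theorem <<1; t>>%AS x; rewrite dim_Fadjoin_root => ->.
by split=> /eqP.
Qed.

End Extension.

Lemma root_of_split (L : fieldExtType F) (f : {poly L}) (rs : seq L) :
  (1 < size f)%N -> f %| \prod_(z <- rs) ('X - z%:P) -> exists t, root f t.
Proof.
move=> sf /dvdp_prod_XsubC[m fE].
have sm : (0 < size (mask m rs))%N.
  by rewrite -ltnS -(size_prod_XsubC _ id) -(eqp_size fE).
exists (head 0 (mask m rs)); rewrite (eqp_root fE) root_prod_XsubC.
by case: (mask m rs) sm => //= z s _; rewrite inE eqxx.
Qed.

(** Let t and t' be roots of the two cubics in a splitting field.  Both generate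
the same subfield of degree 3, in which 1, t, t' and t' t are dependent; hence
t' = (p t + q) / (r t + s).  The second cubic composed with this substitution
vanishes at t, so it is a multiple of the first one. *)
Lemma irr_Moebius (a b c d a' b' c' d' : F) :
  ~ has_root a b c d -> ~ has_root a' b' c' d' ->
  exists p q r s k, [/\ k != 0, p * s + q * r != 0 &
   [/\ subY3 p q r s a' b' c' d' = k * a, subY2Z p q r s a' b' c' d' = k * b,
       subYZ2 p q r s a' b' c' d' = k * c & subZ3 p q r s a' b' c' d' = k * d]].
Proof.
move=> nr nr'; have a0 := no_root_lead nr; have a'0 := no_root_lead nr'.
set f := cubpoly a b c d; set f' := cubpoly a' b' c' d'.
have sf : size f = 4%N by exact: size_cubpoly.
have sf' : size f' = 4%N by exact: size_cubpoly.
have ff'0 : f * f' != 0 by rewrite mulf_neq0 // -size_poly_eq0 ?sf ?sf'.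
have [L [rs rsE _]] := FinSplittingFieldFor ff'0.
have two0 : 1 + 1 = 0 :> L.
  have E : 1 + 1 = 0 :> F by ring2.
  by rewrite -(rmorph1 (in_alg L)) -rmorphD E rmorph0.
have [t ft] : exists t, root (map_poly (in_alg L) f) t.
  apply: (@root_of_split _ _ rs); first by rewrite size_map_poly sf.
  by rewrite -(eqp_dvdr _ rsE) rmorphM dvdp_mulr.
have [t' f't'] : exists t, root (map_poly (in_alg L) f') t.
  apply: (@root_of_split _ _ rs); first by rewrite size_map_poly sf'.
  by rewrite -(eqp_dvdr _ rsE) rmorphM dvdp_mull.
have t'E : t' \in <<1; t>>%VS.
  apply/(mem_Fadjoin_root nr ft).
  by apply/(mem_Fadjoin_root nr' f't'); apply: memv_adjoin.
have nb := root_notin_base nr ft; have nb' := root_notin_base nr' f't'.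
have [p [q [r [s [rs0 E]]]]] : exists p q r s : F, [|| r != 0 | s != 0] /\
    t' * (r%:A * t + s%:A) = p%:A * t + q%:A.
  have nfree : ~~ free [:: t' * t; t'; t; 1].
    apply/negP=> /eqP fr; have /dimvS : (<<[:: (t' * t)%R; t'; t; 1%R]>> <= <<1; t>>)%VS.
      apply/span_subvP=> z; rewrite !inE => /or4P[] /eqP-> //.
      - by rewrite rpredM ?memv_adjoin.
      - exact: memv_adjoin.
      exact: (mem1v <<1; t>>%AS).
    by rewrite fr (dim_Fadjoin_root nr ft).
  have s2 (w1 w2 : L) y : y \in <<[:: w1; w2]>>%VS -> exists x z, y = x *: w1 + z *: w2.
    rewrite span_cons span_seq1.
    by case/memv_addP=> _ /vlineP[x ->] [_ /vlineP[z ->] ->]; exists x, z.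
  have s3 (w1 w2 w3 : L) y : y \in <<[:: w1; w2;
    w3]>>%VS -> exists x z u, y = x *: w1 + (z *: w2 + u *: w3).
    rewrite span_cons.
    by case/memv_addP=> _ /vlineP[x ->] [_ /s2[z [u ->]] ->]; exists x, z, u.
  move: nfree; rewrite !free_cons nil_free andbT span_nil memv0 oner_neq0 andbT.
  rewrite span_seq1 !negb_and !negbK => /or3P[/s3[x [z [u tt']]] | /s2[x [z tt']] | /vlineP[x tE]].
  - exists z, u, 1, (- x); rewrite oner_neq0; split=> //.
    rewrite scale1r mul1r mulrDr tt' scaleNr mulrN -!scalerAr mulr1 addrAC subrr add0r.
    by rewrite -!scalerAl mul1r.
  - exists x, z, 0, 1; rewrite oner_neq0 orbT; split=> //.
    by rewrite scale0r mul0r add0r scale1r mulr1 tt' -scalerAl mul1r.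
  by have := nb x; rewrite tE eqxx.
set w := r%:A * t + s%:A in E.
have w0 : w != 0.
  apply/eqP=> w0; have [r0|r0] := eqVneq r 0.
    move: w0; rewrite /w r0 scale0r mul0r add0r => /eqP; rewrite scaler_eq0 oner_eq0 orbF.
    by move: rs0; rewrite r0 eqxx => /negPf->.
  have := nb (- (r^-1 * s)); rewrite (_ : _%:A = t) ?eqxx //.
  have : r^-1 *: w = 0 by rewrite w0 scaler0.
  rewrite /w scalerDr -scalerAl mul1r !scalerA mulVf // scale1r => /eqP.
  by rewrite addr_eq0 => /eqP->; rewrite scaleNr.
have D0 : p * s + q * r != 0.
  apply/eqP=> D0; have qr : q * r = p * s.
    by transitivity (p * s + q * r + p * s); [ring2 | rewrite D0 add0r].
  have E' : r *: t' = p%:A.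
    apply: (mulIf w0); rewrite -scalerAl E /w !scalerDr !mulrDr -!scalerAl !mul1r.
    by rewrite !scalerA [r * q]mulrC qr [r * p]mulrC.
  have [r0|r0] := eqVneq r 0; last first.
    by have := nb' (r^-1 * p); rewrite -scalerA -E' scalerA mulVf // scale1r eqxx.
  have s0 : s != 0 by move: rs0; rewrite r0 eqxx.
  have p0 : p = 0.
    by move/eqP: qr; rewrite r0 mulr0 eq_sym mulf_eq0 (negPf s0) orbF => /eqP.
  have := nb' (s^-1 * q); move: E; rewrite /w r0 p0 !scale0r !mul0r !add0r => E.
  by rewrite -scalerA -E -scalerAr mulr1 scalerA mulVf // scale1r eqxx.
have root' : (subY3 p q r s a' b' c' d')%:A * t * t * t + (subY2Z p q r s a' b' c' d')%:A * t * t
   + (subYZ2 p q r s a' b' c' d')%:A * t + (subZ3 p q r s a' b' c' d')%:A = 0 :> L.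
  rewrite /subY3 /subY2Z /subYZ2 /subZ3 /cub -!in_algE !(rmorphD, rmorphM) /=.
  rewrite -(@cubic_subst_char2 _ _ _ _ _ _ _ _ _ t two0) -/w -E.
  by rewrite cubic_homog -!in_algE -cubpoly_map (eqP f't') mul0r.
(* Eliminating the cubic term between the two polynomials with root t leaves a
   polynomial of degree at most 2 with root t, hence zero. *)
pose B x y := a * x - subY3 p q r s a' b' c' d' * y.
have sub_0 : cubpoly 0 (B (subY2Z p q r s a' b' c' d') b) (B (subYZ2 p q r s a' b' c' d') c) (B
  (subZ3 p q r s a' b' c' d') d) = 0.
  apply: (deg3_indep nr ft).
    by apply/leq_sizeP=> [[|[|[|[|j]]]]] //; rewrite coef_Poly //= nth_nil.
  apply/eqP; rewrite cubpoly_map /B -!in_algE rmorph0 !mul0r add0r !rmorphB !rmorphM /=.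
  have /eqP := ft; rewrite cubpoly_map => ft0.
  by rewrite (cubic_elim root' ft0).
have coef j : (cubpoly 0 (B (subY2Z p q r s a' b' c' d') b) (B (subYZ2 p q r s a' b' c' d') c)
  (B (subZ3 p q r s a' b' c' d') d))`_j = 0.
  by rewrite sub_0 coef0.
have c2 := coef 2; have c1 := coef 1%N; have c0 := coef 0%N.
rewrite !coef_Poly /= in c0 c1 c2.
have divE x y : B x y = 0 -> x = subY3 p q r s a' b' c' d' / a * y.
  move/eqP; rewrite subr_eq0 => /eqP xE; apply: (mulfI a0); rewrite xE; field2.
exists p, q, r, s, (subY3 p q r s a' b' c' d' / a); split=> //; last first.
  by split; [field2 | exact: divE | exact: divE | exact: divE].
rewrite mulf_neq0 ?invr_eq0 //; apply/eqP=> E0; apply: nr'; exists p, r; split=> //.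
rewrite -negb_and; apply: contra D0 => /andP[/eqP-> /eqP->].
by rewrite mul0r mulr0 addr0.
Qed.

(** * Roots of Y^3 + Y + 1/c *)

Lemma root_finite (a k : F) : cub 1 0 1 a k 1 = 0 <-> a = k * k * k + k.
Proof.
split=> [E | ->]; last by rewrite /cub; ring2.
transitivity (cub 1 0 1 a k 1 + (k * k * k + k)); first by rewrite /cub; ring2.
by rewrite E add0r.
Qed.

Lemma root_affine (a Y Z : F) : (Y != 0) || (Z != 0) -> cub 1 0 1 a Y Z = 0 ->
  Z != 0 /\ a = (Y / Z) * (Y / Z) * (Y / Z) + Y / Z.
Proof.
move=> YZ0 E; have Z0 : Z != 0.
  apply: contraTneq YZ0 => Z0; rewrite Z0 eqxx orbF negbK.
  by move/eqP: E; rewrite /cub Z0 !mulr0 !addr0 mul1r !mulf_eq0 !orbb.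
split=> //; apply: (mulfI Z0); apply: (mulfI Z0); apply: (mulfI Z0).
transitivity (cub 1 0 1 a Y Z + (Y * Y * Y + Y * Z * Z)); first by rewrite /cub; ring2.
by rewrite E; field2.
Qed.

Lemma has_rootP (a : F) : has_root 1 0 1 a <-> exists k : F, a = k * k * k + k.
Proof.
split=> [[Y [Z [YZ0 /(root_affine YZ0)[_ E]]]] | [k kE]]; first by exists (Y / Z).
by exists k, 1; rewrite oner_neq0 orbT; split=> //; apply/root_finite.
Qed.

Lemma two_rootsP (a : F) : two_roots 1 0 1 a <->
  exists k l : F, [/\ k != l, a = k * k * k + k & a = l * l * l + l].
Proof.
split=> [[Y [Z [Y' [Z' [D0 [g g']]]]]] | [k [l [kl kE lE]]]].
  have YZ : (Y != 0) || (Z != 0).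
    by rewrite -negb_and; apply: contra D0 => /andP[/eqP-> /eqP->]; rewrite mul0r mulr0 addr0.
  have YZ' : (Y' != 0) || (Z' != 0).
    by rewrite -negb_and; apply: contra D0 => /andP[/eqP-> /eqP->]; rewrite mul0r mulr0 addr0.
  have [Z0 E] := root_affine YZ g; have [Z'0 E'] := root_affine YZ' g'.
  exists (Y / Z), (Y' / Z'); split=> //; apply: contra D0 => /eqP kl; apply/eqP.
  transitivity (Z * Z' * (Y / Z + Y' / Z')); first by field2.
  by rewrite kl; ring2.
exists k, 1, l, 1; rewrite !mulr1; split; last by split; apply/root_finite.
by apply: contra kl => /eqP kl0; apply/eqP; transitivity (k + l + l); [ring2 | rewrite kl0 add0r].
Qed.

Lemma cube_root_neq01 (a k : F) : a != 0 -> a = k * k * k + k -> k != 0 /\ k + 1 != 0.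
Proof.
move=> a0 aE; have : a = k * ((k + 1) * (k + 1)) by rewrite aE; ring2.
by move=> E; move: a0; rewrite E !mulf_eq0 orbb negb_or => /andP[].
Qed.

(** c = 1/k + 1/(k + 1) + 1/(k + 1)^2. *)
Lemma Tr_root (c k : F) : c != 0 -> c^-1 = k * k * k + k -> Tr c = Tr k^-1.
Proof.
move=> c0 cE; have [|k0 k10] := cube_root_neq01 _ cE; first by rewrite invr_eq0.
have -> : c = k^-1 + ((k + 1)^-1 * (k + 1)^-1 + (k + 1)^-1).
  rewrite -[LHS]invrK cE (_ : k * k * k + k = k * ((k + 1) * (k + 1))); last by ring2.
  field2.
by rewrite TrD Tr_AS addr0.
Qed.

(** For distinct roots k and l the quotient s = l / k solves
s^2 + s = 1 + 1/k^2, so that the right hand side has trace 0. *)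
Lemma two_roots_Tr (c : F) : c != 0 -> two_roots 1 0 1 c^-1 -> Tr c = Tr 1.
Proof.
move=> c0 /two_rootsP[k [l [kl kE lE]]]; rewrite (Tr_root c0 kE).
have [|k0 _] := cube_root_neq01 _ kE; first by rewrite invr_eq0.
have kl0 : k + l != 0.
  by apply: contra kl => /eqP kl0; apply/eqP; transitivity (k + l + l); [ring2 | rewrite kl0 add0r].
have sumE : k * k + k * l + l * l = 1.
  apply: (mulfI kl0); transitivity ((k * k * k + k) + (l * l * l + l) + (k + l)); first by ring2.
  by rewrite -kE -lE; ring2.
have E : (l / k) * (l / k) + l / k = 1 + k^-1 * k^-1.
  by transitivity ((k * k + k * l + l * l) / (k * k) + 1); [field2 | rewrite sumE; field2].
have := Tr_AS (l / k); rewrite E TrD Tr_sqr => TrE0.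
by transitivity (Tr 1 + Tr k^-1 + Tr 1); [ring2 | rewrite TrE0 add0r].
Qed.

Lemma root_Tr_two (c : F) : c != 0 -> has_root 1 0 1 c^-1 -> Tr c = Tr 1 -> two_roots 1 0 1 c^-1.
Proof.
move=> c0 /has_rootP[k kE] TrE; apply/two_rootsP.
have [|k0 k10] := cube_root_neq01 _ kE; first by rewrite invr_eq0.
have /Tr0_AS[s sE] : Tr (1 + k^-1 * k^-1) = 0.
  by rewrite TrD Tr_sqr -TrE (Tr_root c0 kE); ring2.
exists k, (k * s); split=> //.
  apply: contra k10 => /eqP ks; have s1 : s = 1 by apply: (mulfI k0); rewrite -ks mulr1.
  have E : 1 + k^-1 * k^-1 = 0 by rewrite sE s1; ring2.
  rewrite -[k + 1 == 0](orbb) -mulf_eq0; apply/eqP.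
  by transitivity (k * k * (1 + k^-1 * k^-1)); [field2 | rewrite E mulr0].
have sumE : k * k + k * (k * s) + (k * s) * (k * s) = 1.
  by transitivity (k * k * (1 + (s * s + s))); [ring2 | rewrite -sE; field2].
rewrite kE; transitivity (k * s * (k * s) * (k * s) + k * s
    + (k + k * s) * (k * k + k * (k * s) + (k * s) * (k * s)) + (k + k * s)); first by ring2.
by rewrite sumE; ring2.
Qed.

(** With D = v^2 + v + 1, the roots are 1/D, v^2/D and (v^2 + 1)/D. *)
Lemma adm_two_roots (c : F) : admissible c^-1 -> two_roots 1 0 1 c^-1.
Proof.
move=> [v [v0 v1 D0 ->]]; rewrite !expr2 in D0 *.
have D0' : v * v + v + 1 != 0 by [].
exists (v * v + 1), (v * v + v + 1), 1, (v * v + v + 1); split.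
  rewrite (_ : _ + _ = (v * v + v + 1) * (v * v)); last by ring2.
  by rewrite !mulf_neq0.
have -> : (v + v^-1) / (1 + v + v^-1) ^+ 3 =
  (v * v + 1) * (v * v) / ((v * v + v + 1) * (v * v + v + 1) * (v * v + v + 1)).
  have -> : 1 + v + v^-1 = (v * v + v + 1) / v by field2.
  field2.
by rewrite /cub; split; field2.
Qed.

(** Two roots k and l satisfy k^2 + k l + l^2 = 1.  With v^2 = l / k this reads
k (v^2 + v + 1) = 1, and the formula for 1/c = k^3 + k follows. *)
Lemma two_roots_adm (c : F) : c != 0 -> two_roots 1 0 1 c^-1 -> admissible c^-1.
Proof.
move=> c0 /two_rootsP[k [l [kl kE lE]]].
have [|k0 _] := cube_root_neq01 _ kE; first by rewrite invr_eq0.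
have [|l0 _] := cube_root_neq01 _ lE; first by rewrite invr_eq0.
have kl0 : k + l != 0.
  by apply: contra kl => /eqP kl0; apply/eqP; transitivity (k + l + l); [ring2 | rewrite kl0 add0r].
have sumE : k * k + k * l + l * l = 1.
  apply: (mulfI kl0); transitivity ((k * k * k + k) + (l * l * l + l) + (k + l)); first by ring2.
  by rewrite -kE -lE; ring2.
have [v vE] := sqrt_exists (l / k).
have lE' : l = k * (v * v) by rewrite -vE; field2.
have kD : k * (v * v + v + 1) = 1.
  by apply: sqr_inj; rewrite [RHS]mulr1; transitivity (k * k + k * l + l * l); [rewrite lE';
    ring2 | ].
have D0 : v * v + v + 1 != 0 by apply: contra_eq_neq kD => ->; rewrite mulr0 eq_sym oner_neq0.
have v0 : v != 0 by apply: contraNneq l0 => v0; rewrite lE' v0 !mulr0.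
exists v; split=> //; first by apply: contraNneq kl => v1; rewrite lE' v1 !mulr1.
have k_E : k = (v * v + v + 1)^-1 by apply: (mulIf D0); rewrite kD mulVf.
rewrite kE k_E.
have -> : 1 + v + v^-1 = (v * v + v + 1) / v by field2.
field2.
Qed.

(** The parameter c for which 1/u is a root of Y^3 + Y + 1/c. *)
Definition root_map (u : F) : F := u * u * u / ((u + 1) * (u + 1)).

Lemma root_mapE (u : F) : u != 0 -> u + 1 != 0 ->
  root_map u != 0 /\ (root_map u)^-1 = u^-1 * u^-1 * u^-1 + u^-1.
Proof.
move=> u0 u1; split; first by rewrite !mulf_neq0 ?invr_eq0 ?mulf_neq0.
rewrite /root_map invf_div; field2.
Qed.

Lemma Tr_root_map (u : F) : u != 0 -> u + 1 != 0 -> Tr (root_map u) = Tr u.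
Proof. by move=> u0 u1; have [c0 cE] := root_mapE u0 u1; rewrite (Tr_root c0 cE) invrK. Qed.

Lemma root_mapP (c k : F) : c != 0 -> c^-1 = k * k * k + k -> c = root_map k^-1.
Proof.
move=> c0 cE; have [|k0 k10] := cube_root_neq01 _ cE; first by rewrite invr_eq0.
have k1 : k^-1 + 1 != 0.
  by apply: contra k10 => /eqP E; apply/eqP; transitivity (k * (k^-1 + 1));
    [field2 | rewrite E mulr0].
have [|c'0 E] := root_mapE _ k1; first by rewrite invr_eq0.
by apply: invr_inj; rewrite cE E !invrK.
Qed.

Lemma Tr_neq1 (u : F) : Tr u != Tr 1 -> u + 1 != 0.
Proof.
by apply: contraNneq => u1; apply/eqP; congr Defs.Tr; transitivity (u + 1 + 1);
  [ring2 | rewrite u1 add0r].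
Qed.

(** On the nonzero u with Tr u <> Tr 1 the map [root_map] preserves the trace, and
it is injective since such a c admits at most one root; so it is onto. *)
Lemma Tr_has_root (c : F) : c != 0 -> Tr c != Tr 1 -> has_root 1 0 1 c^-1.
Proof.
move=> c0 cT; pose S := [set u : F | (u != 0) && (Tr u != Tr 1)].
have injS : {in S &, injective root_map}.
  move=> u v; rewrite !inE => /andP[u0 uT] /andP[v0 vT] E.
  have u1 := Tr_neq1 uT; have v1 := Tr_neq1 vT; apply/eqP; apply: contraNT uT => uv.
  have [r0 rE] := root_mapE u0 u1; have [r'0 rE'] := root_mapE v0 v1.
  rewrite -(Tr_root_map u0 u1); apply/eqP; apply: (two_roots_Tr r0); apply/two_rootsP.
  exists u^-1, v^-1; split=> //; last by rewrite E.
  by rewrite (inj_eq invr_inj).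
have SS : root_map @: S = S.
  apply/eqP; rewrite eqEcard (card_in_imset injS) leqnn andbT.
  apply/subsetP=> _ /imsetP[u uS ->]; move: (uS); rewrite inE => /andP[u0 uT];
    have u1 := Tr_neq1 uT.
  by have [r0 _] := root_mapE u0 u1; rewrite inE (Tr_root_map u0 u1) uT r0.
have : c \in S by rewrite inE c0.
rewrite -SS => /imsetP[u]; rewrite inE => /andP[u0 uT] cE; have u1 := Tr_neq1 uT.
have [_ E] := root_mapE u0 u1.
by apply/has_rootP; exists u^-1; rewrite cE E.
Qed.

(** A root of Y^3 + Y + 1/c gives a preimage of c under [root_map] with the same
trace as c, and u = 1 is not available as a preimage.  So among the
nonzero c with Tr c = Tr 1 one is missed. *)
Lemma no_root_exists : exists c : F, [/\ c != 0, Tr c = Tr 1 & ~ has_root 1 0 1 c^-1].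
Proof.
pose T := [set u : F | (u != 0) && (Tr u == Tr 1)].
have T1 : (1 : F) \in T by rewrite inE oner_neq0 eqxx.
have : ~~ (T \subset root_map @: (T :\ 1)).
  apply/negP=> /subset_leq_card le; have := leq_trans le (leq_imset_card _ _).
  by rewrite (cardsD1 1 T) T1 add1n ltnn.
case/subsetPn=> c; rewrite inE => /andP[c0 /eqP cT] c_out; exists c; split=> //.
move/has_rootP=> [k kE]; move/negP: c_out; apply.
have [|k0 k10] := cube_root_neq01 _ kE; first by rewrite invr_eq0.
rewrite (root_mapP c0 kE) imset_f // !inE invr_eq0 k0 -(Tr_root c0 kE) cT eqxx !andbT.
by rewrite invr_eq1; apply: contra k10 => /eqP->; apply/eqP; ring2.
Qed.

(** * Equivalent planes have equivalent cubics *)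

Lemma nu_in_qc (al ga a b c d u1 u2 u3 : F) : nu u1 u2 u3 \in net (qc_plane al ga a b c d) ->
  quad al ga u2 u3 = 0 /\ cub a b c d u2 u3 = 0.
Proof.
case/(netP _ (@lin_qc _ _ _ _ _ _)) => x [y [z]] /sym6_inj[[_ e12 e13] [e22 e23 e33]].
split.
  transitivity (al * (u2 * u2) + u2 * u3 + ga * (u3 * u3)); first by rewrite /quad; ring2.
  by rewrite e22 e23 e33; ring2.
transitivity (u2 * (a * (u2 * u2) + c * (u3 * u3)) + u3 * (b * (u2 * u2) + d * (u3 * u3))).
  by rewrite /cub; ring2.
rewrite e22 e33 -e12 -e13; ring2.
Qed.

(** Equivalently, E11 is the only rank-1 point of the plane of (p, g). *)
Definition disjoint_roots (al ga a b c d : F) : Prop :=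
  forall Y Z, quad al ga Y Z = 0 -> cub a b c d Y Z = 0 -> Y = 0 /\ Z = 0.

(** The equivalence fixes the rank-1 point E11, so it has the block form
(k, v, w; 0, B).  Comparing entries, g' composed with B is det B times
k g + (v Y + w Z) p.  As contraction is covariant this cubic is apolar to p,
and therefore v = w = 0. *)
Lemma qc_eqv_sub (al ga a b c d al' ga' a' b' c' d' : F) :
  apolar al ga a b c d -> apolar al' ga' a' b' c' d' -> disjoint_roots al' ga' a' b' c' d' ->
  eqv (net (qc_plane al ga a b c d)) (net (qc_plane al' ga' a' b' c' d')) ->
  exists p q r s k, [/\ k != 0, p * s + q * r != 0 &
   [/\ subY3 p q r s a' b' c' d' = k * a, subY2Z p q r s a' b' c' d' = k * b,
       subYZ2 p q r s a' b' c' d' = k * c & subZ3 p q r s a' b' c' d' = k * d]].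
Proof.
move=> [ap1 ap2] [ap'1 ap'2] gd [A uA AQ].
have mapQ y : y \in net (qc_plane al ga a b c d) ->
  congr_pt A y \in net (qc_plane al' ga' a' b' c' d').
  by move=> yQ; rewrite -AQ mem_congr_vs.
have [k [v [w [A21 [p [q [A31 [r [s AE]]]]]]]]] := mat9_surj A.
have e1Q : E11 \in net (qc_plane al ga a b c d).
  apply/(netP _ (@lin_qc _ _ _ _ _ _)); exists 1, 0, 0; rewrite /qc_plane; congr sym6; ring2.
have A1 : congr_pt A E11 = nu k A21 A31.
  by rewrite AE congr_sym6 /nu; cbv zeta beta; congr sym6; ring2.
have := mapQ _ e1Q; rewrite A1 => /nu_in_qc[q0 c0].
have [A21_0 A31_0] := gd _ _ q0 c0; rewrite A21_0 A31_0 in AE.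
have [k0 D0] : k != 0 /\ p * s + q * r != 0.
  have : k * (p * s + q * r) != 0.
    move: uA; rewrite AE unitmxE unitfE det_mat9; apply: contra => /eqP E; apply/eqP.
    by transitivity (k * (p * s + q * r)); [ring2 | ].
  by rewrite mulf_eq0 negb_or => /andP[].
have y_Q : sym6 0 b a 1 al 0 \in net (qc_plane al ga a b c d).
  apply/(netP _ (@lin_qc _ _ _ _ _ _)); exists 0, 1, 0; rewrite /qc_plane; congr sym6; ring2.
have z_Q : sym6 0 d c 0 ga 1 \in net (qc_plane al ga a b c d).
  apply/(netP _ (@lin_qc _ _ _ _ _ _)); exists 0, 0, 1; rewrite /qc_plane; congr sym6; ring2.
have := mapQ _ y_Q; rewrite AE congr_sym6; cbv zeta beta.
case/(netP _ (@lin_qc _ _ _ _ _ _)) => x1 [y1 [z1]] /sym6_inj[[_ f12 f13] [f22 f23 f33]].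
have := mapQ _ z_Q; rewrite AE congr_sym6; cbv zeta beta.
case/(netP _ (@lin_qc _ _ _ _ _ _)) => x2 [y2 [z2]] /sym6_inj[[_ g12 g13] [g22 g23 g33]].
set D := p * s + q * r in D0.
have y1E : y1 = p * p by rewrite -f22; ring2.
have z1E : z1 = r * r by rewrite -f33; ring2.
have y2E : y2 = q * q by rewrite -g22; ring2.
have z2E : z2 = s * s by rewrite -g33; ring2.
pose w1 := k * b + v + w * al; pose w2 := k * a + v * al.
pose w1' := k * d + w * ga; pose w2' := k * c + v * ga + w.
have F23 : D * al = al' * (p * p) + ga' * (r * r) + p * r.
  by rewrite -y1E -z1E -f23 /D; ring2.
have G23 : D * ga = al' * (q * q) + ga' * (s * s) + q * s.
  by rewrite -y2E -z2E -g23 /D; ring2.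
have F12 : b' * (p * p) + d' * (r * r) = p * w1 + q * w2.
  by rewrite -y1E -z1E -f12 /w1 /w2; ring2.
have F13 : a' * (p * p) + c' * (r * r) = r * w1 + s * w2.
  by rewrite -y1E -z1E -f13 /w1 /w2; ring2.
have G12 : b' * (q * q) + d' * (s * s) = p * w1' + q * w2'.
  by rewrite -y2E -z2E -g12 /w1' /w2'; ring2.
have G13 : a' * (q * q) + c' * (s * s) = r * w1' + s * w2'.
  by rewrite -y2E -z2E -g13 /w1' /w2'; ring2.
have subE1 : subY3 p q r s a' b' c' d' = D * w2.
  transitivity (p * (a' * (p * p) + c' * (r * r)) + r * (b' * (p * p) + d' * (r * r))).
    by rewrite /subY3 /cub; ring2.
  by rewrite F12 F13 /D; ring2.
have subE2 : subY2Z p q r s a' b' c' d' = D * w1.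
  transitivity (q * (a' * (p * p) + c' * (r * r)) + s * (b' * (p * p) + d' * (r * r))).
    by rewrite /subY2Z; ring2.
  by rewrite F12 F13 /D; ring2.
have subE3 : subYZ2 p q r s a' b' c' d' = D * w2'.
  transitivity (p * (a' * (q * q) + c' * (s * s)) + r * (b' * (q * q) + d' * (s * s))).
    by rewrite /subYZ2; ring2.
  by rewrite G12 G13 /D; ring2.
have subE4 : subZ3 p q r s a' b' c' d' = D * w1'.
  transitivity (q * (a' * (q * q) + c' * (s * s)) + s * (b' * (q * q) + d' * (s * s))).
    by rewrite /subZ3 /cub; ring2.
  by rewrite G12 G13 /D; ring2.
have v0 : v = 0.
  apply: (mulfI D0); apply: (mulfI D0); rewrite !mulr0.
  transitivity (D * w2 * (D * ga) + D * (D * w1) + D * w2' * (D * al) + D * D * k * (a * ga + b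
    + c * al)).
    by rewrite /w1 /w2 /w2'; ring2.
  rewrite ap1 -subE1 -subE2 -subE3 F23 G23.
  transitivity (D * D * (p * (a' * ga' + b' + c' * al') + r * (b' * ga' + c' + d' * al'))).
    by rewrite /D /subY3 /subY2Z /subYZ2 /cub; ring2.
  by rewrite ap'1 ap'2; ring2.
have w0 : w = 0.
  apply: (mulfI D0); apply: (mulfI D0); rewrite !mulr0.
  transitivity (D * w1 * (D * ga) + D * (D * w2') + D * w1' * (D * al) + D * D * k * (b * ga +
    c + d * al)).
    by rewrite /w1 /w1' /w2'; ring2.
  rewrite ap2 -subE2 -subE3 -subE4 F23 G23.
  transitivity (D * D * (q * (a' * ga' + b' + c' * al') + s * (b' * ga' + c' + d' * al'))).
    by rewrite /D /subY2Z /subYZ2 /subZ3 /cub; ring2.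
  by rewrite ap'1 ap'2; ring2.
exists p, q, r, s, (D * k); split=> //; first by rewrite mulf_neq0.
by rewrite subE1 subE2 subE3 subE4 /w1 /w2 /w1' /w2' v0 w0; split; ring2.
Qed.

Section SameKind.
Variables (p q r s k a b c d a' b' c' d' : F).
Hypotheses (k0 : k != 0) (D0 : p * s + q * r != 0).
Hypothesis subE : [/\ subY3 p q r s a' b' c' d' = k * a, subY2Z p q r s a' b' c' d' = k * b,
       subYZ2 p q r s a' b' c' d' = k * c & subZ3 p q r s a' b' c' d' = k * d].

Lemma cub_image Y Z : cub a' b' c' d' (p * Y + q * Z) (r * Y + s * Z) = k * cub a b c d Y Z.
Proof. by case: subE => e1 e2 e3 e4; rewrite cub_sub e1 e2 e3 e4 /cub; ring2. Qed.

Lemma has_root_image : has_root a b c d -> has_root a' b' c' d'.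
Proof.
case=> Y [Z [YZ0 E]]; exists (p * Y + q * Z), (r * Y + s * Z); rewrite cub_image E mulr0;
  split=> //.
move: YZ0; rewrite -!negb_and; apply: contra => /andP[/eqP e1 /eqP e2].
apply/andP; split; apply/eqP; apply: (mulfI D0); rewrite mulr0.
  by transitivity (s * (p * Y + q * Z) + q * (r * Y + s * Z)); [ring2 | rewrite e1 e2; ring2].
by transitivity (r * (p * Y + q * Z) + p * (r * Y + s * Z)); [ring2 | rewrite e1 e2; ring2].
Qed.

Lemma two_roots_image : two_roots a b c d -> two_roots a' b' c' d'.
Proof.
case=> Y [Z [Y' [Z' [YZ0 [E E']]]]].
exists (p * Y + q * Z), (r * Y + s * Z), (p * Y' + q * Z'), (r * Y' + s * Z').
rewrite !cub_image E E' mulr0; split=> //.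
rewrite (_ : _ + _ = (p * s + q * r) * (Y * Z' + Y' * Z)); last by ring2.
by rewrite mulf_neq0.
Qed.

Lemma zero_preimage : [/\ a' = 0, b' = 0, c' = 0 & d' = 0] -> [/\ a = 0, b = 0, c = 0 & d = 0].
Proof.
case: subE => e1 e2 e3 e4 [a0 b0 c0' d0].
rewrite /subY3 /subY2Z /subYZ2 /subZ3 /cub a0 b0 c0' d0 !mul0r !addr0 in e1 e2 e3 e4.
by split; apply: (mulfI k0); rewrite mulr0.
Qed.
End SameKind.

Lemma same_kind (al ga a b c d al' ga' a' b' c' d' : F) :
  apolar al ga a b c d -> apolar al' ga' a' b' c' d' ->
  disjoint_roots al ga a b c d -> disjoint_roots al' ga' a' b' c' d' ->
  eqv (net (qc_plane al ga a b c d)) (net (qc_plane al' ga' a' b' c' d')) ->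
  [/\ has_root a b c d <-> has_root a' b' c' d',
      two_roots a b c d <-> two_roots a' b' c' d' &
      [/\ a = 0, b = 0, c = 0 & d = 0] <-> [/\ a' = 0, b' = 0, c' = 0 & d' = 0]].
Proof.
move=> ap ap' gd gd' QQ'.
have [p [q [r [s [k [k0 D0 subE]]]]]] := qc_eqv_sub ap ap' gd' QQ'.
have [p' [q' [r' [s' [k' [k'0 D'0 subE']]]]]] := qc_eqv_sub ap' ap gd (eqv_sym QQ').
split; split.
- exact: (has_root_image D0 subE).
- exact: (has_root_image D'0 subE').
- exact: (two_roots_image D0 subE).
- exact: (two_roots_image D'0 subE').
- exact: (zero_preimage k'0 subE').
- exact: (zero_preimage k0 subE).
Qed.

(** * Invariants of planes *)

(** By [congr_sym6] the symmetric matrices with zero diagonal, which are the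
alternating ones, are stable under congruence. *)
Definition alt (y : 'rV[F]_6) : Prop := forall i, sym_of_pt y i i = 0.
Definition detS (y : 'rV[F]_6) : F := \det (sym_of_pt y).

Lemma altP (a b c d e f : F) : alt (sym6 a b c d e f) <-> [/\ a = 0, d = 0 & f = 0].
Proof.
rewrite /alt sym_sym6; split=> [H | [-> -> ->] i]; last first.
  by rewrite mxE; case: i => [[|[|[|//]]] ?].
have h0 := H 0; have h1 := H (inord 1); have h2 := H (inord 2).
by rewrite !mxE !inordK //= in h0 h1 h2.
Qed.

Lemma alt_congr (A : 'M[F]_3) y : alt y -> alt (congr_pt A y).
Proof.
have [a [b [c [d [e [f ->]]]]]] := sym6_surj y.
have [a1 [a2 [a3 [b1 [b2 [b3 [c1 [c2 [c3 ->]]]]]]]]] := mat9_surj A.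
case/altP=> -> -> ->; rewrite congr_sym6; apply/altP; split; ring2.
Qed.

Lemma detS_congr (A : 'M[F]_3) y : detS (congr_pt A y) = \det A * \det A * detS y.
Proof. by rewrite /detS sym_congr_pt !det_mulmx det_tr mulrAC. Qed.

(** The properties below separate the orbits: the representatives differ in the
number and the span of their rank-1 points, in their alternating points, and in the
effect on the determinant of translating by such points. *)
Definition one_rank1 (U : {vspace 'rV[F]_6}) : Prop :=
  forall r s, r \in U -> s \in U -> rk1 r -> rk1 s -> exists k, s = k *: r.
Definition singular (U : {vspace 'rV[F]_6}) : Prop := forall y, y \in U -> detS y = 0.
Definition rank1_triangle (U : {vspace 'rV[F]_6}) : Prop :=
  exists r s t, [/\ r \in U, s \in U, t \in U & [/\ rk1 r, rk1 s, rk1 t & detS (r + s + t) != 0]].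
Definition no_alt (U : {vspace 'rV[F]_6}) : Prop := forall t, t \in U -> alt t -> t = 0.
Definition alt_meets_rank1 (U : {vspace 'rV[F]_6}) : Prop :=
  exists r t, [/\ r \in U, t \in U & [/\ rk1 r, alt t, t != 0 & detS (r + t) = 0]].
Definition rank1_neutral (U : {vspace 'rV[F]_6}) : Prop :=
  forall y r, y \in U -> r \in U -> rk1 r -> detS (y + r) = detS y.
Definition alt_neutral (U : {vspace 'rV[F]_6}) : Prop :=
  forall y t, y \in U -> t \in U -> alt t -> detS (y + t) = detS y.
Definition some_alt_neutral (U : {vspace 'rV[F]_6}) : Prop :=
  exists t, [/\ t \in U, alt t, t != 0 & forall y, y \in U -> detS (y + t) = detS y].

Definition eqv_invariant (P : {vspace 'rV[F]_6} -> Prop) := forall U V, eqv U V -> P U -> P V.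

Lemma congr_pt_eq0 (A : 'M[F]_3) y : A \in unitmx -> (congr_pt A y == 0) = (y == 0).
Proof.
move=> uA; apply/eqP/eqP=> [E|->]; last exact: linear0.
by rewrite -[y]congr_pt1 -(mulVmx uA) -congr_ptM E linear0.
Qed.

Lemma detA2_neq0 (A : 'M[F]_3) : A \in unitmx -> \det A * \det A != 0.
Proof. by rewrite unitmxE unitfE => d0; rewrite mulf_neq0. Qed.

Lemma alt_congrE (A : 'M[F]_3) y : A \in unitmx -> alt (congr_pt A y) -> alt y.
Proof.
by move=> uA /(alt_congr (invmx A)); rewrite congr_ptM mulVmx // congr_pt1.
Qed.

Lemma one_rank1_inv : eqv_invariant one_rank1.
Proof.
move=> U V [A uA <-] H r s /congr_vsP[x xU ->] /congr_vsP[y yU ->].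
rewrite !rk1_congr // => x1 y1; have [k ->] := H x y xU yU x1 y1.
by exists k; rewrite linearZ.
Qed.

Lemma singular_inv : eqv_invariant singular.
Proof.
by move=> U V [A uA <-] H _ /congr_vsP[x xU ->]; rewrite detS_congr H // mulr0.
Qed.

Lemma rank1_triangle_inv : eqv_invariant rank1_triangle.
Proof.
move=> U V [A uA <-] [r [s [t [rU sU tU [r1 s1 t1 d0]]]]].
exists (congr_pt A r), (congr_pt A s), (congr_pt A t); split; rewrite ?mem_congr_vs //.
by split; rewrite ?rk1_congr // -!linearD detS_congr mulf_neq0 ?detA2_neq0.
Qed.

Lemma no_alt_inv : eqv_invariant no_alt.
Proof.
move=> U V [A uA <-] H _ /congr_vsP[x xU ->] /(alt_congrE uA) ax.
by rewrite (H x) ?linear0.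
Qed.

Lemma alt_meets_rank1_inv : eqv_invariant alt_meets_rank1.
Proof.
move=> U V [A uA <-] [r [t [rU tU [r1 at_ t0 d0]]]].
exists (congr_pt A r), (congr_pt A t); split; rewrite ?mem_congr_vs //.
by split; rewrite ?rk1_congr ?congr_pt_eq0 -?linearD ?detS_congr ?d0 ?mulr0 //; exact: alt_congr.
Qed.

Lemma rank1_neutral_inv : eqv_invariant rank1_neutral.
Proof.
move=> U V [A uA <-] H _ _ /congr_vsP[x xU ->] /congr_vsP[r rU ->].
by rewrite rk1_congr // => r1; rewrite -linearD !detS_congr H.
Qed.

Lemma alt_neutral_inv : eqv_invariant alt_neutral.
Proof.
move=> U V [A uA <-] H _ _ /congr_vsP[x xU ->] /congr_vsP[t tU ->] /(alt_congrE uA) ta.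
by rewrite -linearD !detS_congr H.
Qed.

Lemma some_alt_neutral_inv : eqv_invariant some_alt_neutral.
Proof.
move=> U V [A uA <-] [t [tU ta t0 H]]; exists (congr_pt A t).
split; rewrite ?mem_congr_vs ?congr_pt_eq0 //; first exact: alt_congr.
by move=> _ /congr_vsP[x xU ->]; rewrite -linearD !detS_congr H.
Qed.

(** A property of the cubic of a plane, transported to all equivalent planes. *)
Definition cubic_kind (P : F -> F -> F -> F -> Prop) (U : {vspace 'rV[F]_6}) : Prop :=
  exists al ga a b c d, [/\ apolar al ga a b c d, disjoint_roots al ga a b c d,
    eqv U (net (qc_plane al ga a b c d)) & P a b c d].

Definition zero_cubic (a b c d : F) := [/\ a = 0, b = 0, c = 0 & d = 0].

Lemma cubic_kind_inv P : eqv_invariant (cubic_kind P).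
Proof.
move=> U V UV [al [ga [a [b [c [d [ap gd UQ Pg]]]]]]].
by exists al, ga, a, b, c, d; split=> //; apply: eqv_trans (eqv_sym UV) UQ.
Qed.

(** The values are the indices of the orbits, except that 12, 13 and 14 stand for
cubics with one, no and three roots.  The zero cubic is tested
first since it would pass for one with two roots. *)
Definition plane_class (U : {vspace 'rV[F]_6}) : nat :=
  if `[< one_rank1 U >] then
    if `[< singular U >] then 7
    else if `[< no_alt U >] then
      if `[< cubic_kind zero_cubic U >] then 6
      else if `[< cubic_kind two_roots U >] then 14
      else if `[< cubic_kind has_root U >] then 12 else 13
    else if `[< alt_meets_rank1 U >] then
      if `[< rank1_neutral U >] then 15
      else if `[< alt_neutral U >] then 9
      else if `[< some_alt_neutral U >] then 8 else 10
    else 11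
  else if `[< singular U >] then 1
  else if `[< rank1_triangle U >] then 2
  else if `[< no_alt U >] then 5
  else if `[< alt_meets_rank1 U >] then 3 else 4.

Lemma inv_asbool P U V : eqv_invariant P -> eqv U V -> `[< P U >] = `[< P V >].
Proof.
move=> Pinv UV; apply: asbool_equiv_eq.
by split; apply: Pinv => //; exact: eqv_sym.
Qed.

Lemma plane_class_eqv U V : eqv U V -> plane_class U = plane_class V.
Proof.
move=> UV; rewrite /plane_class (inv_asbool one_rank1_inv UV) (inv_asbool singular_inv UV)
  (inv_asbool rank1_triangle_inv UV)
 (inv_asbool no_alt_inv UV) (inv_asbool alt_meets_rank1_inv UV) (inv_asbool rank1_neutral_inv
   UV) (inv_asbool alt_neutral_inv UV)
 (inv_asbool some_alt_neutral_inv UV).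
by rewrite !(inv_asbool (@cubic_kind_inv _) UV).
Qed.

(** * The classes of the representatives *)

Notation E22 := (sym6 0 0 0 1 0 0).

Lemma rk1_E11 : rk1 E11.
Proof.
rewrite (_ : E11 = nu 1 0 0); last by rewrite /nu; congr sym6; ring2.
by rewrite nu_rk1 ?oner_neq0.
Qed.

Lemma rk1_E22 : rk1 E22.
Proof.
rewrite (_ : E22 = nu 0 1 0); last by rewrite /nu; congr sym6; ring2.
by rewrite nu_rk1 ?oner_neq0 ?orbT.
Qed.

Lemma one_rank1_of (U : {vspace 'rV[F]_6}) r0 :
  (forall u1 u2 u3, nu u1 u2 u3 \in U -> exists k, nu u1 u2 u3 = k *: r0) -> one_rank1 U.
Proof.
move=> H r s rU sU r1 s1.
have [u1 [u2 [u3 [_ rE]]]] := rk1_nu r1; have [v1 [v2 [v3 [_ sE]]]] := rk1_nu s1.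
rewrite rE in rU r1 *; rewrite sE in sU *.
have [k kE] := H _ _ _ rU; have [l ->] := H _ _ _ sU; rewrite kE in r1 *.
have k0 : k != 0 by apply: contraTneq (rk1_neq0 r1) => ->; rewrite scale0r eqxx.
by exists (l / k); rewrite scalerA divfK.
Qed.

Lemma not_one_rank1 (U : {vspace 'rV[F]_6}) : E11 \in U -> E22 \in U -> ~ one_rank1 U.
Proof.
move=> e1 e2 H; have [k] := H _ _ e1 e2 rk1_E11 rk1_E22.
by rewrite scale_sym6 => /sym6_inj[_ [/eqP]]; rewrite mulr0 oner_eq0.
Qed.

Lemma detS_sym6 (a b c d e f : F) :
  detS (sym6 a b c d e f) = a * d * f + a * e * e + d * c * c + f * b * b.
Proof. exact: det_sym6. Qed.

Lemma not_singular (U : {vspace 'rV[F]_6}) y : y \in U -> detS y != 0 -> ~ singular U.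
Proof. by move=> yU /eqP d0 H; apply: d0; apply: H. Qed.

Lemma not_rank1_triangle (U : {vspace 'rV[F]_6}) :
  (forall u1 u2 u3, nu u1 u2 u3 \in U -> u3 = 0 /\ u1 * u2 = 0) -> ~ rank1_triangle U.
Proof.
move=> H [r [s [t [rU sU tU [r1 s1 t1 /eqP d0]]]]]; apply: d0.
have diag y : y \in U -> rk1 y -> exists a b, y = sym6 a 0 0 b 0 0.
  move=> yU /rk1_nu[u1 [u2 [u3 [_ yE]]]]; rewrite yE in yU *; have [u30 u120] := H _ _ _ yU.
  by exists (u1 * u1), (u2 * u2); rewrite /nu u30 u120 !mulr0.
have [a [b ->]] := diag _ rU r1; have [a' [b' ->]] := diag _ sU s1;
  have [a'' [b'' ->]] := diag _ tU t1.
by rewrite !add_sym6 detS_sym6; ring2.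
Qed.

Lemma not_no_alt (U : {vspace 'rV[F]_6}) t : t \in U -> alt t -> t != 0 -> ~ no_alt U.
Proof. by move=> tU ta /eqP t0 H; apply: t0; apply: H. Qed.

Ltac inS lin a b c := apply/(netP _ lin); exists a, b, c; congr sym6; ring2.

Lemma sq0 (x : F) : x * x = 0 -> x = 0.
Proof. by move=> /eqP; rewrite mulf_eq0 orbb => /eqP. Qed.

Lemma nu_E11 (u : F) : nu u 0 0 = (u * u) *: E11.
Proof. by rewrite scale_sym6 /nu; congr sym6; ring2. Qed.

Lemma sym6_neq0 (a b c d e f : F) : [|| a != 0, b != 0, c != 0, d != 0, e != 0 | f != 0] ->
  sym6 a b c d e f != 0.
Proof.
apply: contraTneq => /sym6_eq0[[-> -> ->] [-> -> ->]]; by rewrite eqxx.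
Qed.

Ltac neq0 := apply: sym6_neq0; rewrite ?oner_neq0 ?orbT //.
Ltac altt := apply/altP; split; ring2.

Lemma nu_sigma3 u1 u2 u3 : nu u1 u2 u3 \in net sigma3 -> u3 = 0 /\ u1 * u2 = 0.
Proof. by case/(netP _ lin_sigma3)=> x [y [z]] /sym6_inj[[_ e12 _] [_ _ e33]]; split=> //;
  exact: sq0. Qed.
Lemma nu_sigma4 u1 u2 u3 : nu u1 u2 u3 \in net sigma4 -> u3 = 0 /\ u1 * u2 = 0.
Proof. by case/(netP _ lin_sigma4)=> x [y [z]] /sym6_inj[[_ e12 _] [_ _ e33]]; split=> //;
  exact: sq0. Qed.
Lemma nu_sigma5 u1 u2 u3 : nu u1 u2 u3 \in net sigma5 -> u3 = 0 /\ u1 * u2 = 0.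
Proof.
case/(netP _ lin_sigma5)=> x [y [z]] /sym6_inj[[_ e12 e13] [_ e23 e33]]; split=> //.
apply: sq0; apply: sq0; transitivity (u3 * u3 * (u3 * u3)); first by ring2.
rewrite {1}e33 e33 -{1}e13 -e23; transitivity (u1 * u2 * (u3 * u3)); first by ring2.
by rewrite e12 mul0r.
Qed.
Lemma nu_sigma7 u1 u2 u3 : nu u1 u2 u3 \in net sigma7 -> exists k, nu u1 u2 u3 = k *: E11.
Proof.
case/(netP _ lin_sigma7)=> x [y [z]] /sym6_inj[_ [/sq0 e22 _ /sq0 e33]].
by exists (u1 * u1); rewrite e22 e33 nu_E11.
Qed.
Lemma nu_sigma8 u1 u2 u3 : nu u1 u2 u3 \in net sigma8 -> exists k, nu u1 u2 u3 = k *: E11.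
Proof.
case/(netP _ lin_sigma8)=> x [y [z]] /sym6_inj[_ [/sq0 e22 _ /sq0 e33]].
by exists (u1 * u1); rewrite e22 e33 nu_E11.
Qed.
Lemma nu_sigma9 u1 u2 u3 : nu u1 u2 u3 \in net sigma9 -> exists k, nu u1 u2 u3 = k *: E11.
Proof.
case/(netP _ lin_sigma9)=> x [y [z]] /sym6_inj[_ [e22 e23 /sq0 e33]].
have e22' : u2 = 0 by apply: sq0; rewrite e22 -e23 e33 mulr0.
by exists (u1 * u1); rewrite e22' e33 nu_E11.
Qed.
Lemma nu_sigma10 u1 u2 u3 : nu u1 u2 u3 \in net sigma10 -> exists k, nu u1 u2 u3 = k *: E11.
Proof.
case/(netP _ lin_sigma10)=> x [y [z]] /sym6_inj[_ [e22 e23 e33]].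
have e : u2 = u3 by apply: sqr_inj; rewrite e22 e33.
rewrite e in e23; have u30 := sq0 e23.
by exists (u1 * u1); rewrite e u30 nu_E11.
Qed.
Lemma nu_sigma11 u1 u2 u3 : nu u1 u2 u3 \in net sigma11 ->
  exists k, nu u1 u2 u3 = k *: sym6 0 0 0 1 1 1.
Proof.
case/(netP _ lin_sigma11)=> x [y [z]] /sym6_inj[[e11 e12 e13] [e22 e23 e33]].
have x0 : u1 = 0.
  have [u30|u30] := eqVneq u3 0; last by move/eqP: e13; rewrite mulf_eq0 (negPf u30) orbF => /eqP.
  apply: sq0; rewrite e11; transitivity (x + z + z); first by ring2.
  by rewrite -e33 -e23 u30; ring2.
have e : u2 = u3 by apply: sqr_inj; rewrite e22 e33 -e11 x0; ring2.
exists (u3 * u3); rewrite scale_sym6 /nu e x0; congr sym6; ring2.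
Qed.
Lemma nu_sigma15 u1 u2 u3 : nu u1 u2 u3 \in net sigma15 -> exists k, nu u1 u2 u3 = k *: E11.
Proof.
case/(netP _ lin_sigma15)=> x [y [z]] /sym6_inj[[_ _ e13] [e22 _ /sq0 e33]].
have e22' : u2 = 0 by apply: sq0; rewrite e22 -e13 e33 mulr0.
by exists (u1 * u1); rewrite e22' e33 nu_E11.
Qed.

Lemma rk1_line (U : {vspace 'rV[F]_6}) r0 :
  (forall u1 u2 u3, nu u1 u2 u3 \in U -> exists k, nu u1 u2 u3 = k *: r0) ->
  forall r, r \in U -> rk1 r -> exists2 k, k != 0 & r = k *: r0.
Proof.
move=> H r rU r1; have [u1 [u2 [u3 [_ rE]]]] := rk1_nu r1; rewrite rE in rU r1 *.
have [k kE] := H _ _ _ rU; exists k => //; apply: contraTneq (rk1_neq0 r1) => k0.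
by rewrite kE k0 scale0r eqxx.
Qed.

Lemma E11_sigma1 : E11 \in net sigma1. Proof. by inS lin_sigma1 (1:F) (0:F) (0:F). Qed.
Lemma E11_sigma2 : E11 \in net sigma2. Proof. by inS lin_sigma2 (1:F) (0:F) (0:F). Qed.
Lemma E11_sigma3 : E11 \in net sigma3. Proof. by inS lin_sigma3 (1:F) (0:F) (0:F). Qed.
Lemma E11_sigma4 : E11 \in net sigma4. Proof. by inS lin_sigma4 (1:F) (0:F) (0:F). Qed.
Lemma E11_sigma5 : E11 \in net sigma5. Proof. by inS lin_sigma5 (1:F) (0:F) (0:F). Qed.
Lemma E11_sigma6 c : E11 \in net (sigma6 c). Proof. by inS (@lin_sigma6 c) (1:F) (0:F) (0:F). Qed.
Lemma E11_sigma7 : E11 \in net sigma7. Proof. by inS lin_sigma7 (1:F) (0:F) (0:F). Qed.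
Lemma E11_sigma8 : E11 \in net sigma8. Proof. by inS lin_sigma8 (1:F) (0:F) (0:F). Qed.
Lemma E11_sigma9 : E11 \in net sigma9. Proof. by inS lin_sigma9 (1:F) (0:F) (0:F). Qed.
Lemma E11_sigma10 : E11 \in net sigma10. Proof. by inS lin_sigma10 (1:F) (0:F) (0:F). Qed.
Lemma E11_sigma15 : E11 \in net sigma15. Proof. by inS lin_sigma15 (1:F) (0:F) (0:F). Qed.

Lemma not_singular_at P x y z : lin3 P -> detS (P x y z) = 1 -> ~ singular (net P).
Proof.
move=> linP d1; apply: (@not_singular _ (P x y z)); first exact: mem_net.
by rewrite d1 oner_neq0.
Qed.

Lemma plane_class_sigma1 : plane_class (net sigma1) = 1%N.
Proof.
rewrite /plane_class (asboolF (P := one_rank1 _)); last first.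
  by apply: not_one_rank1; [exact: E11_sigma1 | inS lin_sigma1 (0:F) (0:F) (1:F)].
rewrite (asboolT (P := singular _)) // => _ /(netP _ lin_sigma1)[x [y [z ->]]].
by rewrite detS_sym6; ring2.
Qed.

Lemma plane_class_sigma2 : plane_class (net sigma2) = 2%N.
Proof.
rewrite /plane_class (asboolF (P := one_rank1 _)); last first.
  by apply: not_one_rank1; [exact: E11_sigma2 | inS lin_sigma2 (0:F) (1:F) (0:F)].
rewrite (asboolF (P := singular _)); last first.
  by apply: (@not_singular_at _ 1 1 1 lin_sigma2); rewrite detS_sym6; ring2.
rewrite (asboolT (P := rank1_triangle _)) //.
exists E11, E22, (nu 0 0 1); split;
  [exact: E11_sigma2 | inS lin_sigma2 (0:F) (1:F) (0:F) | inS lin_sigma2 (0:F) (0:F) (1:F) | ].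
split; [exact: rk1_E11 | exact: rk1_E22 | by rewrite nu_rk1 ?oner_neq0 ?orbT | ].
rewrite /nu !add_sym6 detS_sym6 (_ : _ + _ = 1) ?oner_neq0 //; ring2.
Qed.

Lemma plane_class_sigma3 : plane_class (net sigma3) = 3%N.
Proof.
rewrite /plane_class (asboolF (P := one_rank1 _)); last first.
  by apply: not_one_rank1; [exact: E11_sigma3 | inS lin_sigma3 (0:F) (1:F) (0:F)].
rewrite (asboolF (P := singular _)); last first.
  by apply: (@not_singular_at _ 0 1 1 lin_sigma3); rewrite detS_sym6; ring2.
rewrite (asboolF (P := rank1_triangle _)); last by apply: not_rank1_triangle; exact: nu_sigma3.
rewrite (asboolF (P := no_alt _)); last first.
  apply: (@not_no_alt _ (sigma3 0 0 1)); [exact: mem_net lin_sigma3 | altt | neq0].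
rewrite (asboolT (P := alt_meets_rank1 _)) //.
exists E11, (sigma3 0 0 1); split; [exact: E11_sigma3 | exact: mem_net lin_sigma3 | ].
split; [exact: rk1_E11 | altt | neq0 | ].
by rewrite !add_sym6 detS_sym6; ring2.
Qed.

Lemma plane_class_sigma4 : plane_class (net sigma4) = 4%N.
Proof.
rewrite /plane_class (asboolF (P := one_rank1 _)); last first.
  by apply: not_one_rank1; [exact: E11_sigma4 | inS lin_sigma4 (0:F) (1:F) (0:F)].
rewrite (asboolF (P := singular _)); last first.
  by apply: (@not_singular_at _ 1 0 1 lin_sigma4); rewrite detS_sym6; ring2.
rewrite (asboolF (P := rank1_triangle _)); last by apply: not_rank1_triangle; exact: nu_sigma4.
rewrite (asboolF (P := no_alt _)); last first.
  apply: (@not_no_alt _ (sigma4 0 0 1)); [exact: mem_net lin_sigma4 | altt | neq0].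
rewrite (asboolF (P := alt_meets_rank1 _)) // => -[r [t [rU tU [r1 ta t0 d0]]]].
have [u1 [u2 [u3 [u0 rE]]]] := rk1_nu r1; rewrite rE in rU d0.
have [u30 u12] := nu_sigma4 rU.
case/(netP _ lin_sigma4): tU => x [y [z tE]]; rewrite tE in ta t0 d0.
have [x0 y0 _] := proj1 (altP _ _ _ _ _ _) ta.
move: d0; rewrite x0 y0 u30 /nu !add_sym6 detS_sym6 => d0.
have u12' : u1 + u2 != 0.
  apply: contraTneq u0 => u12_0.
  have u12E : u1 = u2 by transitivity (u1 + u2 + u2); [ring2 | rewrite u12_0 add0r].
  by rewrite u12E in u12 *; rewrite u30 (sq0 u12) eqxx.
have z0 : z = 0.
  apply: sq0; apply: (mulfI u12'); apply: (mulfI u12'); rewrite !mulr0 -d0.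
  by transitivity ((u1 * u1 + u2 * u2) * (z * z)); ring2.
by move/eqP: t0; apply; rewrite x0 y0 z0 /sigma4 sym6_0.
Qed.

Lemma plane_class_sigma5 : plane_class (net sigma5) = 5%N.
Proof.
rewrite /plane_class (asboolF (P := one_rank1 _)); last first.
  by apply: not_one_rank1; [exact: E11_sigma5 | inS lin_sigma5 (0:F) (1:F) (0:F)].
rewrite (asboolF (P := singular _)); last first.
  by apply: (@not_singular_at _ 1 0 1 lin_sigma5); rewrite detS_sym6; ring2.
rewrite (asboolF (P := rank1_triangle _)); last by apply: not_rank1_triangle; exact: nu_sigma5.
rewrite (asboolT (P := no_alt _)) // => _ /(netP _ lin_sigma5)[x [y [z ->]]].
by case/altP=> -> -> ->; rewrite /sigma5 sym6_0.
Qed.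

Lemma plane_class_sigma7 : plane_class (net sigma7) = 7%N.
Proof.
rewrite /plane_class (asboolT (P := one_rank1 _)); last exact: one_rank1_of nu_sigma7.
rewrite (asboolT (P := singular _)) // => _ /(netP _ lin_sigma7)[x [y [z ->]]].
by rewrite detS_sym6; ring2.
Qed.

Lemma plane_class_sigma8 : plane_class (net sigma8) = 8%N.
Proof.
rewrite /plane_class (asboolT (P := one_rank1 _)); last exact: one_rank1_of nu_sigma8.
rewrite (asboolF (P := singular _)); last first.
  by apply: (@not_singular_at _ 1 0 1 lin_sigma8); rewrite detS_sym6; ring2.
rewrite (asboolF (P := no_alt _)); last first.
  apply: (@not_no_alt _ (sigma8 0 1 0)); [exact: mem_net lin_sigma8 | altt | neq0].
rewrite (asboolT (P := alt_meets_rank1 _)); last first.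
  exists E11, (sigma8 0 1 0); split; [exact: E11_sigma8 | exact: mem_net lin_sigma8 | ].
  split; [exact: rk1_E11 | altt | neq0 | ].
  by rewrite !add_sym6 detS_sym6; ring2.
rewrite (asboolF (P := rank1_neutral _)); last first.
  move/(_ (sigma8 0 0 1) E11 (mem_net _ _ _ lin_sigma8) E11_sigma8 rk1_E11)/eqP.
  by rewrite !add_sym6 !detS_sym6 !(mul0r, mulr0, mulr1, addr0, add0r) oner_eq0.
rewrite (asboolF (P := alt_neutral _)); last first.
  have ta : alt (sigma8 0 0 1) by altt.
  move/(_ E11 (sigma8 0 0 1) E11_sigma8 (mem_net _ _ _ lin_sigma8) ta)/eqP.
  by rewrite !add_sym6 !detS_sym6 !(mul0r, mulr0, mulr1, addr0, add0r) oner_eq0.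
rewrite (asboolT (P := some_alt_neutral _)) //.
exists (sigma8 0 1 0); split; [exact: mem_net lin_sigma8 | altt | neq0 | ].
by move=> _ /(netP _ lin_sigma8)[x [y [z ->]]]; rewrite !add_sym6 !detS_sym6; ring2.
Qed.

Lemma plane_class_sigma9 : plane_class (net sigma9) = 9%N.
Proof.
rewrite /plane_class (asboolT (P := one_rank1 _)); last exact: one_rank1_of nu_sigma9.
rewrite (asboolF (P := singular _)); last first.
  by apply: (@not_singular_at _ 1 0 1 lin_sigma9); rewrite detS_sym6; ring2.
rewrite (asboolF (P := no_alt _)); last first.
  apply: (@not_no_alt _ (sigma9 0 1 0)); [exact: mem_net lin_sigma9 | altt | neq0].
rewrite (asboolT (P := alt_meets_rank1 _)); last first.
  exists E11, (sigma9 0 1 0); split; [exact: E11_sigma9 | exact: mem_net lin_sigma9 | ].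
  split; [exact: rk1_E11 | altt | neq0 | ].
  by rewrite !add_sym6 detS_sym6; ring2.
rewrite (asboolF (P := rank1_neutral _)); last first.
  move/(_ (sigma9 0 0 1) E11 (mem_net _ _ _ lin_sigma9) E11_sigma9 rk1_E11)/eqP.
  by rewrite !add_sym6 !detS_sym6 !(mul0r, mulr0, mulr1, addr0, add0r) oner_eq0.
rewrite (asboolT (P := alt_neutral _)) //.
move=> _ _ /(netP _ lin_sigma9)[x [y [z ->]]] /(netP _ lin_sigma9)[x' [y' [z' ->]]] /altP[-> -> _].
by rewrite !add_sym6 !detS_sym6; ring2.
Qed.

Lemma plane_class_sigma10 : plane_class (net sigma10) = 10%N.
Proof.
rewrite /plane_class (asboolT (P := one_rank1 _)); last exact: one_rank1_of nu_sigma10.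
rewrite (asboolF (P := singular _)); last first.
  by apply: (@not_singular_at _ 1 0 1 lin_sigma10); rewrite detS_sym6; ring2.
rewrite (asboolF (P := no_alt _)); last first.
  apply: (@not_no_alt _ (sigma10 0 1 0)); [exact: mem_net lin_sigma10 | altt | neq0].
rewrite (asboolT (P := alt_meets_rank1 _)); last first.
  exists E11, (sigma10 0 1 0); split; [exact: E11_sigma10 | exact: mem_net lin_sigma10 | ].
  split; [exact: rk1_E11 | altt | neq0 | ].
  by rewrite !add_sym6 detS_sym6; ring2.
rewrite (asboolF (P := rank1_neutral _)); last first.
  move/(_ (sigma10 0 0 1) E11 (mem_net _ _ _ lin_sigma10) E11_sigma10 rk1_E11)/eqP.
  by rewrite !add_sym6 !detS_sym6 !(mul0r, mulr0, mulr1, addr0, add0r) oner_eq0.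
rewrite (asboolF (P := alt_neutral _)); last first.
  have ta : alt (sigma10 0 1 0) by altt.
  move/(_ (sigma10 0 0 1) (sigma10 0 1 0) (mem_net _ _ _ lin_sigma10) (mem_net _ _ _
    lin_sigma10) ta)/eqP.
  by rewrite !add_sym6 !detS_sym6 !(mul0r, mulr0, mulr1, addr0, add0r) oner_eq0.
rewrite (asboolF (P := some_alt_neutral _)) // => -[_ [/(netP _ lin_sigma10)[x [y [z ->]]]
  /altP[-> -> _] t0]].
move/(_ (sigma10 0 0 1) (mem_net _ _ _ lin_sigma10)); rewrite !add_sym6 !detS_sym6.
rewrite !(mul0r, mulr0, mulr1, mul1r, addr0, add0r) => /sq0 y0.
by move: t0; rewrite y0 /sigma10 sym6_0 eqxx.
Qed.

Lemma plane_class_sigma11 : plane_class (net sigma11) = 11%N.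
Proof.
rewrite /plane_class (asboolT (P := one_rank1 _)); last exact: one_rank1_of nu_sigma11.
rewrite (asboolF (P := singular _)); last first.
  by apply: (@not_singular_at _ 1 0 1 lin_sigma11); rewrite detS_sym6; ring2.
rewrite (asboolF (P := no_alt _)); last first.
  apply: (@not_no_alt _ (sigma11 0 1 0)); [exact: mem_net lin_sigma11 | altt | neq0].
rewrite (asboolF (P := alt_meets_rank1 _)) // => -[r [t [rU tU [r1 ta t0 d0]]]].
have [k k0 rE] := rk1_line nu_sigma11 rU r1.
case/(netP _ lin_sigma11): tU => x [y [z tE]]; rewrite tE in ta t0 d0.
have [x0 z0 _] := proj1 (altP _ _ _ _ _ _) ta.
move: d0; rewrite x0 z0 rE scale_sym6 !add_sym6 detS_sym6 => d0.
have y0 : y = 0.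
  apply: sq0; apply: (mulfI k0); rewrite mulr0 -d0; ring2.
by move/eqP: t0; apply; rewrite x0 y0 z0 /sigma11 addr0 sym6_0.
Qed.

Lemma plane_class_sigma15 : plane_class (net sigma15) = 15%N.
Proof.
rewrite /plane_class (asboolT (P := one_rank1 _)); last exact: one_rank1_of nu_sigma15.
rewrite (asboolF (P := singular _)); last first.
  by apply: (@not_singular_at _ 0 0 1 lin_sigma15); rewrite detS_sym6; ring2.
rewrite (asboolF (P := no_alt _)); last first.
  apply: (@not_no_alt _ (sigma15 0 1 0)); [exact: mem_net lin_sigma15 | altt | neq0].
rewrite (asboolT (P := alt_meets_rank1 _)); last first.
  exists E11, (sigma15 0 1 0); split; [exact: E11_sigma15 | exact: mem_net lin_sigma15 | ].
  split; [exact: rk1_E11 | altt | neq0 | ].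
  by rewrite !add_sym6 detS_sym6; ring2.
rewrite (asboolT (P := rank1_neutral _)) //.
move=> _ r /(netP _ lin_sigma15)[x [y [z ->]]] rU r1.
have [k k0 ->] := rk1_line nu_sigma15 rU r1.
by rewrite scale_sym6 !add_sym6 !detS_sym6; ring2.
Qed.

Lemma plane_class_qc (al ga a b c d : F) : apolar al ga a b c d -> disjoint_roots al ga a b c d ->
  plane_class (net (qc_plane al ga a b c d)) =
    if `[< zero_cubic a b c d >] then 6%N else if `[< two_roots a b c d >] then 14%N
    else if `[< has_root a b c d >] then 12%N else 13%N.
Proof.
move=> ap gd; rewrite /plane_class (asboolT (P := one_rank1 _)); last first.
  apply: (@one_rank1_of _ E11) => u1 u2 u3 /nu_in_qc[q0 c0]; have [-> ->] := gd _ _ q0 c0.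
  by exists (u1 * u1); rewrite nu_E11.
rewrite (asboolF (P := singular _)); last first.
  move=> H; have detQ x y z : detS (qc_plane al ga a b c d x y z) = 0 by apply: H;
    apply: mem_net; exact: lin_qc.
  have pQ y z : y * z + (al * y + ga * z) * (al * y + ga * z) = 0.
    transitivity (detS (qc_plane al ga a b c d 1 y z) + detS (qc_plane al ga a b c d 0 y z)).
      by rewrite !detS_sym6; ring2.
    by rewrite !detQ addr0.
  have al0 : al = 0 by apply: sq0; rewrite -(pQ 1 0); ring2.
  have ga0 : ga = 0 by apply: sq0; rewrite -(pQ 0 1); ring2.
  have /eqP : (1 : F) = 0 by rewrite -(pQ 1 1) al0 ga0; ring2.
  by rewrite oner_eq0.
rewrite (asboolT (P := no_alt _)); last first.
  by move=> _ /(netP _ (@lin_qc _ _ _ _ _ _))[x [y [z ->]]] /altP[-> -> ->];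
    rewrite /qc_plane !mulr0 addr0 sym6_0.
have kindE P : (forall al' ga' a' b' c' d' , apolar al' ga' a' b' c' d' ->
  disjoint_roots al' ga' a' b' c' d' ->
    eqv (net (qc_plane al ga a b c d)) (net (qc_plane al' ga' a' b' c' d')) ->
      (P a b c d <-> P a' b' c' d')) ->
    `[< cubic_kind P (net (qc_plane al ga a b c d)) >] = `[< P a b c d >].
  move=> PE; apply: asbool_equiv_eq; split.
    by case=> al' [ga' [a' [b' [c' [d' [ap' gd' QQ' P']]]]]]; apply/(PE _ _ _ _ _ _ ap' gd' QQ').
  by move=> Pg; exists al, ga, a, b, c, d; split=> //; exact: eqv_refl.
by rewrite !kindE // => al' ga' a' b' c' d' ap' gd' QQ'; have [] := same_kind ap ap' gd gd' QQ'.
Qed.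

Lemma plane_class_cubic (a b c d : F) : a * d + b * c != 0 -> plane_class (cubic_plane a b c d) =
  if `[< two_roots a b c d >] then 14%N else if `[< has_root a b c d >] then 12%N else 13%N.
Proof.
move=> h0; have ap := cubic_plane_apolar h0; rewrite /cubic_plane plane_class_qc //; last first.
  by move=> Y Z; exact: no_common_root ap h0.
rewrite (asboolF (P := zero_cubic _ _ _ _)) // => -[a0 b0 _ _].
by move: h0; rewrite a0 b0 !mul0r addr0 eqxx.
Qed.

Lemma plane_class_qc0 (al ga : F) : ~ AS (al * ga) ->
  plane_class (net (qc_plane al ga 0 0 0 0)) = 6%N.
Proof.
move=> nAS; rewrite plane_class_qc; first by rewrite asboolT.
  by split; ring2.
move=> Y Z q0 _; have [/andP[/eqP-> /eqP->] //|nz] := boolP ((Y == 0) && (Z == 0)).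
by case: nAS; apply/quad_root; exists Y, Z; rewrite -negb_and.
Qed.

(** * The fifteen orbits *)

Lemma E11_qc (al ga a b c d : F) : E11 \in net (qc_plane al ga a b c d).
Proof. by inS (@lin_qc al ga a b c d) (1:F) (0:F) (0:F). Qed.

Lemma rank1_planeI (U : {vspace 'rV[F]_6}) y : \dim U = 3%N -> y \in U -> rk1 y ->
  U \in rank1_planes F.
Proof. by move=> dU yU y1; rewrite inE dU eqxx; apply/existsP; exists y; rewrite yU. Qed.

Lemma rank1_E11 (U : {vspace 'rV[F]_6}) : \dim U = 3%N -> E11 \in U -> U \in rank1_planes F.
Proof. by move=> dU eU; apply: rank1_planeI dU eU rk1_E11. Qed.

Lemma rank1_qc (al ga a b c d : F) : net (qc_plane al ga a b c d) \in rank1_planes F.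
Proof. by apply: rank1_E11; [exact: dim_qc | exact: E11_qc]. Qed.

Lemma rank1_sigma11 : net sigma11 \in rank1_planes F.
Proof.
apply: (@rank1_planeI _ (sigma11 0 0 1)); [exact: dim_sigma11 | exact: mem_net lin_sigma11 | ].
rewrite (_ : sigma11 0 0 1 = nu 0 1 1); last by rewrite /nu /sigma11; congr sym6; ring2.
by rewrite nu_rk1 ?oner_neq0 ?orbT.
Qed.

(** The quadratic form of the second case has no root, and the
fourth case consists of irreducible cubics. *)
Lemma normal_form (U : {vspace 'rV[F]_6}) : U \in rank1_planes F ->
  exists2 W, eqv U W &
   [\/ W \in [:: net sigma2, net sigma5 & nine_planes],
       exists al ga, ~ AS (al * ga) /\ W = net (qc_plane al ga 0 0 0 0),
       exists e, W = cubic_plane 0 1 1 e |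
       exists a b c d, ~ has_root a b c d /\ W = cubic_plane a b c d].
Proof.
move=> /rank1_plane_E11[V UV [dV e1V]].
have [[W WL VW] | [al [ga [a0 [b0 [c0 [d0 VE]]]]]]] := nine_planes_or_qc dV e1V.
  by exists W; [apply: eqv_trans UV VW | constructor 1; rewrite 2!in_cons WL !orbT].
have [a [b [c [d [ap VQ]]]]] := qc_apolar al ga a0 b0 c0 d0.
rewrite -VE in VQ; have UQ := eqv_trans UV VQ.
have [h0|h0] := eqVneq (a * d + b * c) 0; last first.
  rewrite (apolar_cubic_plane ap h0) in UQ.
  have [hr|nr] := pselect (has_root a b c d).
    have [e Qe] := cubic_plane_root h0 hr.
    by exists (cubic_plane 0 1 1 e); [apply: eqv_trans UQ Qe | constructor 3; exists e].
  by exists (cubic_plane a b c d) => //; constructor 4; exists a, b, c, d.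
have [g0|] := boolP [|| a != 0, b != 0, c != 0 | d != 0].
  exists (net sigma5); first exact: eqv_trans UQ (qc_sigma5 ap h0 g0).
  by constructor 1; rewrite !inE eqxx orbT.
rewrite !negb_or !negbK => /and4P[/eqP az /eqP bz /eqP cz /eqP dz].
rewrite az bz cz dz in UQ.
have [/quad_root[Y [Z [YZ0 q0]]]|nAS] := pselect (AS (al * ga)).
  exists (net sigma2); first exact: eqv_trans UQ (qc_sigma2 YZ0 q0).
  by constructor 1; rewrite !inE eqxx.
by exists (net (qc_plane al ga 0 0 0 0)) => //; constructor 2; exists al, ga.
Qed.

(** [irr_Moebius] in terms of planes. *)
Lemma cubic_plane_no_root (a b c d a' b' c' d' : F) :
  ~ has_root a b c d -> ~ has_root a' b' c' d' ->
    eqv (cubic_plane a b c d) (cubic_plane a' b' c' d').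
Proof.
move=> nr nr'; have [p [q [r [s [k [k0 D0 [e1 e2 e3 e4]]]]]]] := irr_Moebius nr nr'.
exact: proj2 (cubic_plane_sub (no_root_disc nr') k0 D0 e1 e2 e3 e4).
Qed.

Lemma two_roots_has_root (a b c d : F) : two_roots a b c d -> has_root a b c d.
Proof.
case=> Y [Z [Y' [Z' [D0 [E E']]]]]; have [YZ0|] := boolP ((Y != 0) || (Z != 0)).
  by exists Y, Z.
rewrite negb_or !negbK => /andP[/eqP Y0 /eqP Z0].
by move: D0; rewrite Y0 Z0 mul0r mulr0 addr0 eqxx.
Qed.

Lemma disc_011 (e : F) : 0 * e + 1 * 1 != 0 :> F.
Proof. by rewrite mul0r add0r mulr1 oner_neq0. Qed.

Lemma plane_class_cubic_AS (e : F) : AS e -> plane_class (cubic_plane 0 1 1 e) = 14%N.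
Proof. by move=> eAS; rewrite plane_class_cubic ?disc_011 // asboolT //; apply/two_roots_AS. Qed.

Lemma plane_class_cubic_nAS (e : F) : ~ AS e -> plane_class (cubic_plane 0 1 1 e) = 12%N.
Proof.
move=> nAS; rewrite plane_class_cubic ?disc_011 // asboolF ?two_roots_AS // asboolT //.
by exists 1, 0; rewrite oner_neq0 /cub; split=> //; ring2.
Qed.

Lemma plane_class_cubic_no_root (a b c d : F) : ~ has_root a b c d ->
  plane_class (cubic_plane a b c d) = 13%N.
Proof.
move=> nr; rewrite plane_class_cubic ?no_root_disc // asboolF; last by move/two_roots_has_root.
by rewrite asboolF.
Qed.

Lemma plane_class_range U : plane_class U \in iota 1 15.
Proof. by rewrite /plane_class; do !case: ifP. Qed.

(** By [normal_form] each plane is equivalent to a plane that depends on its class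
only. *)
Lemma plane_class_complete U V : U \in rank1_planes F -> V \in rank1_planes F ->
  plane_class U = plane_class V -> eqv U V.
Proof.
have [e0 /nAS_Tr1 e0P] := Tr1_exists; have [c0 [_ _ c0P]] := no_root_exists.
pose ref := nth 0%VS [:: 0%VS; net sigma1; net sigma2; net sigma3; net sigma4; net sigma5;
  net (qc_plane 1 e0 0 0 0 0);
  net sigma7; net sigma8; net sigma9; net sigma10; net sigma11; cubic_plane 0 1 1 e0;
    cubic_plane 1 0 1 c0^-1; cubic_plane 0 1 1 0; net sigma15].
suff refP X : X \in rank1_planes F -> eqv X (ref (plane_class X)).
  by move=> Ur Vr UV; apply: eqv_trans (refP _ Ur) _; rewrite UV; apply: eqv_sym; exact: refP.
case/normal_form=> W XW; rewrite (plane_class_eqv XW) => WP; apply: eqv_trans XW _.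
case: WP => [| [al [ga [nAS ->]]] | [e ->] | [a [b [c [d [nr ->]]]]]].
- rewrite !inE; do 10?[case/orP]; move/eqP=> ->;
    rewrite ?(plane_class_sigma1, plane_class_sigma2, plane_class_sigma3, plane_class_sigma4,
      plane_class_sigma5, plane_class_sigma7, plane_class_sigma8, plane_class_sigma9,
        plane_class_sigma10, plane_class_sigma11, plane_class_sigma15);
    exact: eqv_refl.
- by rewrite plane_class_qc0 //; apply: qc_irr; rewrite ?mul1r.
- have [eAS|nAS] := pselect (AS e).
    by rewrite plane_class_cubic_AS //; apply: cubic_plane_AS; rewrite addr0.
  by rewrite plane_class_cubic_nAS //; apply: cubic_plane_AS; exact: nAS_D.
by rewrite plane_class_cubic_no_root //; exact: cubic_plane_no_root.
Qed.

Lemma orbits_of_list (L : seq {vspace 'rV[F]_6}) :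
  {subset L <= rank1_planes F} -> perm_eq (map plane_class L) (iota 1 15) ->
  perm_eq (enum (rank1_plane_orbits F)) [seq orbit 'P (K F) U | U <- L].
Proof.
move=> Lr classL; apply: uniq_perm; first exact: enum_uniq.
  have : uniq (map plane_class L) by rewrite (perm_uniq classL) iota_uniq.
  elim: L {Lr classL} => //= U L IH /andP[UL /IH ->]; rewrite andbT.
  apply: contra UL => /mapP[V VL /orbit_eqv UV]; apply/mapP; exists V => //.
  exact: plane_class_eqv.
move=> O; rewrite mem_enum; apply/imsetP/mapP => [[U Ur ->] | [U UL ->]]; last first.
  by exists U => //; exact: Lr.
have : plane_class U \in map plane_class L by rewrite (perm_mem classL) plane_class_range.
case/mapP=> V VL UV; exists V => //; apply/orbit_eqv.
by apply: plane_class_complete => //; exact: Lr.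
Qed.

Lemma sigma6_nAS (c : F) : Tr c^-1 = 1 -> ~ AS (c^-1 * c^-1).
Proof. by move=> Trc; apply/nAS_Tr1; rewrite Tr_sqr. Qed.

Lemma plane_class_sigma6 (c : F) : c != 0 -> Tr c^-1 = 1 -> plane_class (net (sigma6 c)) = 6%N.
Proof.
by move=> c0 Trc; rewrite (plane_class_eqv (sigma6_qc c0)) plane_class_qc0 //; exact: sigma6_nAS.
Qed.

Lemma Pi_disc (c : F) : c != 0 -> 1 * c^-1 + 0 * 1 != 0.
Proof. by move=> c0; rewrite mul1r mul0r addr0 invr_eq0. Qed.

Lemma plane_class_one_root (c : F) : c != 0 -> Tr c != Tr 1 -> plane_class (net (sigmaPi c)) = 12%N.
Proof.
move=> c0 cT; rewrite (plane_class_eqv (sigmaPi_cubic c0)) plane_class_cubic ?Pi_disc //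
  asboolF; last first.
  by move/(two_roots_Tr c0)=> E; rewrite E eqxx in cT.
by rewrite asboolT //; exact: Tr_has_root.
Qed.

Lemma plane_class_no_root (c : F) : c != 0 -> Tr c = Tr 1 -> ~ admissible c^-1 ->
  plane_class (net (sigmaPi c)) = 13%N.
Proof.
move=> c0 cT nadm; rewrite (plane_class_eqv (sigmaPi_cubic c0));
  apply: plane_class_cubic_no_root => hr.
by apply: nadm; apply: two_roots_adm => //; exact: root_Tr_two.
Qed.

Lemma plane_class_adm (c : F) : c != 0 -> admissible c^-1 -> plane_class (net (sigmaPi c)) = 14%N.
Proof.
move=> c0 adm; rewrite (plane_class_eqv (sigmaPi_cubic c0)) plane_class_cubic ?Pi_disc //
  asboolT //.
exact: adm_two_roots.
Qed.

Lemma Tr_1 : Tr 1 = (odd n2)%:R.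
Proof.
rewrite TrE (eq_bigr (fun=> 1)) => [|i _]; last by rewrite expr1n.
rewrite sumr_const card_ord -[in LHS](odd_double_half n2) mulrnDr -mul2n mulrnA.
by rewrite (_ : 1 *+ 2 = 0 :> F) ?mul0rn ?addr0 // mulr2n; ring2.
Qed.

Lemma Tr1E : Tr 1 = if odd n2 then 1 else 0.
Proof. by rewrite Tr_1; case: odd. Qed.

Lemma plane_class_cond12 (c : F) : cond12 charF2 c ->
  plane_class (net (sigmaPi c)) = if odd n2 then 13%N else 12%N.
Proof.
case=> c0 cT; have := Tr1E; case: ifP => _ T1 adm.
  by apply: plane_class_no_root => //; [rewrite cT T1 | exact: adm].
by apply: plane_class_one_root => //; rewrite cT T1 oner_neq0.
Qed.

Lemma plane_class_cond13 (c : F) : cond13 charF2 c ->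
  plane_class (net (sigmaPi c)) = if odd n2 then 12%N else 13%N.
Proof.
case=> c0 cT; have := Tr1E; case: ifP => _ T1 adm.
  by apply: plane_class_one_root => //; rewrite cT T1 eq_sym oner_neq0.
by apply: plane_class_no_root => //; [rewrite cT T1 | exact: adm].
Qed.

Lemma rank1_sigmaPi (c : F) : c != 0 -> net (sigmaPi c) \in rank1_planes F.
Proof. by move=> c0; rewrite (eqv_rank1_planes (sigmaPi_cubic c0)) rank1_qc. Qed.

Lemma rank1_cubic_plane (a b c d : F) : cubic_plane a b c d \in rank1_planes F.
Proof. exact: rank1_qc. Qed.

(** The order of the classes 12 and 13 depends on the parity of log2 q. *)
Lemma orbits_of_representatives (V6 V12 V13 V14 : {vspace 'rV[F]_6}) (n12 n13 : nat) :
  [&& V6 \in rank1_planes F, V12 \in rank1_planes F,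
    V13 \in rank1_planes F & V14 \in rank1_planes F] ->
  plane_class V6 = 6%N -> plane_class V12 = n12 -> plane_class V13 = n13 ->
    plane_class V14 = 14%N -> perm_eq [:: n12; n13] [:: 12; 13]%N ->
  perm_eq (enum (rank1_plane_orbits F)) [seq orbit 'P (K F) U | U <- [:: net sigma1;
    net sigma2; net sigma3; net sigma4; net sigma5;
     V6; net sigma7; net sigma8; net sigma9; net sigma10; net sigma11; V12; V13; V14; net sigma15]].
Proof.
move=> /and4P[r6 r12 r13 r14] c6 c12 c13 c14 n_perm; apply: orbits_of_list.
  apply/allP; rewrite /= r6 r12 r13 r14 (rank1_E11 dim_sigma1 E11_sigma1) (rank1_E11 dim_sigma2
    E11_sigma2).
  rewrite (rank1_E11 dim_sigma3 E11_sigma3) (rank1_E11 dim_sigma4 E11_sigma4) (rank1_E11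
    dim_sigma5 E11_sigma5).
  rewrite (rank1_E11 dim_sigma7 E11_sigma7) (rank1_E11 dim_sigma8 E11_sigma8) (rank1_E11
    dim_sigma9 E11_sigma9).
  by rewrite (rank1_E11 dim_sigma10 E11_sigma10) rank1_sigma11 (rank1_E11 dim_sigma15 E11_sigma15).
rewrite /= plane_class_sigma1 plane_class_sigma2 plane_class_sigma3 plane_class_sigma4
  plane_class_sigma5 c6 plane_class_sigma7 plane_class_sigma8 plane_class_sigma9
    plane_class_sigma10 plane_class_sigma11 c12 c13 c14 plane_class_sigma15.
exact: (perm_cat (perm_refl [:: 1; 2; 3; 4; 5; 6; 7; 8; 9; 10;
  11]%N) (perm_cat n_perm (perm_refl [:: 14; 15]%N))).
Qed.

Lemma card_orbits : #|rank1_plane_orbits F| = 15%N.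
Proof.
have [e0 /nAS_Tr1 e0P] := Tr1_exists; have [c0 [_ _ c0P]] := no_root_exists.
have := @orbits_of_representatives (net (qc_plane 1 e0 0 0 0 0)) (cubic_plane 0 1 1 e0)
  (cubic_plane 1 0 1 c0^-1) (cubic_plane 0 1 1 0) 12 13.
rewrite rank1_qc !rank1_cubic_plane plane_class_qc0 ?mul1r // plane_class_cubic_nAS //
  plane_class_cubic_no_root // plane_class_cubic_AS; last first.
  by exists 0; ring2.
by move=> /(_ isT erefl erefl erefl erefl isT)/perm_size; rewrite -cardE.
Qed.

Lemma exists_notin (s : seq F) : (size s < #|F|)%N -> exists t, t \notin s.
Proof.
rewrite cardT => lt_s; apply/existsP; apply: contraTT lt_s.
rewrite negb_exists -leqNgt => /forallP sF.
by apply: uniq_leq_size; [exact: enum_uniq | move=> t _; have := sF t; rewrite negbK].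
Qed.

Lemma cond6_exists : exists c : F, cond6 charF2 c.
Proof.
have [e eT] := Tr1_exists; exists e^-1; split; last by rewrite invrK.
rewrite invr_eq0; apply/eqP=> e0; move/eqP: eT.
by rewrite e0 Tr0 eq_sym oner_eq0.
Qed.

Lemma no_root_not_adm (c : F) : ~ has_root 1 0 1 c^-1 -> ~ admissible c^-1.
Proof. by move=> nr /adm_two_roots /two_roots_has_root. Qed.

Lemma cond12_exists : exists c : F, cond12 charF2 c.
Proof.
have [c [c0 cT /no_root_not_adm nadm]] := no_root_exists.
have := Tr1E; case: ifP => odd_n T1; first by exists c; split=> //; rewrite cT.
have [e eT] := Tr1_exists; exists e; split=> //; last by rewrite odd_n.
by apply/eqP=> e0; move/eqP: eT; rewrite e0 Tr0 eq_sym oner_eq0.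
Qed.

Lemma cond13_exists : #|F| <> 2%N -> exists c : F, cond13 charF2 c.
Proof.
move=> F2; have [c [c0 cT /no_root_not_adm nadm]] := no_root_exists.
have := Tr1E; case: ifP => odd_n T1; last by exists c; split=> //; rewrite cT.
have [|t] := @exists_notin [:: 0; 1].
  by have := finNzRing_gt1 F; rewrite leq_eqVlt => /orP[/eqP F2'|//]; case: F2.
rewrite !inE negb_or => /andP[t0 t1]; exists (t * t + t); split; last by rewrite odd_n.
  rewrite (_ : t * t + t = t * (t - 1)); last by ring2.
  by rewrite mulf_neq0 // subr_eq0.
exact: Tr_AS.
Qed.

(** Admissible elements exist as soon as F has an element outside F_4. *)
Lemma cond14_exists : (4 < #|F|)%N -> exists c : F, cond14 charF2 c.
Proof.
move=> F4; have [v [v0 v1 vD]] : exists v : F, [/\ v != 0, v != 1 & v ^+ 2 + v + 1 != 0].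
  have [[w wE]|nw] := pselect (AS 1).
    have [|v] := @exists_notin [:: 0; 1; w; w + 1]; first by [].
    rewrite !inE !negb_or => /and4P[v0 v1 vw vw1]; exists v; split=> //.
    apply/eqP; rewrite expr2 => vE; have : v * v + v = w * w + w.
      by rewrite -wE; transitivity (v * v + v + 1 + 1); [ring2 | rewrite vE add0r].
    by case/AS_fibre => E; [move: vw | move: vw1]; rewrite E eqxx.
  have [|v] := @exists_notin [:: 0; 1]; first by apply: leq_trans F4.
  rewrite !inE !negb_or => /andP[v0 v1]; exists v; split=> //.
  apply/eqP; rewrite expr2 => vE; apply: nw; exists v.
  by transitivity (v * v + v + 1 + (v * v + v)); [ring2 | rewrite vE add0r].
pose a := (v + v^-1) / (1 + v + v^-1) ^+ 3.
have a0 : a != 0.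
  rewrite mulf_neq0 ?invr_eq0 ?expf_neq0 //.
    rewrite (_ : v + v^-1 = (v - 1) * (v - 1) / v); last by field2.
    by rewrite !mulf_neq0 ?invr_eq0 // subr_eq0.
  rewrite (_ : 1 + v + v^-1 = (v ^+ 2 + v + 1) / v); last by field2.
  by rewrite mulf_neq0 ?invr_eq0.
have adm : admissible (a^-1)^-1 by rewrite invrK; exists v.
exists a^-1; split=> //; first by rewrite invr_eq0.
by apply: two_roots_Tr; [rewrite invr_eq0 | exact: adm_two_roots].
Qed.

Lemma plane_list_Sigma14 (c6 c12 c13 : F) (V14 : {vspace 'rV[F]_6}) :
  cond6 charF2 c6 -> cond12 charF2 c12 -> cond13 charF2 c13 ->
  V14 \in rank1_planes F -> plane_class V14 = 14%N ->
  perm_eq (enum (rank1_plane_orbits F))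
    [seq orbit 'P (K F) U | U <- representatives c6 c12 c13 V14].
Proof.
move=> [c6_0 c6_T] H12 H13 r14 cls14.
have [c12_0 _ _] := H12; have [c13_0 _ _] := H13.
have r6 : net (sigma6 c6) \in rank1_planes F by apply: rank1_E11 (dim_sigma6 _) (E11_sigma6 _).
apply: (orbits_of_representatives _ (plane_class_sigma6 c6_0 c6_T) (plane_class_cond12 H12)
  (plane_class_cond13 H13) cls14).
  by rewrite r6 !rank1_sigmaPi.
by case: ifP.
Qed.

Lemma plane_class_sigma14' : plane_class (net sigma14') = 14%N.
Proof. by rewrite (plane_class_eqv sigma14'_cubic) plane_class_cubic_AS //; exists 0; ring2. Qed.

Lemma rank1_sigma14' : net sigma14' \in rank1_planes F.
Proof. by rewrite (eqv_rank1_planes sigma14'_cubic) rank1_cubic_plane. Qed.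

End Classification.

Theorem theorem1p1 (F : finFieldType) (charF2 : 2%N \in [pchar F]) :
  #|rank1_plane_orbits F| = 15%N /\
  (#|F| <> 2%N ->
    [/\ exists c, cond6 charF2 c,
        exists c, cond12 charF2 c,
        exists c, cond13 charF2 c &
        (4 < #|F|)%N -> exists c, cond14 charF2 c] /\
    (forall c6 c12 c13 : F,
      cond6 charF2 c6 -> cond12 charF2 c12 -> cond13 charF2 c13 ->
      (#|F| = 4%N ->
        perm_eq (enum (rank1_plane_orbits F))
          [seq orbit 'P (K F) U | U <- representatives c6 c12 c13 (Sigma14' F)]) /\
      ((4 < #|F|)%N -> forall c14 : F, cond14 charF2 c14 ->
        perm_eq (enum (rank1_plane_orbits F))
          [seq orbit 'P (K F) U | U <- representatives c6 c12 c13 (Pi c14)]))).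
Proof.
split; first exact: (card_orbits charF2).
move=> F2; split.
  split; [exact: cond6_exists | exact: cond12_exists | exact: cond13_exists |].
  exact: cond14_exists.
move=> c6 c12 c13 H6 H12 H13; split=> [_ | _ c14 [c14_0 _ adm]].
  by apply: (plane_list_Sigma14 H6 H12 H13); [exact: rank1_sigma14' | exact: plane_class_sigma14'].
by apply: (plane_list_Sigma14 H6 H12 H13); [exact: rank1_sigmaPi | exact: plane_class_adm].
Qed.
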